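(* Let $\sigma=\begin{pmatrix} m'&m\\ n'&n\end{pmatrix}\in SL_2(\mathbb Z)$ with $n>0$, and let $u\in\mathbb C^*$ (with a fixed root $u^{1/n}$). There is an action of $\mathfrak{Diff}_q$ on $F^{na}\otimes\mathbb C[\mathbf Q_{(n)}]$ determined by the following formulas: $c$ acts by $n$, $c'$ acts by $n'$, $H_k=E_{0,k}$ ($k\ne0$) acts by $H^{tw}[k]=\sum_{b=0}^{n-1}a_b[k]$, and $E(z)$, $F(z)$ act by $$E^{tw}(z)=\sum_{\substack{0\le a,b\le n-1\\ b-a\equiv -n'\bmod n}}u^{\frac1n}q^{\frac{a+b-n}{2n}}z^{\frac{n'-a+b}{n}+1}:\exp\big(\phi_b(q^{1/2}z)-\phi_a(q^{-1/2}z)\big):\epsilon_{a,b},$$ $$F^{tw}(z)=\sum_{\substack{0\le a,b\le n-1\\ b-a\equiv n'\bmod n}}u^{-\frac1n}q^{\frac{-a-b+n}{2n}}z^{\frac{-n'-a+b}{n}+1}:\exp\big(\phi_b(q^{-1/2}z)-\phi_a(q^{1/2}z)\big):\epsilon_{a,b},$$ respectively. Here $\epsilon_{a,b}=\prod_r(-1)^{a_r[0]}$, where the product is over those $r$ such that $a-1\ge r\ge b$ for $a>b$, and $b-1\ge r\ge a$ for $b>a$. The representation obtained is isomorphic to $\mathcal F_u^\sigma$.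
   Context: $q\in\mathbb C^*$ is not a root of unity; compatible fractional powers of $q$ are fixed. The Lie algebra $\mathfrak{Diff}_q$ has basis $E_{k,l}$ ($(k,l)\in\mathbb Z^2\setminus\{(0,0)\}$), $c$, $c'$, with $c,c'$ central and $[E_{k,l},E_{r,s}]=(q^{(sk-lr)/2}-q^{(lr-sk)/2})E_{k+r,l+s}+\delta_{k,-r}\delta_{l,-s}(c'k+cl)$. It is generated by $c,c'$, $E_{1,k}$, $E_{-1,k}$, $H_k=E_{0,k}$; $E(z)=\sum_{k\in\mathbb Z}E_{1,k}z^{-k}$, $F(z)=\sum_{k\in\mathbb Z}E_{-1,k}z^{-k}$. Twists. $\sigma\in SL_2(\mathbb Z)$ acts by the automorphism $\sigma(E_{k,l})=E_{m'k+ml,\,n'k+nl}$, $\sigma(c')=m'c'+n'c$, $\sigma(c)=mc'+nc$. For a module $M$ with action $\rho_M$, $M^\sigma$ is the same space with action $\rho_M\circ\sigma$. Fock module $\mathcal F_u$: the Fock space of the Heisenberg algebra $[a_k,a_l]=k\delta_{k+l,0}$ (vacuum killed by $a_k$, $k>0$) with $c\mapsto1$, $c'\mapsto0$, $H_k\mapsto a_k$, $E(z)\mapsto\frac{u}{1-q}\exp\big(\sum_{k>0}\frac{q^{-k/2}-q^{k/2}}{k}a_{-k}z^k\big)\exp\big(\sum_{k<0}\frac{q^{-k/2}-q^{k/2}}{k}a_{-k}z^k\big)$, $F(z)\mapsto\frac{u^{-1}}{1-q^{-1}}\exp\big(\sum_{k>0}\frac{q^{k/2}-q^{-k/2}}{k}a_{-k}z^k\big)\exp\big(\sum_{k<0}\frac{q^{k/2}-q^{-k/2}}{k}a_{-k}z^k\big)$.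 $n$-boson space. The Heisenberg algebra is generated by $a_b[i]$ ($0\le b\le n-1$, $i\in\mathbb Z$) with $[a_{b_1}[i],a_{b_2}[j]]=i\delta_{b_1,b_2}\delta_{i+j,0}$. It is extended by operators $e^{Q_b}$; $e^{Q_b}$ commutes with all generators except $a_b[0]$, and $a_b[0]e^{Q_b}=e^{Q_b}(a_b[0]+1)$. $F^{na}$ is the Fock module of the $a_b[i]$, $i\ne0$, with cyclic vacuum vector killed by $a_b[i]$, $i>0$. $\mathbf Q_{(n)}$ is the lattice with basis $Q_0-Q_1,\dots,Q_{n-2}-Q_{n-1}$; $\mathbb C[\mathbf Q_{(n)}]$ is its group algebra (spanned by $e^\lambda$, $\lambda=\sum_i\lambda_iQ_i\in\mathbf Q_{(n)}$), on which $a_b[0]e^{\sum\lambda_iQ_i}=\lambda_be^{\sum\lambda_iQ_i}$ and $e^{\mu}$ ($\mu\in\mathbf Q_{(n)}$) acts by multiplication. On $F^{na}\otimes\mathbb C[\mathbf Q_{(n)}]$, $a_b[i]$ ($i\neq 0$) acts on the first factor, and $a_b[0]$ and $e^\mu$ act on the second. $\phi_b(z)=\sum_{j\ne0}\frac1ja_b[j]z^{-j}+Q_b+a_b[0]\log z$ ($Q_b$ is a formal symbol). The normally ordered exponent $:\exp(\dots):$ of a linear combination of the $a_b[i]$ and $Q_b$ is the product, from left to right, of: the exponential of the part with $a_b[i]$, $i<0$; that of the part with $a_b[i]$, $i>0$; the exponential of the $Q_b$ part; that of the $a_b[0]$ part (with $\exp(a_b[0]\log x)=x^{a_b[0]}$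).
   Formalization: The printed formulas violate [E_{1,k},E_{-1,-k}]=c'+ck; here ε_{a,b} has an extra minus sign for a>b, and for n=1 the only term a=b carries an extra factor (q^{-1/2}z−q^{1/2}z)^{-1} in E^{tw} and (q^{1/2}z−q^{-1/2}z)^{-1} in F^{tw}. *)

(* Defs.v *)
From HB Require Import structures.
From mathcomp Require Import all_boot all_order all_algebra.
From mathcomp Require Import finmap multiset monalg.
From mathcomp Require Import boolp classical_sets fsbigop reals complex.

Set Implicit Arguments.
Unset Strict Implicit.
Unset Printing Implicit Defensive.

Import Order.TTheory GRing.Theory Num.Theory.
Local Open Scope ring_scope.

(* Linear extension of a map defined on the basis K of the free module {malg A[K]}. *)
Definition malg_lift (A : fieldType) (K : choiceType) (V : lmodType A)
  (f : K -> V) (x : {malg A[K]}) : V := \sum_(k <- msupp x) x@_k *: f k.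

(* A compatible choice of the fractional powers of q; [qpow r] is q^r. *)
Definition fractional_powers (A : fieldType) (q : A) (qpow : rat -> A) : Prop :=
  qpow 1 = q /\ forall r s, qpow (r + s) = qpow r * qpow s.

(* inl (k, l) is E_{k,l}, inr true is c, inr false is c'. *)
Definition diffq_basis : choiceType := ({kl : int * int | kl != 0} + bool)%type.

(* C is modelled as R[i] for R : realType. *)
Definition diffq (R : realType) := {malg R[i][diffq_basis]}.

(* E_{k,l}, with the convention E_{0,0} = 0. *)
Definition dE (R : realType) (k l : int) : diffq R :=
  if insub (k, l) is Some kl then << inl kl >> else 0.
Definition dc (R : realType) : diffq R := << inr true >>.
Definition dc' (R : realType) : diffq R := << inr false >>.

Definition bracket_basis (R : realType) (qpow : rat -> R[i])
    (x y : diffq_basis) : diffq R :=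
  match x, y with
  | inl i, inl j =>
    let: (k, l) := val i in
    let: (r, s) := val j in
    (qpow ((s * k - l * r)%:Q / 2) - qpow ((l * r - s * k)%:Q / 2))
        *: dE R (k + r) (l + s)
    + (if (k == - r) && (l == - s) then k%:~R *: dc' R + l%:~R *: dc R else 0)
  | _, _ => 0
  end.

Definition bracket (R : realType) (qpow : rat -> R[i]) (x y : diffq R) : diffq R :=
  malg_lift (fun i => malg_lift (bracket_basis qpow i) y) x.

Definition is_rep (R : realType) (qpow : rat -> R[i]) (V : lmodType R[i])
    (rho : diffq R -> V -> V) : Prop :=
  [/\ forall x, linear (rho x),
      forall v, linear (rho^~ v)
    & forall x y v, rho (bracket qpow x y) v = rho x (rho y v) - rho y (rho x v)].

Definition rep_iso (R : realType) (V W : lmodType R[i])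
    (rho : diffq R -> V -> V) (rho' : diffq R -> W -> W) : Prop :=
  exists2 f : {linear V -> W}, bijective f
    & forall x v, f (rho x v) = rho' x (f v).

(* sigma = (m' m; n' n). *)
Definition sl2_basis (R : realType) (sigma : 'M[int]_2) (x : diffq_basis) : diffq R :=
  let: (m', m, n', n) := (sigma 0 0, sigma 0 1, sigma 1 0, sigma 1 1) in
  match x with
  | inl i => let: (k, l) := val i in dE R (m' * k + m * l) (n' * k + n * l)
  | inr true => m%:~R *: dc' R + n%:~R *: dc R
  | inr false => m'%:~R *: dc' R + n'%:~R *: dc R
  end.

Definition sl2_act (R : realType) (sigma : 'M[int]_2) : diffq R -> diffq R :=
  malg_lift (sl2_basis R sigma).

Definition twist (R : realType) (V : lmodType R[i]) (sigma : 'M[int]_2)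
  (rho : diffq R -> V -> V) : diffq R -> V -> V := fun x => rho (sl2_act sigma x).

(* Coefficient of t^m in (\sum_(k >= 1) X_k t^k)^j. *)
Fixpoint pow_coef (A : fieldType) (V : lmodType A) (X : nat -> V -> V)
    (j m : nat) (v : V) : V :=
  if j is j'.+1 then \sum_(1 <= k < m.+1) X k (pow_coef X j' (m - k) v)
  else if m == 0%N then v else 0.

(* Coefficient of t^m in exp (\sum_(k >= 1) X_k t^k); powers j > m do not contribute. *)
Definition exp_coef (A : fieldType) (V : lmodType A) (X : nat -> V -> V)
    (m : nat) (v : V) : V :=
  \sum_(0 <= j < m.+1) (j`!%:R)^-1 *: pow_coef X j m v.

(* Coefficient of z^N in
     exp (\sum_(k > 0) X_k z^k) exp (\sum_(k < 0) X_k z^k) (\sum_M Z_M z^M)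
   applied to v.  The sum is over finite support (and would be 0 if the support
   were infinite); in the Fock spaces below only finitely many terms are nonzero. *)
Definition normal_coef (A : fieldType) (V : lmodType A)
    (X Z : int -> V -> V) (N : int) (v : V) : V :=
  \sum_(rp \in [set: nat * nat])
    exp_coef (fun k => X k%:Z) rp.1
      (exp_coef (fun k => X (- k%:Z)) rp.2 (Z (N - rp.1%:Z + rp.2%:Z) v)).

(* Occupation numbers of the creation operators: the multiplicity of (b, k)
   is the exponent of a_b[-(k+1)] in the monomial applied to the vacuum. *)
Definition occupation (T : choiceType) : choiceType := {mset T * nat}%mset.

Definition fock (R : realType) (T : choiceType) := {malg R[i][occupation T]}.

(* a_b[i] S = c S' with (c, S') = osc b i S, for i != 0. *)
Definition osc (R : realType) (T : choiceType) (b : T) (i : int)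
    (S : occupation T) : R[i] * occupation T :=
  match i with
  | Posz 0 => (0, S)
  | Posz k.+1 => ((k.+1 * S (b, k))%:R, (S `\ (b, k))%mset)
  | Negz k => (1, ((b, k) +` S)%mset)
  end.

Definition heis (R : realType) (T : choiceType) (b : T) (i : int) :
    fock R T -> fock R T :=
  malg_lift (fun S => let: (c, S') := osc R b i S in c *: << S' >>).

(* Coefficients of z^{-l} in the images of E(z) and F(z); here X_k is the
   coefficient of z^k in the exponent, and a_0 does not occur. *)
Definition fock_E (R : realType) (q : R[i]) (qpow : rat -> R[i]) (u : R[i]) (l : int)
    (v : fock R unit) : fock R unit :=
  (u / (1 - q)) *:
    normal_coef
      (fun k w => ((qpow (- k%:Q / 2) - qpow (k%:Q / 2)) / k%:~R) *: heis tt (- k) w)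
      (fun M w => if M == 0 then w else 0) (- l) v.

Definition fock_F (R : realType) (q : R[i]) (qpow : rat -> R[i]) (u : R[i]) (l : int)
    (v : fock R unit) : fock R unit :=
  (u^-1 / (1 - q^-1)) *:
    normal_coef
      (fun k w => ((qpow (k%:Q / 2) - qpow (- k%:Q / 2)) / k%:~R) *: heis tt (- k) w)
      (fun M w => if M == 0 then w else 0) (- l) v.

Definition is_fock_module (R : realType) (q : R[i]) (qpow : rat -> R[i]) (u : R[i])
    (rho : diffq R -> fock R unit -> fock R unit) : Prop :=
  [/\ is_rep qpow rho,
      forall v, rho (dc R) v = v /\ rho (dc' R) v = 0,
      forall k v, k != 0 -> rho (dE R 0 k) v = heis tt k v,
      forall k v, rho (dE R 1 k) v = fock_E q qpow u k v
    & forall k v, rho (dE R (-1) k) v = fock_F q qpow u k v].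

(* \sum_b l_b Q_b lies in the span of the Q_b - Q_{b+1} iff its coordinates sum to 0. *)
Definition root_pred (n : nat) : pred {ffun 'I_n -> int} :=
  fun l => \sum_b l b == 0.

Definition root_lattice (n : nat) : choiceType := {l : {ffun 'I_n -> int} | root_pred l}.

Definition Qvec (n : nat) (b : 'I_n) : {ffun 'I_n -> int} := [ffun c => (c == b)%:R].

Lemma shift_subproof (n : nat) (b a : 'I_n) (l : root_lattice n) :
  root_pred (val l + (Qvec b - Qvec a)).
Proof.
have sumQ c : \sum_d Qvec c d = 1.
  rewrite (bigD1 c) //= ffunE eqxx big1 ?addr0 // => d /negPf dc.
  by rewrite ffunE dc.
have /eqP l0 := valP l; rewrite /root_pred.
have -> : \sum_c (val l + (Qvec b - Qvec a)) c
        = \sum_c (val l c + (Qvec b c - Qvec a c)).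
  by apply: eq_bigr => c _; rewrite !ffunE.
by rewrite big_split sumrB /= l0 !sumQ.
Qed.

(* l |-> l + Q_b - Q_a, i.e. multiplication by e^{Q_b - Q_a}. *)
Definition shift (n : nat) (b a : 'I_n) (l : root_lattice n) : root_lattice n :=
  exist _ (val l + (Qvec b - Qvec a)) (shift_subproof b a l).

(* F^{na} \otimes C[Q_(n)], with basis the S \otimes e^l. *)
Definition boson_space (R : realType) (n : nat) :=
  {malg R[i][(occupation 'I_n * root_lattice n)%type]}.

(* a_b[i], including i = 0. *)
Definition boson (R : realType) (n : nat) (b : 'I_n) (i : int) :
    boson_space R n -> boson_space R n :=
  malg_lift (fun Sl : occupation 'I_n * root_lattice n =>
    if i == 0 then (val Sl.2 b)%:~R *: << Sl >>
    else let: (c, S') := osc R b i Sl.1 in c *: << (S', Sl.2) >>).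

(* Coefficient of z^k, k != 0, in phi_b(q^s z): the term j = -k of
   \sum_(j != 0) j^-1 a_b[j] (q^s z)^-j. *)
Definition phi_osc (R : realType) (qpow : rat -> R[i]) (n : nat) (b : 'I_n) (s : rat)
    (k : int) (v : boson_space R n) : boson_space R n :=
  ((- k)%:~R^-1 * qpow (k%:Q * s)) *: boson b (- k) v.

(* Coefficient of z^M in
   e^{Q_b - Q_a} exp (a_b[0] log (q^s z) - a_a[0] log (q^t z)). *)
Definition zero_modes (R : realType) (qpow : rat -> R[i]) (n : nat) (b : 'I_n) (s : rat)
    (a : 'I_n) (t : rat) (M : int) : boson_space R n -> boson_space R n :=
  malg_lift (fun Sl : occupation 'I_n * root_lattice n =>
    let: (lb, la) := (val Sl.2 b, val Sl.2 a) in
    if lb - la == M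
    then qpow (s * lb%:Q - t * la%:Q) *: << (Sl.1, shift b a Sl.2) >> else 0).

(* Coefficient of z^N in :exp (phi_b(q^s z) - phi_a(q^t z)): *)
Definition vertex (R : realType) (qpow : rat -> R[i]) (n : nat) (b : 'I_n) (s : rat)
    (a : 'I_n) (t : rat) (N : int) : boson_space R n -> boson_space R n :=
  normal_coef (fun k w => phi_osc qpow b s k w - phi_osc qpow a t k w)
              (zero_modes qpow b s a t) N.

(* \prod_r (-1)^{a_r[0]} over min(a,b) <= r < max(a,b). *)
Definition klein (R : realType) (n : nat) (a b : 'I_n) :
    boson_space R n -> boson_space R n :=
  malg_lift (fun Sl : occupation 'I_n * root_lattice n =>
    ((-1) ^ (\sum_(r : 'I_n | (minn a b <= r < maxn a b)%N) val Sl.2 r)) *: << Sl >>).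

(* Coefficient of z^N in the product e^{-phi_a(q^t z)} e^{phi_b(q^s z)} of the
   two fermion fields of the boson-fermion correspondence.
   - For a != b it is :exp (phi_b(q^s z) - phi_a(q^t z)): \epsilon_{a,b} with
     \epsilon_{a,b} = klein if a < b and \epsilon_{a,b} = - klein if a > b.
     The sign is what is left of the Klein factors \prod_(r < a) (-1)^{a_r[0]}
     and \prod_(r < b) (-1)^{a_r[0]} of the two fields once they are collected
     on the right.  It cannot be dropped: klein anticommutes with
     e^{Q_b - Q_a}, so without it the (a,b) term of E and the (b,a) term of F
     would contribute to [E(z), F(w)] with the wrong sign.
   - For a = b (which occurs only when n = 1) reordering the two fields produces
     the contraction 1 / (q^t z - q^s z). *)
Definition fermion_pair (R : realType) (qpow : rat -> R[i]) (n : nat) (b : 'I_n)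
    (s : rat) (a : 'I_n) (t : rat) (N : int) (v : boson_space R n) : boson_space R n :=
  if a == b then (qpow t - qpow s)^-1 *: vertex qpow b s a t (N + 1) v
  else (-1) ^+ (b < a)%N *: vertex qpow b s a t N (klein a b v).

(* In tw_E and tw_F, n' is the eigenvalue of c', and un the chosen root u^{1/n}; l selects
   the coefficient of z^{-l}.  The divisions by n in the exponents of z are exact. *)
Definition tw_E (R : realType) (qpow : rat -> R[i]) (n : nat) (n' : int) (un : R[i])
    (l : int) (v : boson_space R n) : boson_space R n :=
  \sum_(a < n) \sum_(b < n | (b%:Z - a%:Z == - n' %[mod n%:Z])%Z)
    (un * qpow ((a%:Q + b%:Q - n%:Q) / (2 * n%:Q))) *:
      fermion_pair qpow b (1 / 2) a (- (1 / 2))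
        (- l - (((n' - a%:Z + b%:Z) %/ n%:Z)%Z + 1)) v.

Definition tw_F (R : realType) (qpow : rat -> R[i]) (n : nat) (n' : int) (un : R[i])
    (l : int) (v : boson_space R n) : boson_space R n :=
  \sum_(a < n) \sum_(b < n | (b%:Z - a%:Z == n' %[mod n%:Z])%Z)
    (un^-1 * qpow ((- a%:Q - b%:Q + n%:Q) / (2 * n%:Q))) *:
      fermion_pair qpow b (- (1 / 2)) a (1 / 2)
        (- l - (((- n' - a%:Z + b%:Z) %/ n%:Z)%Z + 1)) v.

Definition is_twisted_boson_rep (R : realType) (qpow : rat -> R[i]) (n : nat) (n' : int)
    (un : R[i]) (rho : diffq R -> boson_space R n -> boson_space R n) : Prop :=
  [/\ is_rep qpow rho,
      forall v, rho (dc R) v = n%:R *: v /\ rho (dc' R) v = n'%:~R *: v,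
      forall k v, k != 0 -> rho (dE R 0 k) v = \sum_(b < n) boson b k v,
      forall k v, rho (dE R 1 k) v = tw_E qpow n' un k v
    & forall k v, rho (dE R (-1) k) v = tw_F qpow n' un k v].

(* Main.v *)
From HB Require Import structures.
Require Import Defs.
From mathcomp Require Import all_boot all_order all_algebra.
From mathcomp Require Import finmap multiset monalg.
From mathcomp Require Import boolp classical_sets fsbigop reals complex.
From mathcomp Require Import zify ring.
Set Implicit Arguments.
Unset Strict Implicit.
Unset Printing Implicit Defensive.

Import Order.TTheory GRing.Theory Num.Theory.
Local Open Scope ring_scope.

(** Both modules are a single module of charge-zero fermions, seen through two
    boson-fermion correspondences and one diagonal rescaling of the fermions.

    Take fermions psi_j, psi*_j indexed by j in Z, acting on the span of the Maya
    diagrams.  The normally ordered sums of the al(j) psi_{j+l} psi*_j close under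
    the bracket up to the usual scalar cocycle of gl_infinity ([cur_bracket]).  For
    n > 0, an integer n' and y <> 0 put d = n'k + nl and let E_{k,l} act by
      y^k sum_j q^{(k/n)(j + d/2)} :psi_{j+d} psi*_j:  +  [d = 0] y^k / (1 - q^{k/n}).
    The coefficients multiply like monomials of the quantum torus and the cocycle is
    a geometric sum, so this is a representation of Diff_q in which c acts by n and
    c' by n' ([diff_op_bracket], [fermion_rep_rep]).

    The twisted bosonic module is this representation for (n, n', u^{1/n}).  Sorting
    the fermions by the residue of j modulo n gives n fermion fields, whose Heisenberg
    currents act on charge-zero fermions as the a_b[k] act on the bosonic space.  The
    resulting map [PhiN] is injective because a bosonic Fock vector is determined by
    the results of lowering it, and surjective because the Sugawara operator is
    diagonal on Maya diagrams with eigenvalues in N, and 0 only when the component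
    concerned is a shifted vacuum ([sugawara]): every other diagram is produced by
    creation operators from diagrams of lower energy.  Bilinears in two distinct
    fermion fields and vertex operators have the same commutators with the Heisenberg
    currents and the same leading terms on charged vacua, hence agree
    ([bosonization]); the order of the indices used for the fermion signs is chosen so
    that these leading terms carry the signs of [fermion_pair].  Grouping the terms of
    E_{1,l} and E_{-1,l} by residues gives [tw_E] and [tw_F] ([diff_op_split]).  The
    same argument with one component and (n, n', y) = (1, 0, u) gives the Fock module
    F_u ([fock_module]).

    Finally, multiply psi_j by g_j = u^{mj/n} q^{m j^2 / (2n)}.  Since m'n - mn' = 1,
    the ratios g_{j+d} / g_j turn the formula for E_{k,l} in the representation
    (n, n', u^{1/n}) into the formula for E_{m'k+ml, n'k+nl} in the representation
    (1, 0, u) ([diff_op_gauge]); this is the isomorphism with the twisted Fock module.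
    Uniqueness holds because c, c', the E_{0,k} and the E_{1,k}, E_{-1,k} generate
    Diff_q ([rep_generated]). *)

(** * Linear maps out of a free module *)

Section FreeModule.
Variables (A : fieldType) (K : choiceType).
Implicit Types (V : lmodType A) (x : {malg A[K]}).

Lemma malg_basisE x : x = \sum_(k <- msupp x) x@_k *: << k >>.
Proof.
rewrite {1}(monalgE x); apply: eq_bigr => k _.
by apply/malgP => j; rewrite mcoeffZ !mcoeffU mulr_natr.
Qed.

Lemma malg_liftEw V (f : K -> V) x (s : {fset K}) :
  {subset msupp x <= s} -> malg_lift f x = \sum_(k <- s) x@_k *: f k.
Proof.
move=> /fsubsetP sub; rewrite /malg_lift (big_fset_incl _ sub) // => k _ kx.
by rewrite mcoeff_outdom // scale0r.
Qed.

Lemma malg_lift_is_linear V (f : K -> V) : linear (malg_lift f).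
Proof.
move=> c x y; pose s := (msupp x `|` msupp y)%fset.
have sx : {subset msupp x <= s} by move=> k kx; rewrite inE kx.
have sy : {subset msupp y <= s} by move=> k ky; rewrite inE ky orbT.
have sxy : {subset msupp (c *: x + y) <= s}.
  move=> k; rewrite -mcoeff_neq0 mcoeffD mcoeffZ inE -!mcoeff_neq0.
  by have [->|] := eqVneq x@_k 0; have [->|] := eqVneq y@_k 0; rewrite ?mulr0 ?addr0 ?eqxx.
rewrite (malg_liftEw f sx) (malg_liftEw f sy) (malg_liftEw f sxy).
rewrite scaler_sumr -big_split; apply: eq_bigr => k _ /=.
by rewrite mcoeffD mcoeffZ scalerDl scalerA.
Qed.

HB.instance Definition _ V (f : K -> V) :=
  GRing.isLinear.Build A {malg A[K]} V _ (malg_lift f) (malg_lift_is_linear f).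

Lemma malg_liftU V (f : K -> V) k : malg_lift f << k >> = f k.
Proof. by rewrite /malg_lift msuppU oner_eq0 big_seq_fset1 mcoeffUU scale1r. Qed.

Lemma malg_ext V (f g : {malg A[K]} -> V) :
  linear f -> linear g -> (forall k, f << k >> = g << k >>) -> f =1 g.
Proof.
move=> lf lg fg x.
pose F : {linear _ -> _} := HB.pack f (GRing.isLinear.Build _ _ _ _ f lf).
pose G : {linear _ -> _} := HB.pack g (GRing.isLinear.Build _ _ _ _ g lg).
rewrite -[f]/(F : _ -> _) -[g]/(G : _ -> _) (malg_basisE x) !linear_sum.
by apply: eq_bigr => k _; rewrite !linearZ /= fg.
Qed.

Lemma malg_lift_coeff1 (K' : choiceType) (f : K -> {malg A[K']}) x k' k1 :
  (forall k, k != k1 -> (f k)@_k' = 0) ->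
  (malg_lift f x)@_k' = x@_k1 * (f k1)@_k'.
Proof.
move=> f0; rewrite /malg_lift raddf_sum /=.
rewrite (eq_big_seq (fun k => x@_k * (f k)@_k')) => [|k _]; last by rewrite mcoeffZ.
case: (boolP (k1 \in msupp x)) => [k1x|k1x].
  rewrite (big_fsetD1 k1 k1x) /= big1_seq ?addr0 // => k /andP[_].
  by rewrite !inE => /andP[kk1 _]; rewrite f0 ?mulr0.
rewrite (mcoeff_outdom k1x) mul0r big1_seq // => k /andP[_ kx].
by rewrite f0 ?mulr0 //; apply: contraNneq k1x => <-.
Qed.

End FreeModule.

Section LinearOps.
Variables (A : fieldType) (U V W : lmodType A).
Implicit Types (f g : U -> V).

Lemma linear_idf : linear (fun x : U => x). Proof. by []. Qed.

Lemma linear_compf (g : V -> W) (f : U -> V) :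
  linear g -> linear f -> linear (fun x => g (f x)).
Proof. by move=> lg lf c x y; rewrite lf lg. Qed.

Lemma linear_addf f g : linear f -> linear g -> linear (fun x => f x + g x).
Proof. by move=> lf lg c x y; rewrite lf lg scalerDr addrACA. Qed.

Lemma linear_oppf f : linear f -> linear (fun x => - f x).
Proof. by move=> lf c x y; rewrite lf opprD scalerN. Qed.

Lemma linear_subf f g : linear f -> linear g -> linear (fun x => f x - g x).
Proof. by move=> lf lg; apply/linear_addf/linear_oppf. Qed.

Lemma linear_scalef a f : linear f -> linear (fun x => a *: f x).
Proof. by move=> lf c x y; rewrite lf scalerDr !scalerA mulrC. Qed.

Lemma linear_0f : linear (fun _ : U => 0 : V).
Proof. by move=> c x y; rewrite scaler0 addr0. Qed.

Lemma linear_iff (b : bool) f g :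
  linear f -> linear g -> linear (fun x => if b then f x else g x).
Proof. by case: b. Qed.

Lemma linear_sumf (I : Type) (r : seq I) (P : pred I) (F : I -> U -> V) :
  (forall i, linear (F i)) -> linear (fun x => \sum_(i <- r | P i) F i x).
Proof.
move=> lF; elim: r => [|i r IH] c x y; first by rewrite !big_nil scaler0 addr0.
by rewrite !big_cons; case: (P i); rewrite IH // lF scalerDr addrACA.
Qed.

Lemma linear_additive f : linear f -> {morph f : x y / x + y}.
Proof. by move=> lf x y; rewrite -[x]scale1r lf !scale1r. Qed.
Lemma linear_0 f : linear f -> f 0 = 0.
Proof. by move=> lf; apply: (addIr (f 0)); rewrite add0r -(linear_additive lf) add0r. Qed.
Lemma linear_homo f : linear f -> forall c x, f (c *: x) = c *: f x.
Proof. by move=> lf c x; have := lf c x 0; rewrite (linear_0 lf) !addr0. Qed.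
Lemma linear_opp f : linear f -> {morph f : x / - x}.
Proof. by move=> lf x; rewrite -scaleN1r (linear_homo lf) scaleN1r. Qed.
Lemma linear_sub f : linear f -> {morph f : x y / x - y}.
Proof. by move=> lf x y; rewrite (linear_additive lf) (linear_opp lf). Qed.
Lemma linear_bigsum f : linear f -> forall (I : Type) (r : seq I) (P : pred I) (F : I -> U),
  f (\sum_(i <- r | P i) F i) = \sum_(i <- r | P i) f (F i).
Proof.
by move=> lf I r P F; apply: big_morph; [exact: linear_additive|exact: linear_0].
Qed.
End LinearOps.

(** * Fermions on Maya diagrams *)

(** A diagram is encoded by the finite set of positions at which it differs from the
    vacuum, in which exactly the positions j >= 0 are filled. *)
Definition maya := {fset int}.

Definition filled (D : maya) (j : int) : bool := (0 <= j) (+) (j \in D).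
Definition toggle (j : int) (D : maya) : maya :=
  (if j \in D then D `\ j else j |` D)%fset.

Lemma in_toggle i j D : (i \in toggle j D) = (i == j) (+) (i \in D).
Proof.
rewrite /toggle; case: (boolP (j \in D)) => jD; rewrite !inE.
  by case: eqP => [->|_]; rewrite ?jD.
by case: eqP => [->|_]; rewrite ?(negPf jD).
Qed.

Lemma filled_toggle i j D : filled (toggle j D) i = (i == j) (+) filled D i.
Proof. by rewrite /filled in_toggle addbCA. Qed.

Lemma toggleK j : involutive (toggle j).
Proof. by move=> D; apply/fsetP => i; rewrite !in_toggle addbA addbb. Qed.

Lemma toggleC i j D : toggle i (toggle j D) = toggle j (toggle i D).
Proof. by apply/fsetP => k; rewrite !in_toggle addbCA. Qed.

Lemma filled_inj D D' : filled D =1 filled D' -> D = D'.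
Proof. by move=> e; apply/fsetP => i; have := e i; rewrite /filled => /addbI. Qed.

Lemma filled0 j : filled fset0 j = (0 <= j).
Proof. by rewrite /filled inE addbF. Qed.

Lemma big_toggle (A : fieldType) (F G : int -> A) j D :
    (F j * G j = 1) ->
  \prod_(i <- toggle j D) F i = (if j \in D then G j else F j) * \prod_(i <- D) F i.
Proof.
move=> FG; rewrite /toggle; case: (boolP (j \in D)) => jD.
  by rewrite (big_fsetD1 j jD) /= mulrA [G j * _]mulrC FG mul1r.
by rewrite big_fsetU1.
Qed.

(** Orders used for the fermion signs: exactly one of i, j comes first when they differ,
    which is what makes psi_i and psi_j anticommute.  The choice of the order is left
    open, since the n-component correspondence needs a particular one. *)
Definition tournament (lt : rel int) :=
  (forall i, lt i i = false) /\ (forall i j, i != j -> lt j i = ~~ lt i j).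

(** The free module on the diagrams is kept behind an isomorphism that does not reduce,
    so that comparing two fermionic vectors never unfolds them to coefficient maps. *)
Record free_copy (A : fieldType) (K : choiceType) := FreeCopy {
  copy_sort : lmodType A;
  copy_of : {malg A[K]} -> copy_sort;
  copy_to : copy_sort -> {malg A[K]};
  copy_of_linear : linear copy_of;
  copy_to_linear : linear copy_to;
  copy_ofK : cancel copy_of copy_to;
  copy_toK : cancel copy_to copy_of }.

Lemma free_copy_exists (A : fieldType) (K : choiceType) : free_copy A K.
Proof. by exists {malg A[K]} id id. Qed.

Definition fermions (A : fieldType) : lmodType A := copy_sort (free_copy_exists A maya).

Section Kets.
Variable A : fieldType.
Local Notation F := (fermions A).
Let fcopy := free_copy_exists A maya.

Definition ket (D : maya) : F := copy_of fcopy << D >>.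
Definition coef (D : maya) (v : F) : A := (copy_to v)@_D.
Definition ksupp (v : F) : {fset maya} := msupp (copy_to v).
Definition lift (V : lmodType A) (f : maya -> V) (v : F) : V := malg_lift f (copy_to v).

Lemma coef_linear D : linear (coef D : F -> A^o).
Proof. by move=> c x y; rewrite /coef copy_to_linear mcoeffD mcoeffZ. Qed.

Lemma coefD D : {morph coef D : x y / x + y}.
Proof. exact: (linear_additive (coef_linear D)). Qed.
Lemma coefN D : {morph coef D : x / - x}.
Proof. exact: (linear_opp (coef_linear D)). Qed.
Lemma coefB D : {morph coef D : x y / x - y}.
Proof. exact: (linear_sub (coef_linear D)). Qed.
Lemma coefZ D c x : coef D (c *: x) = c * coef D x.
Proof. exact: (linear_homo (coef_linear D)). Qed.
Lemma coef0 D : coef D 0 = 0.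
Proof. exact: (linear_0 (coef_linear D)). Qed.
Lemma coef_sum D (I : Type) (r : seq I) (P : pred I) (f : I -> F) :
  coef D (\sum_(i <- r | P i) f i) = \sum_(i <- r | P i) coef D (f i).
Proof. exact: (linear_bigsum (coef_linear D)). Qed.

Lemma coefP v w : (forall D, coef D v = coef D w) -> v = w.
Proof. by move=> e; apply: (can_inj (@copy_toK _ _ fcopy)); apply/malgP. Qed.

Lemma coef_ket D D' : coef D' (ket D) = (D == D')%:R.
Proof. by rewrite /coef /ket copy_ofK mcoeffU. Qed.

Lemma mem_ksupp D v : (D \in ksupp v) = (coef D v != 0).
Proof. by rewrite mcoeff_neq0. Qed.

Lemma lift_linear (V : lmodType A) (f : maya -> V) : linear (lift f).
Proof. by move=> c x y; rewrite /lift copy_to_linear linearP. Qed.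

Lemma lift_ket (V : lmodType A) (f : maya -> V) D : lift f (ket D) = f D.
Proof. by rewrite /lift /ket copy_ofK malg_liftU. Qed.

Lemma ketE v : v = \sum_(D <- ksupp v) coef D v *: ket D.
Proof.
rewrite -[LHS](@copy_toK _ _ fcopy) {1}(malg_basisE (copy_to v)).
rewrite (linear_bigsum (@copy_of_linear _ _ fcopy)); apply: eq_bigr => D _.
by rewrite (linear_homo (@copy_of_linear _ _ fcopy)).
Qed.

Lemma ket_ext (V : lmodType A) (f g : F -> V) :
  linear f -> linear g -> (forall D, f (ket D) = g (ket D)) -> f =1 g.
Proof.
move=> lf lg fg v; rewrite (ketE v) (linear_bigsum lf) (linear_bigsum lg).
by apply: eq_bigr => D _; rewrite (linear_homo lf) (linear_homo lg) fg.
Qed.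

Lemma lift_coef1 (f : maya -> F) x D' D1 :
  (forall D, D != D1 -> coef D' (f D) = 0) -> coef D' (lift f x) = coef D1 x * coef D' (f D1).
Proof.
move=> f0; rewrite {1}(ketE x) (linear_bigsum (lift_linear f)) coef_sum.
under eq_bigr => D _ do rewrite (linear_homo (lift_linear f)) lift_ket coefZ.
case: (boolP (D1 \in ksupp x)) => [k1x|].
  rewrite (big_fsetD1 D1 k1x) /= big1_seq ?addr0 // => D /andP[_].
  by rewrite !inE => /andP[DD1 _]; rewrite f0 ?mulr0.
rewrite mem_ksupp negbK => /eqP D10; rewrite D10 mul0r big1 // => D _.
by have [->|DD1] := eqVneq D D1; rewrite ?D10 ?mul0r // f0 ?mulr0.
Qed.

End Kets.

(** Jordan-Wigner sign.  Only the positions that differ from the vacuum are counted: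
    a product over all filled positions would be infinite. *)
HB.lock Definition jw_sign (A : fieldType) (lt : rel int) (D : maya) (j : int) : A :=
  \prod_(i <- D) (-1) ^+ lt i j.

(** psi*_j, which empties position j, for e = true; psi_j, which fills it, for
    e = false.  A common name makes the canonical anticommutation relations one lemma. *)
HB.lock Definition fc (A : fieldType) (lt : rel int) (e : bool) (j : int) :
    fermions A -> fermions A :=
  lift (fun D => if filled D j == e then jw_sign A lt D j *: ket A (toggle j D)
                      else 0 : fermions A).

Section Fermions.
Variables (A : fieldType) (lt : rel int).
Hypothesis ltP : tournament lt.

Local Notation F := (fermions A).
Local Notation jw_sign := (@jw_sign A lt).
Local Notation fc := (@fc A lt).
Local Notation ket := (ket A).

Lemma jw_sign_toggle D i j : jw_sign (toggle i D) j = (-1) ^+ lt i j * jw_sign D j.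
Proof.
rewrite jw_sign.unlock (big_toggle (G := fun i => (-1) ^+ lt i j)) ?if_same //.
by rewrite -signr_addb addbb.
Qed.

Lemma jw_sign_sqr D j : jw_sign D j * jw_sign D j = 1.
Proof.
rewrite jw_sign.unlock -big_split big1_seq //= => i _.
by rewrite -signr_addb addbb.
Qed.

Lemma jw_sign_neq0 D j : jw_sign D j != 0.
Proof. by apply: contra_eq_neq (jw_sign_sqr D j) => ->; rewrite mul0r eq_sym oner_neq0. Qed.

Lemma fc_linear e j : linear (fc e j). Proof. by rewrite fc.unlock; exact: lift_linear. Qed.
HB.instance Definition _ e j := GRing.isLinear.Build A F F _ (fc e j)
  (fc_linear e j).

Lemma fcU e j D :
  fc e j (ket D) = if filled D j == e then jw_sign D j *: ket (toggle j D) else 0.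
Proof. by rewrite fc.unlock lift_ket. Qed.

Lemma fc_coeff e j D v : filled D j == e -> coef (toggle j D) (fc e j v) = jw_sign D j * coef D v.
Proof.
move=> De; rewrite fc.unlock (lift_coef1 _ (D1 := D)) => [|D' D'D].
  by rewrite De coefZ coef_ket eqxx mulr1 mulrC.
case: (_ == e); last exact: coef0.
by rewrite coefZ coef_ket (can_eq (toggleK j)) (negPf D'D) mulr0.
Qed.

(** Acting at i and j in the two orders gives the same diagram, and the signs differ by
    [lt i j] against [lt j i]; at i = j the sign squares to 1. *)
Lemma fc_car e i e' j v : fc e i (fc e' j v) + fc e' j (fc e i v)
  = if (i == j) && (e != e') then v else 0.
Proof.
move: v; apply: (@ket_ext A).
- by apply: linear_addf; apply: linear_compf; exact: linearP.
- by apply: linear_iff; [exact: linear_idf | exact: linear_0f].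
move=> D; rewrite !fcU.
have [->|ij] /= := eqVneq i j.
  have h e1 e2 : fc e1 j (if filled D j == e2 then jw_sign D j *: ket (toggle j D) else 0)
       = if (filled D j == e2) && (e1 != e2) then ket D else 0.
    case: (eqVneq (filled D j) e2) => [Fe|_] /=; last by rewrite linear0.
    rewrite linearZ /= fcU filled_toggle eqxx Fe toggleK.
    by case: e1 e2 Fe => [] [] Fe //=; rewrite ?scaler0 // scalerA jw_sign_toggle (proj1 ltP)
      mul1r jw_sign_sqr scale1r.
  rewrite !h; case: (filled D j); case: e e' => [] [] //=; by rewrite ?addr0 ?add0r.
have h e1 i1 e2 i2 : i1 != i2 ->
   fc e1 i1 (if filled D i2 == e2 then jw_sign D i2 *: ket (toggle i2 D) else 0)
       = if (filled D i2 == e2) && (filled D i1 == e1) then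
         (jw_sign D i2 * ((-1) ^+ lt i2 i1 * jw_sign D i1)) *: ket (toggle i1 (toggle i2 D)) else 0.
  move=> i12; case: (eqVneq (filled D i2) e2) => [Fe|_] /=; last by rewrite linear0.
  rewrite linearZ /= fcU filled_toggle (negPf i12) /= jw_sign_toggle.
  by case: (filled D i1 == e1); [rewrite scalerA | rewrite scaler0].
have ji : j != i by rewrite eq_sym.
rewrite (h e i e' j ij) (h e' j e i ji) [(_ == e) && _]andbC.
case: (_ && _); last by rewrite addr0.
rewrite toggleC -scalerDl (proj2 ltP _ _ ij).
set x := jw_sign D i; set y := jw_sign D j.
suff -> : y * ((-1) ^+ (~~ lt i j) * x) + x * ((-1) ^+ lt i j * y) = 0 by rewrite scale0r.
by case: (lt i j) => /=; ring.
Qed.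

Lemma fcC e i e' j v : ~~ ((i == j) && (e != e')) ->
  fc e i (fc e' j v) = - fc e' j (fc e i v).
Proof. by move=> /negPf h; apply/eqP; rewrite -addr_eq0 fc_car h. Qed.

(** The vacuum is the only diagram killed by psi*_j for j < 0 and psi_j for j >= 0, so
    Z maps it to a multiple of itself; fermions generate all diagrams from it. *)
Lemma commutant_scalar (Z : F -> F) : linear Z ->
    (forall e j v, Z (fc e j v) = fc e j (Z v)) ->
  forall v, Z v = coef fset0 (Z (ket fset0)) *: v.
Proof.
move=> lZ Zfc; set z := coef _ (Z _).
(* If D is not the vacuum, some j in D can be undone by a fermion that kills the
   vacuum, so that D does not occur in Z applied to the vacuum. *)
have Z0 : Z (ket fset0) = z *: (ket fset0).
  apply/coefP => D; rewrite coefZ coef_ket.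
  have [->|D0] := eqVneq D fset0; first by rewrite mulr1.
  rewrite mulr0.
  have /fset0Pn[j jD] := D0; pose e := ~~ (0 <= j).
  have : fc e j (Z (ket fset0)) = 0.
    by rewrite -Zfc fcU filled0 /e; case: (0 <= j); rewrite linear_0.
  move/(congr1 (coef (toggle j D))); rewrite coef0 fc_coeff; last first.
    by rewrite /filled /e jD addbT.
  by move/eqP; rewrite mulf_eq0 (negPf (jw_sign_neq0 _ _)) => /eqP.
apply: ket_ext; [exact: lZ | exact: (linear_scalef _ (@linear_idf _ _)) |].
elim/finSet_rect => D IH.
have [->|/fset0Pn[j jD]] := eqVneq D fset0; first exact: Z0.
pose D' := toggle j D.
have jD' : j \notin D' by rewrite in_toggle eqxx jD.
have -> : ket D = jw_sign D' j *: fc (filled D' j) j (ket D').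
  by rewrite fcU eqxx scalerA jw_sign_sqr scale1r toggleK.
rewrite (linear_homo lZ) Zfc IH.
  by rewrite linearZ !scalerA [_ * z]mulrC.
rewrite fproperEneq; apply/andP; split.
  by apply: contraNneq jD' => ->.
apply/fsubsetP => i; rewrite in_toggle; case: eqP => [->|//].
by rewrite jD.
Qed.

End Fermions.

(** * Normally ordered currents and their cocycle *)

Lemma big_uniq_widen (V : nmodType) (I : eqType) (s r : seq I) (F : I -> V) :
  uniq s -> uniq r -> {subset s <= r} ->
  (forall j, j \in r -> j \notin s -> F j = 0) ->
  \sum_(j <- r) F j = \sum_(j <- s) F j.
Proof.
move=> us ur sr F0; rewrite (bigID (mem s)) /= [X in _ + X]big_seq_cond.
rewrite [X in _ + X]big1 ?addr0 => [|j /andP[]]; last exact: F0.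
rewrite -big_filter; apply/perm_big/uniq_perm; rewrite ?filter_uniq // => j.
by rewrite mem_filter andb_idr //; exact: sr.
Qed.

Lemma big_delta (A : pzRingType) (V : lmodType A) (r : seq int) (F : int -> V) j :
  uniq r -> j \in r -> \sum_(i <- r) (if i == j then F i else 0) = F j.
Proof.
move=> ur jr; rewrite -big_mkcond -big_filter.
rewrite (perm_big [:: j]) ?big_seq1 //; apply: uniq_perm; rewrite ?filter_uniq // => i.
by rewrite mem_filter !inE andb_idr // => /eqP->.
Qed.

Section Currents.
Variables (A : fieldType) (lt : rel int).
Hypothesis ltP : tournament lt.
Local Notation F := (fermions A).
Local Notation fc := (@fc A lt).
Local Notation ket := (@ket A).
Implicit Types (v : F) (D : maya).

(** :psi_i psi*_j:, with vanishing vacuum expectation. *)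
Definition normal_pair (i j : int) v : F :=
  fc false i (fc true j v) - (if (i == j) && (0 <= j) then v else 0).

Lemma normal_pair_linear i j : linear (normal_pair i j).
Proof.
apply: linear_subf; first by apply: linear_compf; exact: linearP.
by apply: linear_iff; [exact: linear_idf | exact: linear_0f].
Qed.

Lemma normal_pair_neq i j v : i != j -> normal_pair i j v = fc false i (fc true j v).
Proof. by move=> /negPf ij; rewrite /normal_pair ij subr0. Qed.

Lemma normal_pair_fc e i k j v : normal_pair i k (fc e j v) = fc e j (normal_pair i k v) +
  (if e then - (if i == j then fc true k v else 0)
        else (if k == j then fc false i v else 0)).
Proof.
rewrite /normal_pair linearB /=.
have -> : fc e j (if (i == k) && (0 <= k) then v else 0)
       = if (i == k) && (0 <= k) then fc e j v else 0.
  by case: (_ && _); rewrite ?linear0.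
rewrite [RHS]addrAC; congr (_ - _); case: e.
  have h1 : fc true k (fc true j v) = - fc true j (fc true k v).
    by apply: (fcC ltP); rewrite andbF.
  rewrite h1 linearN /= -[fc false i _](addrK (fc true j (fc false i (fc true k v)))).
  rewrite (fc_car ltP) andbT opprB; case: (i == j); rewrite ?subr0 //.
have := fc_car ltP true k false j v; rewrite andbT => /(canRL (addrK _)) ->.
rewrite linearB /=.
have -> : fc false i (fc false j (fc true k v)) = - fc false j (fc false i (fc true k v)).
  by apply: (fcC ltP); rewrite andbF.
by rewrite opprK addrC; case: (k == j); rewrite ?linear0.
Qed.

(** All but finitely many of the :psi_(j+l) psi*_j: kill the diagram D; this is a finite
    list of indices containing those that do not, which turns the infinite sum over j
    into a finite one. *)
Definition reach (D : maya) (l : int) : seq int :=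
  undup (enum_fset D ++ [seq i - l | i <- enum_fset D] ++ [seq m%:Z | m <- iota 0 `|l|%N]).

Lemma reach_uniq D l : uniq (reach D l). Proof. exact: undup_uniq. Qed.

Lemma mem_reach D l j :
  (j \in reach D l) = [|| j \in D, j + l \in D | (0 <= j) && (j < `|l|%N)].
Proof.
rewrite mem_undup !mem_cat; congr [|| _, _ | _].
  apply/mapP/idP => [[i iD ->]|jD]; first by rewrite subrK.
  by exists (j + l); rewrite ?addrK.
apply/mapP/idP => [[m]|/andP[j0 jl]]; first by rewrite mem_iota => ? ->; lia.
by exists `|j|%N; rewrite ?mem_iota; lia.
Qed.

Lemma normal_pair_diag j D :
  normal_pair j j (ket D) = ((filled D j)%:R - (0 <= j)%R%:R) *: ket D.
Proof.
rewrite /normal_pair fcU eqxx scalerBl; congr (_ - _); last by case: (0 <= j); rewrite ?scale1r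
  ?scale0r.
case: (boolP (filled D j)) => Fj; last by rewrite /= linear0 scale0r.
rewrite /= linearZ /= fcU filled_toggle eqxx Fj /= scalerA jw_sign_toggle (proj1 ltP) mul1r.
by rewrite jw_sign_sqr toggleK.
Qed.

Lemma normal_pair_off i j D : i != j -> normal_pair i j (ket D) =
  if filled D j && ~~ filled D i then
     (jw_sign A lt D j * jw_sign A lt (toggle j D) i) *: ket (toggle i (toggle j D)) else 0.
Proof.
move=> ij; rewrite normal_pair_neq // fcU; case: (filled D j) => /=; last by rewrite linear0.
rewrite linearZ /= fcU filled_toggle (negPf ij) /=.
by case: (filled D i); rewrite /= ?scaler0 ?scalerA.
Qed.

Lemma normal_pair_reach D l j : j \notin reach D l -> normal_pair (j + l) j (ket D) = 0.
Proof.
rewrite mem_reach !negb_or => /and3P[jD jlD jl].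
have fj : filled D j = (0 <= j) by rewrite /filled (negPf jD) addbF.
have fjl : filled D (j + l) = (0 <= j + l) by rewrite /filled (negPf jlD) addbF.
have [l0|l0] := eqVneq l 0.
  by rewrite l0 addr0 normal_pair_diag fj subrr scale0r.
rewrite normal_pair_off; last by lia.
by rewrite fj fjl; case: ifP => // ?; lia.
Qed.

End Currents.

(** The infinite sum of the al(j) :psi_(j+l) psi*_j: over j in Z. *)
HB.lock Definition cur (A : fieldType) (lt : rel int) (al : int -> A) (l : int) :
    fermions A -> fermions A :=
  lift (fun D => \sum_(j <- reach D l) al j *: normal_pair lt (j + l) j (ket A D)).

Lemma cur_linear (A : fieldType) (lt : rel int) (al : int -> A) (l : int) :
  linear (cur lt al l).
Proof. rewrite cur.unlock; exact: lift_linear. Qed.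
HB.instance Definition _ (A : fieldType) lt al l :=
  GRing.isLinear.Build A (fermions A) (fermions A) _ (cur lt al l) (@cur_linear A lt al l).

(** The vacuum expectation of the product of the currents (al, l) and (be, - l):
    for 0 <= j < l the first current undoes the move of j to j - l made by the
    second. *)
Definition cocycle (A : fieldType) (al be : int -> A) (l : int) : A :=
  if l is Posz m then \sum_(0 <= j < m) al (j%:Z - l) * be j%:Z else 0.

Section CurrentAlgebra.
Variables (A : fieldType) (lt : rel int).
Hypothesis ltP : tournament lt.
Local Notation F := (fermions A).
Local Notation fc := (@fc A lt).
Local Notation ket := (@ket A).
Local Notation cur := (@cur A lt).
Local Notation normal_pair := (@normal_pair A lt).
Implicit Types (v : F) (D : maya) (al be : int -> A).

Lemma curU al l D : cur al l (ket D) = \sum_(j <- reach D l) al j *: normal_pair (j + l) j (ket D).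
Proof. by rewrite cur.unlock lift_ket. Qed.

Lemma curE r al l D : uniq r -> {subset reach D l <= r} ->
  cur al l (ket D) = \sum_(j <- r) al j *: normal_pair (j + l) j (ket D).
Proof.
move=> ur sub; rewrite curU [RHS](big_uniq_widen (reach_uniq D l) ur sub) // => j _ jr.
by rewrite normal_pair_reach // scaler0.
Qed.

Lemma cur_ext al be l v : al =1 be -> cur al l v = cur be l v.
Proof.
move=> ab; move: v; apply: ket_ext; try exact: linearP.
by move=> D; rewrite !curU; apply: eq_bigr => j _; rewrite ab.
Qed.

Lemma curD al be l v : cur (fun j => al j + be j) l v = cur al l v + cur be l v.
Proof.
move: v; apply: ket_ext; [exact: linearP | by apply: linear_addf; exact: linearP |].
move=> D; rewrite !curU -big_split; apply: eq_bigr => j _ /=.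
by rewrite scalerDl.
Qed.

Lemma curZ c al l v : cur (fun j => c * al j) l v = c *: cur al l v.
Proof.
move: v; apply: ket_ext; [exact: linearP | by apply: linear_scalef; exact: linearP |].
move=> D; rewrite !curU scaler_sumr; apply: eq_bigr => j _ /=.
by rewrite scalerA.
Qed.

Lemma cur0 l v : cur (fun _ => 0) l v = 0.
Proof.
by rewrite -[RHS](scale0r (cur (fun=> 0) l v)) -curZ; apply: cur_ext => j; rewrite mul0r.
Qed.

Lemma cur_sum (I : Type) (r : seq I) (P : pred I) (al : I -> int -> A) l v :
  cur (fun j => \sum_(i <- r | P i) al i j) l v = \sum_(i <- r | P i) cur (al i) l v.
Proof.
elim: r => [|i r IH].
  by rewrite big_nil -[RHS](cur0 l v); apply: cur_ext => j; rewrite big_nil.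
rewrite big_cons; case: (boolP (P i)) => Pi.
  by rewrite -IH -curD; apply: cur_ext => j; rewrite big_cons Pi.
by rewrite -IH; apply: cur_ext => j; rewrite big_cons (negPf Pi).
Qed.

(** A current acts on fermions by the matrix with entries al(j) at (j+l, j); the normal
    ordering constant is central and does not contribute. *)
Lemma cur_fc e al l j v : cur al l (fc e j v) = fc e j (cur al l v) +
  (if e then - (al (j - l) *: fc true (j - l) v) else al j *: fc false (j + l) v).
Proof.
move: v; apply: ket_ext.
- by apply: linear_compf; exact: linearP.
- apply: linear_addf; first by apply: linear_compf; exact: linearP.
  apply: linear_iff; first by apply/linear_oppf/linear_scalef; exact: linearP.
  by apply/linear_scalef; exact: linearP.
move=> D; pose r := undup ([:: j; j - l] ++ reach D l ++ reach (toggle j D) l).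
have ur : uniq r by exact: undup_uniq.
have r1 : {subset reach D l <= r} by move=> k kD; rewrite mem_undup !mem_cat kD orbT.
have r2 : {subset reach (toggle j D) l <= r}.
  by move=> k kD; rewrite mem_undup !mem_cat kD !orbT.
have jr : j \in r by rewrite mem_undup !inE eqxx.
have jlr : j - l \in r by rewrite mem_undup !inE eqxx !orbT.
have -> : cur al l (fc e j (ket D))
        = \sum_(i <- r) al i *: normal_pair (i + l) i (fc e j (ket D)).
  rewrite fcU; case: (_ == e).
    rewrite linearZ /= (curE _ ur r2) scaler_sumr; apply: eq_bigr => i _.
    by rewrite (linear_homo (normal_pair_linear _ _ _)) !scalerA mulrC.
  rewrite linear0 big1 // => i _.
  by rewrite (linear_0 (normal_pair_linear _ _ _)) scaler0.
rewrite (curE _ ur r1) linear_sum -[X in _ + X]/(_ : F) /=.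
transitivity (\sum_(i <- r) fc e j (al i *: normal_pair (i + l) i (ket D)) +
  \sum_(i <- r) (if i == (if e then j - l else j)
     then (if e then - (al i *: fc true i (ket D)) else al i *: fc false (i + l) (ket D)) else 0)).
  rewrite -big_split; apply: eq_bigr => i _ /=.
  rewrite (normal_pair_fc ltP) scalerDr linearZ /=; congr (_ + _).
  case: (e); last by case: (i == j); rewrite ?scaler0.
  rewrite eq_sym -subr_eq eq_sym.
  case: (i == j - l); first by rewrite scalerN.
  by rewrite oppr0 scaler0.
case: (e); first by rewrite (big_delta _ ur jlr).
by rewrite (big_delta _ ur jr).
Qed.

Lemma cur_vac al l : 0 <= l -> cur al l (ket fset0) = 0.
Proof.
move=> l0; rewrite curU big1 // => j _.
have [->|l1] := eqVneq l 0.
  by rewrite addr0 normal_pair_diag // filled0 subrr scale0r scaler0.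
rewrite normal_pair_off; last by lia.
by rewrite !filled0; case: ifP => [?|]; [lia | rewrite scaler0].
Qed.

Lemma cur_coeff_vac al l v : l <= 0 -> coef fset0 (cur al l v) = 0.
Proof.
move=> l0; rewrite (ketE v) linear_sum coef_sum big1 // => D _.
rewrite linearZ coefZ -[X in _ * coef _ X]/(cur al l (ket D)) curU coef_sum big1 ?mulr0 // => j _.
rewrite coefZ.
have [l1|l1] := eqVneq l 0.
  rewrite l1 addr0 normal_pair_diag // coefZ coef_ket.
  have [->|_] := eqVneq D fset0; first by rewrite filled0 subrr mul0r mulr0.
  by rewrite !mulr0.
rewrite normal_pair_off; last by lia.
case: (boolP (filled D j && _)) => [/andP[Fj Fjl]|_]; last by rewrite coef0 mulr0.
rewrite coefZ coef_ket; case: eqP => [e|_]; last by rewrite !mulr0.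
have := filled_toggle (j + l) (j + l) (toggle j D); have := filled_toggle j (j + l) (toggle j D).
rewrite e !filled0 !filled_toggle !eqxx Fj (negPf Fjl).
have [/negPf -> /negPf ->] : j != j + l /\ j + l != j by split; lia.
by move=> /= h1 h2; exfalso; lia.
Qed.

Lemma bil_vac_coeff i j : coef fset0 (fc false i (fc true j (ket fset0)))
  = if (i == j) && (0 <= j) then 1 else 0.
Proof.
have [->|ij] := eqVneq i j.
  have := normal_pair_diag A ltP j fset0; rewrite filled0 subrr scale0r /normal_pair eqxx /=.
  move/eqP; rewrite subr_eq0 => /eqP ->.
  by case: (0 <= j); rewrite ?coef0 // coef_ket eqxx.
rewrite -(normal_pair_neq lt _ ij) normal_pair_off //.
case: (_ && _); rewrite ?coef0 // coefZ coef_ket.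
case: eqP => [e|_]; last by rewrite mulr0.
have : j \in toggle i (toggle j fset0) by rewrite !in_toggle !inE eqxx eq_sym (negPf ij).
by rewrite e inE.
Qed.

Lemma cur_cur_vac al be l s : coef fset0 (cur al l (cur be s (ket fset0)))
  = if l + s == 0 then cocycle al be l else 0.
Proof.
have [l0|l0] := leP l 0.
  rewrite cur_coeff_vac //; case: l l0 => [[|m]|m] //= _; rewrite ?if_same //.
  by rewrite big_geq ?if_same.
have [s0|s0] := leP 0 s.
  by rewrite cur_vac // linear0 coef0; case: eqP => //; lia.
(* For s < 0 only 0 <= j < |s| gives a nonzero move of the vacuum. *)
pose r := [seq m%:Z | m <- iota 0 `|s|%N].
rewrite (@curE r); first last.
- move=> j; rewrite mem_reach !inE /= => /andP[j0 js].
  by apply/mapP; exists `|j|%N; rewrite ?mem_iota; lia.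
- by rewrite map_inj_uniq ?iota_uniq // => x y [].
rewrite linear_sum coef_sum.
have term j : j \in r -> coef fset0 (cur al l (be j *: normal_pair (j + s) j (ket fset0)))
   = if l + s == 0 then al (j - l) * be j else 0.
  move=> /mapP[m]; rewrite mem_iota => /andP[_ ms] jm.
  rewrite linearZ coefZ normal_pair_neq; last by lia.
  rewrite /= cur_fc cur_fc cur_vac ?linear0 ?add0r; last by lia.
  rewrite linearN linearZ coefD coefN !coefZ /= !bil_vac_coeff.
  case: (eqVneq (l + s) 0) => [e|e].
    have -> : (j + s + l == j) && (0 <= j) by lia.
    have -> : (j + s == j - l) && (0 <= j - l) = false by lia.
    have -> : j + s = j - l by lia.
    by rewrite mulr0 oppr0 add0r mulr1 mulrC.
  have -> : (j + s + l == j) && (0 <= j) = false by lia.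
  have -> : (j + s == j - l) && (0 <= j - l) = false by lia.
  by rewrite !mulr0 oppr0 addr0 mulr0.
rewrite (eq_big_seq _ term); case: eqP => [e|_]; last by rewrite big1.
have -> : l = Posz `|s|%N by lia.
by rewrite /= big_map /index_iota subn0.
Qed.

(** Both sides have the same commutators with all fermions, hence differ by a scalar,
    which is read off from the vacuum expectation. *)
Lemma cur_bracket al be l s v :
  cur al l (cur be s v) - cur be s (cur al l v)
  = cur (fun j => al (j + s) * be j - be (j + l) * al j) (l + s) v
    + (if l + s == 0 then cocycle al be l - cocycle be al s else 0) *: v.
Proof.
set ga := fun j => _.
pose Z v := cur al l (cur be s v) - cur be s (cur al l v) - cur ga (l + s) v.
have lZ : linear Z.
  apply: linear_subf; last exact: linearP.
  by apply: linear_subf; apply: linear_compf; exact: linearP.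
have Zfc e j w : Z (fc e j w) = fc e j (Z w).
  rewrite /Z !cur_fc !linearD /= !cur_fc.
  case: e.
    rewrite !linearN !linearZ /= !cur_fc.
    have -> : j - l - s = j - (l + s) by ring.
    have -> : j - s - l = j - (l + s) by ring.
    have -> : ga (j - (l + s)) = al (j - l) * be (j - (l + s)) - be (j - s) * al (j - (l + s)).
      by rewrite /ga; congr (al _ * _ - be _ * _); ring.
    apply/coefP => D; rewrite !(coefD, coefB, coefZ, coefN) /=; ring.
  rewrite !linearN !linearZ /= !cur_fc.
  have -> : j + l + s = j + (l + s) by ring.
  have -> : j + s + l = j + (l + s) by ring.
  rewrite /ga.
  apply/coefP => D; rewrite !(coefD, coefB, coefZ, coefN) /=; ring.
have := commutant_scalar lZ Zfc v; rewrite {1}/Z => /eqP.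
rewrite subr_eq => /eqP ->; rewrite addrC; congr (_ + _ *: _).
rewrite /Z !coefB !cur_cur_vac.
have -> : coef fset0 (cur ga (l + s) (ket fset0)) = 0.
  have [ls|ls] := leP (l + s) 0; first by rewrite cur_coeff_vac.
  by rewrite cur_vac ?coef0 // ltW.
rewrite subr0 [s + l]addrC; case: (_ == 0); by rewrite ?subr0.
Qed.

End CurrentAlgebra.

(** * The q-difference action on fermions *)

Lemma nQ_neq0 (n : nat) : (0 < n)%N -> n%:Q != 0.
Proof. by move=> n0; rewrite intr_eq0; lia. Qed.

Section FractionalPowers.
Variables (A : fieldType) (q : A) (qpow : rat -> A).
Hypotheses (q_neq0 : q != 0) (q_not_root : forall k : nat, (0 < k)%N -> q ^+ k != 1).
Hypothesis (qpowP : fractional_powers q qpow).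

Lemma qpow1 : qpow 1 = q. Proof. by case: qpowP. Qed.
Lemma qpowD r s : qpow (r + s) = qpow r * qpow s. Proof. by case: qpowP. Qed.

Lemma qpow_neq0 r : qpow r != 0.
Proof. by apply: contraNneq q_neq0 => r0; rewrite -qpow1 -[1](subrKC r) qpowD r0 mul0r. Qed.

Lemma qpow0 : qpow 0 = 1.
Proof. by apply: (mulfI (qpow_neq0 0)); rewrite -qpowD addr0 mulr1. Qed.

Lemma qpowN r : qpow (- r) = (qpow r)^-1.
Proof. by apply: (mulfI (qpow_neq0 r)); rewrite -qpowD subrr qpow0 divff ?qpow_neq0. Qed.

Lemma qpowMn r m : qpow (r *+ m) = qpow r ^+ m.
Proof. by elim: m => [|m IH]; rewrite ?mulr0n ?qpow0 // mulrS qpowD IH exprS. Qed.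

(** If q^(a/b) = 1 then q^a = 1. *)
Lemma qpow_neq1 r : r != 0 -> qpow r != 1.
Proof.
move=> r0; apply/eqP => qr.
have hn : qpow (numq r)%:Q = 1.
  have -> : (numq r)%:Q = r *+ `|denq r|%N.
    rewrite -[r *+ _]mulr_natr -[X in X * _](divq_num_den r).
    have -> : (`|denq r|%N)%:R = (denq r)%:Q by rewrite -[in RHS](gez0_abs (denq_ge0 r)).
    by rewrite divfK // intr_eq0 denq_neq0.
  by rewrite qpowMn qr expr1n.
have hm : qpow `|numq r|%N%:R = 1.
  case: (numq r) hn => m; first by [].
  by rewrite NegzE rmorphN /= qpowN => /(congr1 (@GRing.inv _)); rewrite invrK invr1.
have := q_not_root (k := `|numq r|%N); rewrite -qpow1 -qpowMn hm eqxx absz_gt0 numq_eq0 r0.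
by move=> /(_ isT).
Qed.

Section DiffAction.
Variables (lt : rel int) (ltP : tournament lt).
Variables (n : nat) (n_gt0 : (0 < n)%N) (n' : int) (y : A) (y_neq0 : y != 0).
Local Notation F := (fermions A).
Local Notation cur := (@cur A lt).
Implicit Types (k l r s : int) (v : F).

(** The distance by which E_{k,l} moves a fermion, which is also the value of c'k + cl at
    c' = n' and c = n. *)
Definition deg k l : int := n' * k + n%:Z * l.

Definition diff_coeff k l (j : int) : A :=
  y ^ k * qpow (k%:Q / n%:Q * (j%:Q + (deg k l)%:Q / 2)).

(** The sum of y^k q^{(k/n)j} over the filled positions j >= 0 of the vacuum, as a
    rational function: the vacuum expectation that normal ordering removes. *)
Definition diff_const k : A := y ^ k / (1 - qpow (k%:Q / n%:Q)).

Definition diff_central k l : A := if deg k l == 0 then diff_const k else 0.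

Definition diff_op k l v : F := cur (diff_coeff k l) (deg k l) v + diff_central k l *: v.

Lemma diff_op_linear k l : linear (diff_op k l).
Proof. by apply: linear_addf; [exact: linearP | exact/linear_scalef/linear_idf]. Qed.

(** The symmetric exponent j + d/2 is what makes the factor q^{(sk-lr)/2} depend on the
    determinant of (k, l) and (r, s) alone. *)
Lemma diff_coeff_mul k l r s j : diff_coeff k l (j + deg r s) * diff_coeff r s j
  = qpow ((s * k - l * r)%:Q / 2) * diff_coeff (k + r) (l + s) j.
Proof.
rewrite /diff_coeff mulrACA -expfzDr // [RHS]mulrCA -!qpowD; congr (_ * qpow _).
have n0 := nQ_neq0 n_gt0; rewrite /deg; rewrite !(rmorphD, rmorphB, rmorphM) /=; field; exact: n0.
Qed.

(** The cocycle is a geometric sum with ratio p = q^{(k+r)/n}.  For p <> 1 it is the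
    difference of the two boundary terms, each a multiple of [diff_const]; for k + r = 0
    all m terms equal 1 and the central term appears. *)
Lemma cocycle_geometric k l r s (m : nat) : deg k l = m%:Z -> deg r s = - m%:Z ->
  cocycle (diff_coeff k l) (diff_coeff r s) m%:Z =
    (qpow ((s * k - l * r)%:Q / 2) - qpow ((l * r - s * k)%:Q / 2)) * diff_const (k + r)
    + (if (k == - r) && (l == - s) then (deg k l)%:~R else 0).
Proof.
move=> dkl drs; have n0 := nQ_neq0 n_gt0.
have d0 : deg (k + r) (l + s) = 0 by move: dkl drs; rewrite /deg; lia.
pose x := (s * k - l * r)%:Q / 2; pose p := qpow ((k + r)%:Q / n%:Q).
have -> : (l * r - s * k)%:Q / 2 = - x by rewrite /x; rewrite !rmorphB /=; field.
rewrite -/x.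
have -> : cocycle (diff_coeff k l) (diff_coeff r s) m = qpow x * y ^ (k + r) * \sum_(0 <= j < m)
  p ^+ j.
  rewrite /cocycle big_distrr /=; apply: eq_bigr => j _.
  have -> : j%:Z - m%:Z = j%:Z + deg r s by rewrite drs.
  rewrite diff_coeff_mul -mulrA; congr (_ * (_ * _)).
  rewrite -qpowMn d0; congr (qpow _); rewrite mul0r addr0 -mulr_natr; by congr (_ * _).
have [kr|kr] := eqVneq (k + r) 0.
  have ls : l + s = 0 by move: d0; rewrite /deg kr; nia.
  have -> : (k == - r) && (l == - s) by lia.
  have x0 : x = 0.
    rewrite /x; have -> : s * k - l * r = 0 by nia.
    by rewrite mul0r.
  have p1 : p = 1 by rewrite /p kr mul0r qpow0.
  rewrite x0 oppr0 subrr mul0r add0r dkl p1 qpow0 mul1r kr expr0z mul1r.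
  under eq_bigr => j _ do rewrite expr1n.
  by rewrite sumr_const_nat subn0.
have -> : (k == - r) && (l == - s) = false by lia.
have p1 : 1 - p != 0.
  rewrite subr_eq0 eq_sym; apply: qpow_neq1.
  by apply: mulf_neq0; [rewrite intr_eq0 | rewrite invr_eq0].
have xm : qpow (- x) = qpow x * p ^+ m.
  rewrite -qpowMn -qpowD; congr (qpow _).
  have : (s * k - l * r)%:Q = - ((k + r)%:Q / n%:Q * m%:Q).
    apply: (mulIf n0).
    have -> : m%:Q = (deg k l)%:Q by rewrite dkl.
    have h : (k + r) * deg k l = - (n%:Z * (s * k - l * r)).
      have e : n' * (k + r) = - (n%:Z * (l + s)) by move: d0; rewrite /deg; lia.
      transitivity (n' * (k + r) * k + (k + r) * (n%:Z * l)); first by rewrite /deg; ring.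
      by rewrite e; ring.
    have h2 : (k + r)%:Q * (deg k l)%:Q = - (n%:Q * (s * k - l * r)%:Q).
      by rewrite -!intrM h mulrNz.
    by rewrite mulNr mulrAC divfK // h2 opprK mulrC.
  move=> h; rewrite /x -[_ *+ m]mulr_natr -[m%:R]/(m%:Q) h; field; exact: n0.
rewrite xm addr0 /diff_const -/p.
have -> : \sum_(0 <= j < m) p ^+ j = (1 - p ^+ m) / (1 - p).
  rewrite big_mkord; apply: (mulIf p1); rewrite divfK //.
  have := subrX1 p m => h; have -> : 1 - p ^+ m = - (p ^+ m - 1) by ring.
  by rewrite h; ring.
by field.
Qed.

(** [cur_bracket], with [diff_coeff_mul] for the operator part and [cocycle_geometric],
    used for whichever of the two currents has nonnegative degree, for the scalar. *)
Lemma diff_op_bracket k l r s v :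
  diff_op k l (diff_op r s v) - diff_op r s (diff_op k l v)
  = (qpow ((s * k - l * r)%:Q / 2) - qpow ((l * r - s * k)%:Q / 2)) *: diff_op (k + r) (l + s) v
    + (if (k == - r) && (l == - s) then (deg k l)%:~R else 0) *: v.
Proof.
have n0 := nQ_neq0 n_gt0.
pose Q := qpow ((s * k - l * r)%:Q / 2) - qpow ((l * r - s * k)%:Q / 2).
have dD : deg k l + deg r s = deg (k + r) (l + s) by rewrite /deg; ring.
have h := cur_bracket ltP (diff_coeff k l) (diff_coeff r s) (deg k l) (deg r s) v.
have hc : (if deg k l + deg r s == 0 then
     cocycle (diff_coeff k l) (diff_coeff r s) (deg k l) - cocycle (diff_coeff r s) (diff_coeff
       k l) (deg r s) else 0)
   = Q * diff_central (k + r) (l + s)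
     + (if (k == - r) && (l == - s) then (deg k l)%:~R else 0).
  rewrite dD /diff_central; case: eqP => [d0|d0]; last first.
    rewrite mulr0 add0r; case: ifP => // /andP[/eqP kr /eqP ls].
    by exfalso; apply: d0; rewrite kr ls !addNr /deg !mulr0.
  have [m|m] : {m : nat | deg k l = m%:Z} + {m : nat | deg r s = m%:Z}.
    move: dD; rewrite d0; case: (deg k l) => m e; first by left; exists m.
    by right; exists m.+1; lia.
  - case: m => m dm; have dr : deg r s = - m%:Z by lia.
    rewrite dm (cocycle_geometric dm dr) -/Q dm dr.
    have -> : cocycle (diff_coeff r s) (diff_coeff k l) (- m%:Z) = 0.
      by case: (m) => // ; rewrite /cocycle /= big_geq.
    by rewrite subr0.
  - case: m => m dm; have dr : deg k l = - m%:Z by lia.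
    rewrite dm (cocycle_geometric dm dr) dr.
    have -> : cocycle (diff_coeff k l) (diff_coeff r s) (- m%:Z) = 0.
      by case: (m) => // ; rewrite /cocycle /= big_geq.
    rewrite dm [r + k]addrC.
    have -> : (r == - k) && (s == - l) = (k == - r) && (l == - s) by lia.
    by rewrite /Q; case: ifP => _; rewrite ?rmorphN /=; ring.
have ha : (fun j => diff_coeff k l (j + deg r s) * diff_coeff r s j - diff_coeff r s (j + deg k
  l) * diff_coeff k l j)
   =1 (fun j => Q * diff_coeff (k + r) (l + s) j).
  by move=> j; rewrite !diff_coeff_mul [r + k]addrC [s + l]addrC -mulrBl.
rewrite hc (cur_ext _ _ _ ha) (@curZ _ _ Q (diff_coeff (k + r) (l + s))) dD in h.
rewrite /diff_op.
have lc al d x z c : cur al d (x + c *: z) = cur al d x + c *: cur al d z.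
  by rewrite linearD linearZ.
rewrite !lc -/Q; apply/coefP => D; have := congr1 (coef D) h.
rewrite !(coefD, coefN, coefZ) => /eqP; rewrite subr_eq => /eqP ->; ring.
Qed.

End DiffAction.
End FractionalPowers.

(** * Heisenberg modes and the Sugawara operator *)

Definition spread (D : maya) : nat := \max_(j <- D) `|j|.+1%N.

Lemma spreadP D j : j \in D -> (`|j| < spread D)%N.
Proof. by move=> jD; rewrite /spread (big_fsetD1 j jD) /= leq_maxl. Qed.

Lemma filled_lo D j : filled D j -> - (spread D)%:Z <= j.
Proof.
by rewrite /filled; case: (boolP (j \in D)) => [/spreadP jB _|_]; rewrite ?addbF; lia.
Qed.

Lemma filled_hi D j : ~~ filled D j -> j < (spread D)%:Z.
Proof.
by rewrite /filled; case: (boolP (j \in D)) => [/spreadP jB _|_]; rewrite ?addbF; lia.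
Qed.

Section Modes.
Variables (A : fieldType) (lt : rel int).
Hypothesis ltP : tournament lt.
Hypothesis char0 : forall m : nat, m.+1%:R != 0 :> A.
Variables (n : nat) (n_gt0 : (0 < n)%N).
Local Notation F := (fermions A).
Local Notation fc := (@fc A lt).
Local Notation ket := (@ket A).
Local Notation cur := (@cur A lt).
Local Notation normal_pair := (@normal_pair A lt).
Implicit Types (v : F) (D : maya).

Definition inclass (c : 'I_n) (j : int) : bool := (j %% n%:Z)%Z == c%:Z.
(** a_c[k], the sum of the :psi_{n(i+k)+c} psi*_{ni+c}: over i. *)
Definition mode (c : 'I_n) (k : int) : F -> F := cur (fun j => (inclass c j)%:R) (n%:Z * k).

Lemma mode_linear c k : linear (mode c k). Proof. exact: linearP. Qed.
HB.instance Definition _ c k := GRing.isLinear.Build A F F _ (mode c k) (mode_linear c k).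

Lemma inclassD c j k : inclass c (j + n%:Z * k) = inclass c j.
Proof. by rewrite /inclass addrC mulrC modzMDl. Qed.

Lemma inclassE c d i : inclass c (n%:Z * i + (d : 'I_n)%:Z) = (d == c).
Proof.
rewrite /inclass mulrC modzMDl modz_small; last by apply/andP; split=> //; exact: ltn_ord.
by rewrite -[RHS](inj_eq val_inj).
Qed.

Lemma inclass_uniq c c' j : inclass c j -> inclass c' j -> c = c'.
Proof. by rewrite /inclass => /eqP -> /eqP[]; exact: val_inj. Qed.

Lemma class_count c m : \sum_(0 <= j < n * m) (inclass c j%:Z)%:R = m%:R :> A.
Proof.
elim: m => [|m IH]; first by rewrite muln0 big_geq.
rewrite (big_cat_nat (n := n * m)) //=; last by rewrite leq_mul2l leqnSn orbT.
rewrite IH -natr1; congr (_ + _).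
rewrite -{1}[(n * m)%N]add0n big_addn mulnS addnK big_mkord.
have shiftE (i : 'I_n) : inclass c (i + n * m)%N = (i == c).
  by rewrite PoszD PoszM addrC inclassE.
rewrite (bigD1 c) //= big1 ?addr0 ?shiftE ?eqxx // => i ic.
by rewrite shiftE (negPf ic).
Qed.

(** Among the n|k| indices in the range of the cocycle, |k| have residue c. *)
Lemma cocycle_class c c' k : cocycle (fun j => (inclass c j)%:R) (fun j => (inclass c' j)%:R)
  (n%:Z * k)
   = if (c == c') && (0 <= k) then k%:~R else 0 :> A.
Proof.
case: k => k; last first.
  rewrite andbF; have -> : n%:Z * Negz k = Negz (n * k.+1).-1 by nia.
  by [].
rewrite andbT -PoszM /cocycle.
transitivity (\sum_(0 <= j < n * k) (if c == c' then (inclass c j%:Z)%:R else 0) : A).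
  apply: eq_bigr => j _; rewrite PoszM -mulrN inclassD.
  have [->|cc] := eqVneq c c'; first by rewrite -natrM mulnb andbb.
  rewrite -natrM mulnb; case: (boolP (_ && _)) => // /andP[h h'].
  by rewrite (inclass_uniq h h') eqxx in cc.
by case: (c == c'); rewrite ?class_count // big1.
Qed.

(** The operator part of the bracket cancels because moving an index by a multiple of n
    does not change its residue. *)
Lemma mode_bracket c k c' k' v :
  mode c k (mode c' k' v) - mode c' k' (mode c k v)
  = (if (c == c') && (k + k' == 0) then k%:~R else 0) *: v.
Proof.
rewrite /mode (cur_bracket ltP).
rewrite (_ : cur _ _ v = 0) ?add0r; last first.
  rewrite -[RHS](cur0 lt (n%:Z * k + n%:Z * k') v); apply: cur_ext => j.
  by rewrite !inclassD mulrC subrr.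
congr (_ *: _); have -> : (n%:Z * k + n%:Z * k' == 0) = (k + k' == 0) by nia.
case: eqP => [kk|_]; last by rewrite andbF.
rewrite andbT !cocycle_class [c' == c]eq_sym; case: (c == c') => /=; last by rewrite subr0.
have -> : k' = - k by lia.
have [k0|k0] := leP 0 k.
  case: ifP => [h|_]; rewrite ?subr0 //.
  have -> : k = 0 by lia.
  by rewrite oppr0 addr0.
by rewrite oppr_ge0 ltW // sub0r rmorphN opprK.
Qed.

Lemma bil_neq0 D i j : i != j -> fc false i (fc true j (ket D)) <> 0 -> filled D j /\ ~~ filled D i.
Proof.
move=> ij; rewrite -(normal_pair_neq lt _ ij) (@normal_pair_off A lt) //.
by case: ifP => // /andP[].
Qed.

Definition sugawara_op c (K : nat) v : F := \sum_(1 <= k < K) mode c (- k%:Z) (mode c k v).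

Lemma sugawara_op_linear c K : linear (sugawara_op c K).
Proof. by apply: linear_sumf => k; apply: linear_compf; exact: mode_linear. Qed.

(** Truncated Sugawara operator of component c on a diagram D.  All indices that occur lie
    in the window J of the integers in [-R, R), so that the sums below are finite sums over
    a fixed finite type, in which the four indices can be permuted freely. *)
Section Sugawara.
Variables (c : 'I_n) (D : maya) (K : nat).
Hypothesis KD : ((spread D).*2 < K)%N.
Let R := (spread D + n * K).+2.
Let T := 'I_(R.*2).
Let e (t : T) : int := t%:Z - R%:Z.
Let J := [seq e t | t : T].

Let e_inj : injective e.
Proof. by move=> s t; rewrite /e => h; apply: val_inj => /=; lia. Qed.

Let J_uniq : uniq J. Proof. by rewrite map_inj_uniq ?enum_uniq. Qed.

Let mem_J j : (j \in J) = (- R%:Z <= j < R%:Z).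
Proof.
apply/mapP/idP => [[t _ ->]|h]; first by rewrite /e; have := ltn_ord t; lia.
have tR : (`|(j + R%:Z)%R| < R.*2)%N by lia.
by exists (Ordinal tR); rewrite ?mem_enum // /e /=; lia.
Qed.

Let big_J (V : nmodType) (f : int -> V) : \sum_(j <- J) f j = \sum_(t : T) f (e t).
Proof. by rewrite big_map big_enum. Qed.

Let f (i i' j j' : int) : F := fc false i' (fc true i (fc false j' (fc true j (ket D)))).

Let step k D' : (0 < `|k| < K)%N -> (spread D' <= (spread D).+1)%N ->
  mode c k (ket D') = \sum_(j : T) \sum_(j' : T)
    if inclass c (e j) && (e j' == e j + n%:Z * k) then fc false (e j') (fc true (e j) (ket D'))
      else 0.
Proof.
move=> /andP[k0 kK] bD'; have nk : (n * `|k| < n * K)%N by rewrite ltn_mul2l n_gt0.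
have knz : n%:Z * k != 0 by nia.
have nkE : `|(n%:Z * k)%R|%N = (n * `|k|)%N by rewrite abszM.
rewrite /mode (curE ltP (r := J)) // => [|j]; last first.
  rewrite mem_reach mem_J => /or3P[/spreadP|/spreadP|]; rewrite ?nkE /R => h; lia.
rewrite big_J; apply: eq_bigr => t _.
have tn : e t + n%:Z * k != e t by lia.
case: (inclass c (e t)); last by rewrite scale0r big1.
rewrite scale1r (normal_pair_neq lt _ tn) /=.
have out : e t + n%:Z * k \notin J ->
    fc false (e t + n%:Z * k) (fc true (e t) (ket D')) = 0.
  apply: contraNeq => /eqP /(bil_neq0 tn)[/filled_lo h1 /filled_hi h2].
  by rewrite mem_J /R; lia.
rewrite -(big_J (fun j' => if j' == e t + n%:Z * k
  then fc false j' (fc true (e t) (ket D')) else 0)).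
case: (boolP (e t + n%:Z * k \in J)) => h; first by rewrite (big_delta _ J_uniq h).
rewrite (out h) big1_seq // => j /andP[_ jJ].
by case: eqP => // jE; rewrite jE (negPf h) in jJ.
Qed.

Let Q (G : int -> int -> int -> int -> F) : F :=
  \sum_(x : (T * T) * (T * T)) G (e x.1.1) (e x.1.2) (e x.2.1) (e x.2.2).

Let Q_nested G : \sum_(j : T) \sum_(j' : T) \sum_(i : T) \sum_(i' : T)
    G (e j) (e j') (e i) (e i') = Q G.
Proof.
by rewrite pair_bigA; under eq_bigr => p _ do rewrite pair_bigA; rewrite pair_bigA.
Qed.

Let eq_Q G G' : (forall j j' i i', G j j' i i' = G' j j' i i') -> Q G = Q G'.
Proof. by move=> GG; apply: eq_bigr => x _; exact: GG. Qed.

Let swap_i G : Q G = Q (fun j j' i i' => G i j' j i').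
Proof.
pose h (x : (T * T) * (T * T)) := ((x.2.1, x.1.2), (x.1.1, x.2.2)).
have hK : involutive h by case=> [[? ?] [? ?]].
by rewrite /Q (reindex_inj (inv_inj hK)).
Qed.

Let swap_i' G : Q G = Q (fun j j' i i' => G j i' i j').
Proof.
pose h (x : (T * T) * (T * T)) := ((x.1.1, x.2.2), (x.2.1, x.1.2)).
have hK : involutive h by case=> [[? ?] [? ?]].
by rewrite /Q (reindex_inj (inv_inj hK)).
Qed.

Let antisym0 G : Q G = - Q G -> Q G = 0.
Proof.
move=> /eqP; rewrite -addr_eq0 -mulr2n -scaler_nat scaler_eq0.
by rewrite (negPf (char0 1)) /= => /eqP.
Qed.

Let QD G G' : Q (fun j j' i i' => G j j' i i' + G' j j' i i') = Q G + Q G'.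
Proof. exact: big_split. Qed.

Let QN G : Q (fun j j' i i' => - G j j' i i') = - Q G.
Proof. exact: sumrN. Qed.

Let ff j j' i i' : F := fc false i' (fc true i (fc false j' (fc true j (ket D)))).

Let step2 k : (0 < k < K)%N -> mode c (- k%:Z) (mode c k (ket D)) =
  Q (fun j j' i i' => if [&& inclass c j, j' == j + n%:Z * k%:Z, inclass c i
     & i' == i - n%:Z * k%:Z] then ff j j' i i' else 0).
Proof.
move=> kK; have nk : (0 < n * k)%N by rewrite muln_gt0 n_gt0; case/andP: kK.
rewrite (@step k%:Z D) //.
rewrite linear_sum -Q_nested; apply: eq_bigr => j _.
rewrite linear_sum; apply: eq_bigr => j' _ /=.
case: (boolP (inclass c (e j))) => cj /=; last first.
  by rewrite linear0 big1 // => i _; rewrite big1.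
case: eqP => [jk|_] /=; last first.
  by rewrite linear0 big1 // => i _; rewrite big1.
rewrite /ff; set w := fc false (e j') (fc true (e j) (ket D)).
have tn : e j' != e j by lia.
have wE : w = if filled D (e j) && ~~ filled D (e j') then
    (jw_sign A lt D (e j) * jw_sign A lt (toggle (e j) D) (e j')) *: ket (toggle (e j') (toggle
      (e j) D)) else 0.
  by rewrite /w -(normal_pair_neq lt _ tn) (@normal_pair_off A lt).
case: (boolP (filled D (e j) && _)) wE => [/andP[/filled_lo h1 /filled_hi h2]|_] ->; last first.
  rewrite linear0 big1 // => i _; rewrite big1 // => i' _.
  by rewrite !linear0 if_same.
rewrite linearZ /= step ?abszN //; last first.
  rewrite {1}/spread; apply/bigmax_leqP_seq => x; rewrite !in_toggle => + _.
  case: (eqVneq x (e j')) => [->|_]; first by move=> _; lia.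
  case: (eqVneq x (e j)) => [->|_]; first by move=> _; lia.
  by move=> /spreadP; lia.
rewrite scaler_sumr; apply: eq_bigr => i _; rewrite scaler_sumr; apply: eq_bigr => i' _.
rewrite -mulrN; case: (_ && _); last by rewrite scaler0.
by rewrite !linearZ.
Qed.

(** The terms with i = j', hence i' = j, are diagonal and count the pairs of a filled j and
    an empty j' > j in class c.  In the others psi*_i anticommutes with psi_{j'}, and
    exchanging them leaves a summand antisymmetric in i, j when i < j' and in i', j' when
    i > j', so that they cancel.  The count is 0 only when no filled position of class c
    has an empty one of class c above it. *)
Lemma sugawara : exists m : nat,
  sugawara_op c K (ket D) = m%:R *: ket D /\
  (m = 0%N -> forall j j', inclass c j -> inclass c j' -> j < j' ->
     filled D j -> filled D j').
Proof.
pose cl j j' i i' := [&& inclass c j, inclass c j', inclass c i & inclass c i'].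
pose C j j' i i' := [&& cl j j' i i', j < j' & i + j == i' + j'].
have -> : sugawara_op c K (ket D) = Q (fun j j' i i' => if C j j' i i' then ff j j' i i' else 0).
  rewrite /sugawara_op (eq_big_nat _ _ (F2 := fun k => Q (fun j j' i i' =>
    if [&& inclass c j, j' == j + n%:Z * k%:Z, inclass c i
     & i' == i - n%:Z * k%:Z] then ff j j' i i' else 0))); last by move=> k; exact: step2.
  rewrite exchange_big; apply: eq_bigr => x _.
  move: (e x.1.1) (e x.1.2) (e x.2.1) (e x.2.2) => j j' i i' /=.
  case: (boolP (C j j' i i')) => [/and3P[/and4P[cj cj' ci ci'] jj' ij]|nC]; last first.
    rewrite big_nat big1 // => k kK; case: ifP => // /and4P[cj /eqP j'E ci /eqP i'E].
    case/negP: nC; rewrite /C /cl j'E i'E -mulrN !inclassD cj ci /=.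
    have : (0 < n * k)%N by rewrite muln_gt0 n_gt0; case/andP: kK.
    by move=> nk; apply/andP; split; [lia | apply/eqP; ring].
  have [w0|w0] := eqVneq (fc false j' (fc true j (ket D))) 0.
    rewrite /ff w0 !linear0 big1 // => k _; by rewrite if_same.
  (* A quadruple is counted by the single k = (j' - j) / n, which is below K because j
     and j' are within the spread of D. *)
  have [/filled_lo h1 /filled_hi h2] : filled D j /\ ~~ filled D j'.
    by apply: bil_neq0 (elimN eqP w0); lia.
  have [k kE] : exists k : nat, j' - j = n%:Z * k%:Z.
    have : (n%:Z %| j' - j)%Z.
      rewrite -eqz_mod_dvd; apply/eqP.
      by move: cj cj'; rewrite /inclass => /eqP -> /eqP ->.
    case/dvdzP => d dE; exists `|d|%N; rewrite dE mulrC; congr (_ * _); nia.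
  have nk : (0 < n * k)%N by lia.
  have kK : (0 < k < K)%N.
    rewrite muln_gt0 in nk; case/andP: nk => _ ->; rewrite andTb.
    apply: leq_ltn_trans KD; have : (k <= n * k)%N by rewrite leq_pmull.
    by lia.
  rewrite (bigD1_seq k) ?mem_index_iota ?iota_uniq //=.
  have -> : [&& inclass c j, j' == j + n%:Z * k%:Z, inclass c i & i' == i - n%:Z * k%:Z].
    by rewrite cj ci /=; apply/andP; split; apply/eqP; lia.
  rewrite big1 ?addr0 // => k' kk'; case: ifP => // /and4P[_ /eqP h _ _].
  have n0 : n%:Z != 0 by lia.
  have /(mulfI n0)[kk] : n%:Z * k'%:Z = n%:Z * k%:Z by lia.
  by rewrite kk eqxx in kk'.
(* The quartic part, with the two psi* moved to the right. *)
pose gg j j' i i' : F := fc false i' (fc false j' (fc true i (fc true j (ket D)))).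
have ffE j j' i i' : ff j j' i i' =
    (if i == j' then fc false i' (fc true j (ket D)) else 0) - gg j j' i i'.
  rewrite /ff /gg; have := fc_car ltP true i false j' (fc true j (ket D)).
  rewrite andbT => /(canRL (addrK _)) ->; rewrite linearB /=.
  by congr (_ - _); case: (i == j'); rewrite ?linear0.
have ggi j j' i i' : gg i j' j i' = - gg j j' i i'.
  rewrite /gg; have -> : fc true j (fc true i (ket D)) = - fc true i (fc true j (ket D)).
    by apply: (fcC ltP); rewrite andbF.
  by rewrite !linearN.
have ggi' j j' i i' : gg j i' i j' = - gg j j' i i'.
  by rewrite /gg; apply: (fcC ltP); rewrite andbF.
pose N j j' i i' := [&& C j j' i i', i == j', filled D j & ~~ filled D j'].
pose m := #|[pred x : (T * T) * (T * T) | N (e x.1.1) (e x.1.2) (e x.2.1) (e x.2.2)]|.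
exists m; split; last first.
  move=> m0 j j' cj cj' jj' Fj; apply/negPn/negP => Fj'.
  have lo := filled_lo Fj; have hi := filled_hi Fj'.
  have jJ : j \in J by rewrite mem_J /R; lia.
  have jJ' : j' \in J by rewrite mem_J /R; lia.
  case/mapP: jJ => t _ tE; case/mapP: jJ' => t' _ tE'.
  have := card0_eq m0 ((t, t'), (t', t)); rewrite !inE /N /C /cl /= -tE -tE'.
  by rewrite cj cj' Fj Fj' jj' eqxx addrC eqxx.
have -> : Q (fun j j' i i' => if C j j' i i' then ff j j' i i' else 0) =
   Q (fun j j' i i' => if N j j' i i' then ket D else 0)
   - (Q (fun j j' i i' => if C j j' i i' && (i < j') then gg j j' i i' else 0)
      + Q (fun j j' i i' => if C j j' i i' && (j' < i) then gg j j' i i' else 0)).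
  rewrite -QD -QN -QD; apply: eq_Q => j j' i i'; rewrite /N.
  case: (boolP (C _ _ _ _)) => [/and3P[_ jj' /eqP ij]|_] /=; last by rewrite addr0 subr0.
  have [ij'|ij'|ij'] := ltrgtP i j'.
  - rewrite ffE; have -> : (i == j') = false by lia.
    by rewrite /= addr0.
  - rewrite ffE; have -> : (i == j') = false by lia.
    by rewrite /= !add0r.
  have i'j : i' = j by lia.
  rewrite addr0 subr0 /= /ff ij' i'j.
  have fcK b x E : fc (~~ b) x (fc b x (ket E)) = if filled E x == b then ket E else 0.
    rewrite fcU; case: (eqVneq (filled E x) b) => [Fx|_]; last by rewrite linear0.
    rewrite linearZ /= fcU filled_toggle eqxx Fx eqxx toggleK scalerA.
    by rewrite jw_sign_toggle (proj1 ltP) mul1r jw_sign_sqr scale1r.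
  have -> : fc true j' (fc false j' (fc true j (ket D)))
          = if ~~ filled D j' then fc true j (ket D) else 0.
    rewrite (fcU A lt true j); case: (_ == true); last by rewrite !linear0 if_same.
    rewrite !linearZ /= (fcK false) filled_toggle.
    have /negPf -> : j' != j by lia.
    by case: (filled D j'); rewrite ?scaler0.
  rewrite andbC; case: (filled D j'); rewrite ?linear0 //= (fcK true).
  by case: (filled D j).
rewrite [X in _ - (X + _)]antisym0 ?[X in _ - (_ + X)]antisym0 ?addr0 ?subr0.
- rewrite /Q -big_mkcond sumr_const -/m -scaler_nat //.
- rewrite [LHS]swap_i' -QN; apply: eq_Q => j j' i i'; rewrite ggi'.
  have -> : C j i' i j' && (i' < i) = C j j' i i' && (j' < i).
    rewrite /C /cl; case: (inclass c j) (inclass c j') (inclass c i) (inclass c i') => [] [] []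
      [] //=.
    by lia.
  by case: (_ && _); rewrite ?oppr0.
- rewrite [LHS]swap_i -QN; apply: eq_Q => j j' i i'; rewrite ggi.
  have -> : C i j' j i' && (j < j') = C j j' i i' && (i < j').
    rewrite /C /cl; case: (inclass c j) (inclass c j') (inclass c i) (inclass c i') => [] [] []
      [] //=.
    by lia.
  by case: (_ && _); rewrite ?oppr0.
Qed.

End Sugawara.
End Modes.

(** * Charge, energy and charged vacua *)

Lemma big_toggle_add (V : zmodType) (f : int -> V) j D :
  \sum_(i <- toggle j D) f i = (if j \in D then - f j else f j) + \sum_(i <- D) f i.
Proof.
rewrite /toggle; case: (boolP (j \in D)) => jD; last by rewrite big_fsetU1.
by rewrite (big_fsetD1 j jD) /= addrA addNr add0r.
Qed.

Definition charge (D : maya) : int := \sum_(i <- D) (if 0 <= i then -1 else 1).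
Definition energy (D : maya) : int := \sum_(i <- D) `|i|.

Lemma charge_toggle j D : charge (toggle j D) = charge D + (if filled D j then -1 else 1).
Proof.
rewrite /charge big_toggle_add addrC; congr (_ + _); rewrite /filled.
by case: (0 <= j); case: (j \in D).
Qed.

Lemma energy_toggle j D : energy (toggle j D) = energy D + (if filled D j then j else - j).
Proof.
rewrite /energy big_toggle_add addrC; congr (_ + _); rewrite /filled.
by have [j0|j0] := leP 0 j; case: (j \in D) => /=; lia.
Qed.

Lemma energy_ge0 D : 0 <= energy D.
Proof. by apply: sumr_ge0. Qed.

(** The positions at which the shifted vacuum filled from l on differs from the vacuum
    filled from 0 on. *)
Definition itv (l : int) : seq int :=
  match l with
  | Posz m => [seq i%:Z | i <- iota 0 m]
  | Negz m => [seq Negz i | i <- iota 0 m.+1]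
  end.

Lemma itv_uniq l : uniq (itv l).
Proof. by case: l => m; rewrite map_inj_uniq ?iota_uniq // => x y []. Qed.

Lemma mem_itv l i : (i \in itv l) = (0 <= i) (+) (l <= i).
Proof.
case: l => m /=.
  apply/mapP/idP => [[k]|h]; first by rewrite mem_iota => ? ->; lia.
  by exists `|i|%N; rewrite ?mem_iota; lia.
rewrite -[_ :: _]/[seq Negz k | k <- iota 0 m.+1].
apply/mapP/idP => [[k]|h]; first by rewrite mem_iota => ? ->; lia.
by exists `|i|.-1; rewrite ?mem_iota; lia.
Qed.

Section Singular.
Variables (A : fieldType) (lt : rel int).
Hypothesis ltP : tournament lt.
Hypothesis char0 : forall m : nat, m.+1%:R != 0 :> A.
Variables (n : nat) (n_gt0 : (0 < n)%N).
Local Notation F := (fermions A).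
Local Notation fc := (@fc A lt).
Local Notation ket := (@ket A).
Local Notation cur := (@cur A lt).
Local Notation normal_pair := (@normal_pair A lt).
Local Notation mode := (@mode A lt n).
Implicit Types (v x : F) (D E : maya).

Lemma decomp (j : int) : exists i (b : 'I_n), j = n%:Z * i + b%:Z.
Proof.
have n0 : n%:Z != 0 by lia.
have h0 := modz_ge0 j n0; have h1 := ltz_pmod j (d := n%:Z).
have bn : (`|(j %% n%:Z)%Z| < n)%N by have := h1 n_gt0; lia.
exists (j %/ n%:Z)%Z, (Ordinal bn) => /=.
by rewrite {1}(divz_eq j n%:Z) mulrC; congr (_ + _); lia.
Qed.

Lemma decomp_inj i i' (b b' : 'I_n) :
  n%:Z * i + b%:Z = n%:Z * i' + b'%:Z -> i = i' /\ b = b'.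
Proof.
move=> h; have := inclassE b b i; rewrite h inclassE eqxx => /eqP b'E.
split=> //; move: h; rewrite b'E => /addIr; apply: mulfI; lia.
Qed.

(** In each residue class the filled positions form an up-set: the diagram is a vacuum
    in every component. *)
Definition upclosed D := forall j, filled D j -> filled D (j + n%:Z).

Lemma upclosedM D j (k : nat) : upclosed D -> filled D j -> filled D (j + n%:Z * k%:Z).
Proof.
move=> up Fj; elim: k => [|k IH]; first by rewrite mulr0 addr0.
have -> : j + n%:Z * k.+1%:Z = (j + n%:Z * k%:Z) + n%:Z by rewrite -addn1 PoszD; ring.
exact: up.
Qed.

(** The Sugawara operators kill a singular vector and are diagonal, so that it is
    supported on diagrams with eigenvalue 0. *)
Lemma singular_upclosed x : (forall c (k : nat), (0 < k)%N -> mode c k x = 0) ->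
  forall D, coef D x != 0 -> upclosed D.
Proof.
move=> sx D Dx j Fj.
have [i [c jE]] := decomp j.
have cj : inclass c j by rewrite jE inclassE.
pose K := (\max_(E <- ksupp x) spread E).*2.+1.
have KE E : E \in ksupp x -> ((spread E).*2 < K)%N.
  by move=> Ex; rewrite ltnS leq_double (big_fsetD1 E Ex) /= leq_maxl.
have Dk : D \in ksupp x by rewrite mem_ksupp.
have [m [mE m0]] := sugawara ltP char0 n_gt0 c (KE D Dk).
suff m00 : m = 0%N by apply: (m0 m00 j) => //; rewrite ?/inclass ?modzDr //; lia.
have : coef D (sugawara_op lt c K x) = 0.
  by rewrite /sugawara_op big_nat big1 ?coef0 // => k /andP[k0 _]; rewrite sx ?linear0.
rewrite (ketE x) (linear_bigsum (sugawara_op_linear _ _ _)) coef_sum (big_fsetD1 D Dk) /=.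
rewrite (linear_homo (sugawara_op_linear _ _ _)) mE !coefZ coef_ket eqxx mulr1.
rewrite big1_seq ?addr0 => [/eqP|E /andP[_]].
  rewrite mulf_eq0 (negPf Dx) /=; case: (m) => // m'.
  by rewrite (negPf (char0 m')).
rewrite !inE => /andP[ED /KE KE'].
have [m' [m'E _]] := sugawara ltP char0 n_gt0 c KE'.
by rewrite (linear_homo (sugawara_op_linear _ _ _)) m'E !coefZ coef_ket (negPf ED) !mulr0.
Qed.

Lemma lowering_upclosed al (k : nat) v D :
  (0 < k)%N -> upclosed D -> coef D (cur al (n%:Z * - k%:Z) v) = 0.
Proof.
move=> k0 up; have nk : (0 < n * k)%N by rewrite muln_gt0 n_gt0.
rewrite (ketE v) linear_sum coef_sum big1 // => E _.
rewrite linearZ coefZ /= curU coef_sum big1 ?mulr0 // => j _.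
rewrite coefZ (@normal_pair_off A lt); last by lia.
case: (boolP (filled E j && _)) => [/andP[Fj Fjk]|_]; last by rewrite coef0 mulr0.
rewrite coefZ coef_ket; case: eqP => [h|_]; last by rewrite !mulr0.
set j' := j + n%:Z * - k%:Z in h Fjk.
have jj' : j != j' by rewrite /j'; lia.
have F1 : filled D j' by rewrite -h !filled_toggle eqxx eq_sym (negPf jj') (negPf Fjk).
have F2 : filled D j = false by rewrite -h !filled_toggle eqxx (negPf jj') Fj.
have := upclosedM k up F1; rewrite (_ : j' + _ = j) ?F2 // /j'; ring.
Qed.

Lemma creation_upclosed c (k : nat) v D :
  (0 < k)%N -> upclosed D -> coef D (mode c (- k%:Z) v) = 0.
Proof. exact: lowering_upclosed. Qed.

(** By induction on the energy: if D is not a vacuum in every component, some Sugawara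
    eigenvalue m is nonzero, and m D is a sum of a_c[-k] a_c[k] D in which a_c[k] D is a
    combination of diagrams of lower energy. *)
Lemma creation_generated (P : F -> Prop) :
    P 0 -> (forall x y, P x -> P y -> P (x + y)) -> (forall a x, P x -> P (a *: x)) ->
    (forall c (k : nat) x, (0 < k)%N -> P x -> P (mode c (- k%:Z) x)) ->
    (forall D, upclosed D -> charge D = 0 -> P (ket D)) ->
  forall D, charge D = 0 -> P (ket D).
Proof.
move=> P0 PD PZ Pm Pv D; have Psum (I : Type) (r : seq I) (f : I -> F) :
    (forall i, P (f i)) -> P (\sum_(i <- r) f i).
  move=> Pf; elim: r => [|i r IH]; rewrite ?big_nil // big_cons.
  exact: PD.
have [N] := ubnP `|energy D|%N; elim: N D => // N IH D EN D0.
pose K := (spread D).*2.+1.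
have KD : ((spread D).*2 < K)%N by [].
case: (pselect (upclosed D)) => [up|nup]; first exact: Pv.
have [c [m m0]] : exists (c : 'I_n) (m : nat), m.+1%:R *: ket D = sugawara_op lt c K (ket D).
  apply: contrapT => H; apply: nup => j Fj.
  have [i [c jE]] := decomp j.
  have cj : inclass c j by rewrite jE inclassE.
  have [[|m] [mE m0]] := sugawara ltP char0 n_gt0 c KD; last first.
    by case: H; exists c, m.
  by apply: (m0 erefl j) => //; rewrite ?/inclass ?modzDr //; lia.
have -> : ket D = m.+1%:R^-1 *: sugawara_op lt c K (ket D).
  by rewrite -m0 scalerA mulVf ?scale1r.
apply: (PZ); rewrite /sugawara_op big_nat; apply: big_ind => // k /andP[k0 _].
have nk : (0 < n * k)%N by rewrite muln_gt0 n_gt0.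
apply: Pm => //; rewrite /mode curU; apply: big_ind => // j _; apply: (PZ).
rewrite (@normal_pair_off A lt); last by lia.
case: (boolP (filled D j && _)) => [/andP[Fj Fjk]|_]; last exact: P0.
have jj : j + n%:Z * k%:Z != j by lia.
have Fjk' : filled (toggle j D) (j + n%:Z * k%:Z) = false.
  by rewrite filled_toggle (negPf jj) (negPf Fjk).
apply/PZ/IH; last by rewrite !charge_toggle Fj Fjk' D0.
have := energy_ge0 D.
have := energy_ge0 (toggle (j + n%:Z * k%:Z) (toggle j D)).
by rewrite !energy_toggle Fj Fjk'; lia.
Qed.

(** Component b is filled from position l_b on. *)
Definition vacset (l : {ffun 'I_n -> int}) : maya :=
  seq_fset tt [seq n%:Z * i + (b : 'I_n)%:Z | b <- enum 'I_n, i <- itv (l b)].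

Lemma big_vacset (V : Type) (idx : V) (op : Monoid.com_law idx) (f : int -> V) l :
  \big[op/idx]_(j <- vacset l) f j
  = \big[op/idx]_(b < n) \big[op/idx]_(i <- itv (l b)) f (n%:Z * i + (b : 'I_n)%:Z).
Proof.
rewrite -[RHS]big_enum -big_allpairs_dep /=.
rewrite (perm_big _ (seq_fset_perm tt _)) undup_id //.
apply: allpairs_uniq_dep => [|b _|[b i] [b' i'] _ _ /=]; [exact: enum_uniq | exact: itv_uniq |].
by move=> /decomp_inj[-> ->].
Qed.

Lemma in_vacset l i (b : 'I_n) : (n%:Z * i + b%:Z \in vacset l) = (i \in itv (l b)).
Proof.
rewrite seq_fsetE; apply/allpairsPdep/idP => [[b' [i' [_ h /decomp_inj[-> ->]]]]|h] //.
by exists b, i; rewrite mem_enum.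
Qed.

Lemma filled_vacset l i (b : 'I_n) : filled (vacset l) (n%:Z * i + b%:Z) = (l b <= i).
Proof.
rewrite /filled in_vacset mem_itv.
have -> : (0 <= n%:Z * i + b%:Z) = (0 <= i) by have := ltn_ord b; nia.
by rewrite addKb.
Qed.

Lemma vacset_inj : injective vacset.
Proof.
move=> l l' h; apply/ffunP => b.
have e i : (l b <= i) = (l' b <= i) by rewrite -!filled_vacset h.
by apply/eqP; rewrite eq_le e lexx -e lexx.
Qed.

Lemma vacset0 : vacset [ffun=> 0] = fset0.
Proof.
apply: filled_inj => j; have [i [b ->]] := decomp j.
rewrite filled_vacset ffunE filled0; have := ltn_ord b; nia.
Qed.

Lemma upclosed_vacset l : upclosed (vacset l).
Proof.
move=> j; have [i [b ->]] := decomp j; rewrite filled_vacset => h.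
have -> : n%:Z * i + b%:Z + n%:Z = n%:Z * (i + 1) + b%:Z by ring.
rewrite filled_vacset; lia.
Qed.

(** The threshold of component b is the first filled position; it exists because
    positions far below 0 are empty and those far above are filled. *)
Lemma upclosedE D : upclosed D -> exists l, D = vacset l.
Proof.
move=> up.
have th b : exists t, forall i, filled D (n%:Z * i + (b : 'I_n)%:Z) = (t <= i).
  pose B := (spread D).+1%:Z; pose p (k : nat) := filled D (n%:Z * (k%:Z - B) + b%:Z).
  have bn := ltn_ord b.
  have ex : exists k, p k.
    exists (2 * (spread D).+1)%N; apply/negPn/negP => /filled_hi.
    have -> : (2 * (spread D).+1)%N%:Z - B = (spread D)%:Z + 1 by rewrite /B; lia.
    have : (spread D <= n * spread D)%N by rewrite leq_pmull.
    by lia.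
  case: (ex_minnP ex) => k pk kmin; exists (k%:Z - B) => i.
  apply/idP/idP => [Fi|ki].
    have lo := filled_lo Fi; have iB : 0 <= i + B by rewrite /B; nia.
    have := kmin `|(i + B)%R|%N; rewrite /p.
    have -> : `|(i + B)%R|%N%:Z - B = i by lia.
    by move=> /(_ Fi); lia.
  have := upclosedM `|(i - (k%:Z - B))%R|%N up pk.
  by congr (filled D _); rewrite gez0_abs; [ring | lia].
have [l lP] := choice th; exists [ffun b => l b].
apply: filled_inj => j; have [i [b ->]] := decomp j.
by rewrite filled_vacset ffunE.
Qed.

Lemma charge_vacset l : charge (vacset l) = - \sum_b l b.
Proof.
rewrite /charge big_vacset -sumrN; apply: eq_bigr => b _.
have bn := ltn_ord b.
transitivity (\sum_(i <- itv (l b)) (if 0 <= i then -1 else 1 : int)).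
  by apply: eq_bigr => i _; have -> : (0 <= n%:Z * i + b%:Z) = (0 <= i) by nia.
case: (l b) => m; rewrite /itv big_map big_const_seq.
  by rewrite count_predT size_iota iter_addr_0 mulNrn natz.
by rewrite count_predT size_iota iter_addr_0 NegzE opprK natz.
Qed.

End Singular.

(** * Signs and bilinears of the n-component fermion *)

(** Folds Z around the Fermi surface, which lies between -1 and 0: the value grows with
    the distance to it. *)
Definition fold (i : int) : nat := match i with Posz m => m.*2 | Negz m => m.*2.+1 end.

Lemma fold_inj : injective fold.
Proof. by case=> [i|i] [j|j] /= h; first [congr Posz; lia | congr Negz; lia | exfalso; lia]. Qed.

Lemma fold_itv l i : i \in itv l -> (fold i <= fold l)%N /\ (fold i <= fold (l - 1))%N.
Proof.
rewrite mem_itv.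
have fE (x : int) : fold x = if 0 <= x then `|x|.*2 else `|x|.*2.-1 by case: x => m //=; lia.
case: (leP 0 i); case: (leP l i) => //= h1 h2 _; rewrite !fE; split; do !case: ifP => ?; lia.
Qed.

Section Order.
Variables (n : nat) (n_gt0 : (0 < n)%N).

(** Components are ordered by their index, and inside a component the positions far from
    the Fermi surface come first.  Then the positions between the vacuum and a shifted
    vacuum of the same component never precede the position filled or emptied next, and
    only the other components contribute signs ([jw_sign_vacset]). *)
Definition mode_order : rel int := fun i j =>
  let: (i', j') := ((i %/ n%:Z)%Z, (j %/ n%:Z)%Z) in
  let: (b, c) := ((i %% n%:Z)%Z, (j %% n%:Z)%Z) in
  (b < c) || (b == c) && (fold j' < fold i')%N.

Lemma modz_dec i (b : 'I_n) : ((n%:Z * i + b%:Z) %% n%:Z)%Z = b.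
Proof. by have := inclassE b b i; rewrite eqxx => /eqP. Qed.

Lemma divz_dec i (b : 'I_n) : ((n%:Z * i + b%:Z) %/ n%:Z)%Z = i.
Proof.
have := divz_eq (n%:Z * i + b%:Z) n%:Z; rewrite modz_dec => /addIr.
have n0 : n%:Z != 0 by lia.
by rewrite mulrC => /(mulIf n0).
Qed.

Lemma mode_orderE i (b : 'I_n) j (c : 'I_n) :
  mode_order (n%:Z * i + b%:Z) (n%:Z * j + c%:Z) =
  (b < c)%N || (b == c) && (fold j < fold i)%N.
Proof. by rewrite /mode_order !modz_dec !divz_dec. Qed.

Lemma mode_orderP : tournament mode_order.
Proof.
split=> [i|i j].
  by have [x [b ->]] := decomp n_gt0 i; rewrite mode_orderE eqxx !ltnn.
have [x [b ->]] := decomp n_gt0 i; have [y [c ->]] := decomp n_gt0 j.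
rewrite !mode_orderE => ij.
have e1 : (b == c) = (nat_of_ord b == nat_of_ord c) by [].
have e2 : (c == b) = (nat_of_ord c == nat_of_ord b) by [].
have [bc|bc|bc] := ltngtP b c.
- by rewrite e1 e2; lia.
- by rewrite e1 e2; lia.
have xy : fold x != fold y.
  by rewrite (inj_eq fold_inj); apply: contraNneq ij => ->; rewrite (val_inj bc).
by rewrite e1 e2; lia.
Qed.

(** Up to sign, the total charge of the components that precede b; (-1) to this power is
    the Klein factor of the b-th fermion field. *)
Definition below (l : {ffun 'I_n -> int}) (b : 'I_n) : int := \sum_(r < n | (r < b)%N) l r.

Section Signs.
Variable A : fieldType.
Local Notation sgn x := ((-1 : A) ^ (x : int)).
Implicit Types (l : {ffun 'I_n -> int}) (a b : 'I_n).

Let N1 : (-1 : A) != 0. Proof. by rewrite oppr_eq0 oner_neq0. Qed.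

Lemma sgnD (x y : int) : sgn (x + y) = sgn x * sgn y.
Proof. exact: expfzDr. Qed.

Lemma sgn_sqr (x : int) : sgn x * sgn x = 1.
Proof.
rewrite -sgnD (_ : x + x = 2 * x); last by ring.
by rewrite -exprz_exp (_ : (-1) ^ 2 = 1) ?exp1rz // -exprnP sqrrN expr1n.
Qed.

Lemma sgn_abs (x : int) : (-1) ^+ `|x|%N = sgn x.
Proof.
case: x => m //; rewrite NegzE -exprnN abszN /=.
by rewrite -exprVn invrN1.
Qed.

Lemma sgn_sum (P : pred 'I_n) (f : 'I_n -> int) :
  sgn (\sum_(r < n | P r) f r) = \prod_(r < n | P r) sgn (f r).
Proof. by apply: big_morph => // x y; exact: sgnD. Qed.

Lemma jw_sign_vacset l b (i : int) : (i == l b) || (i == l b - 1) ->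
  jw_sign A mode_order (vacset l) (n%:Z * i + b%:Z) = sgn (below l b).
Proof.
move=> ilb; rewrite jw_sign.unlock big_vacset // /below sgn_sum [RHS]big_mkcond /=.
apply: eq_bigr => r _.
transitivity (\prod_(i' <- itv (l r)) (-1) ^+ (r < b)%N : A).
  apply: eq_big_seq => i' i'l; rewrite mode_orderE.
  have [rb|rb] := eqVneq r b; last by rewrite orbF.
  have [h1 h2] := fold_itv i'l; rewrite rb ltnn /=.
  suff -> : (fold i < fold i')%N = false by [].
  by apply/negbTE; rewrite -leqNgt; case/orP: ilb => /eqP ->; rewrite -rb.
case: (r < b)%N; last by rewrite big1.
rewrite big_const_seq count_predT iter_mulr_1 expr1 -sgn_abs; congr (_ ^+ _).
by case: (l r) => m; rewrite /itv size_map size_iota.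
Qed.

Lemma toggle_vacset l b : toggle (n%:Z * l b + b%:Z) (vacset l) = vacset (l + Qvec b).
Proof.
apply: filled_inj => j; have [i [c ->]] := decomp n_gt0 j.
rewrite filled_toggle !filled_vacset // !ffunE.
have [->|cb] := eqVneq c b.
  have -> : (n%:Z * i + b%:Z == n%:Z * l b + b%:Z) = (i == l b).
    by apply/eqP/eqP => [/(decomp_inj n_gt0)[]|->].
  by rewrite addrC /= ; case: (ltgtP i (l b)); lia.
rewrite addr0; case: eqP => // /(decomp_inj n_gt0)[_ h].
by rewrite h eqxx in cb.
Qed.

Lemma toggle_vacset_down l a :
  toggle (n%:Z * (l a - 1) + a%:Z) (vacset l) = vacset (l - Qvec a).
Proof.
apply: (inv_inj (toggleK (n%:Z * (l a - 1) + a%:Z))); rewrite toggleK.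
have := toggle_vacset (l - Qvec a) a; rewrite !ffunE eqxx => ->.
by rewrite subrK.
Qed.

Lemma below_Qvec l a b : below (l + Qvec b) a = below l a + (b < a)%N%:Z.
Proof.
rewrite /below; under eq_bigr => r _ do rewrite !ffunE; rewrite big_split /=; congr (_ + _).
case: (boolP (b < a)%N) => ba.
  rewrite (bigD1 b) //= eqxx big1 ?addr0 // => r /andP[_ /negPf ->] //.
rewrite big1 // => r ra; case: eqP => // rb.
by rewrite rb in ra; rewrite ra in ba.
Qed.

Lemma below_between l a b : sgn (below l b) * sgn (below l a)
  = sgn (\sum_(r < n | (minn a b <= r < maxn a b)%N) l r).
Proof.
wlog ab : a b / (a <= b)%N => [H|].
  by case/orP: (leq_total a b) => h; [exact: H | rewrite mulrC minnC maxnC; exact: H].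
rewrite (minn_idPl ab) (maxn_idPr ab).
have -> : below l b = below l a + \sum_(r < n | (a <= r < b)%N) l r.
  rewrite /below (bigID (fun r : 'I_n => (r < a)%N)) /=; congr (_ + _); apply: eq_bigl => r; lia.
by rewrite sgnD mulrAC sgn_sqr mul1r.
Qed.

(** The two Klein factors multiply to the sign of the charges between a and b, and for
    b < a the position already emptied in component b contributes one more sign. *)
Lemma bil_vacset l a b : a != b ->
  fc mode_order false (n%:Z * (l a - 1) + a%:Z)
     (fc mode_order true (n%:Z * l b + b%:Z) (ket A (vacset l)))
  = ((-1) ^+ (b < a)%N * sgn (\sum_(r < n | (minn a b <= r < maxn a b)%N) l r))
      *: ket A (vacset (l + (Qvec b - Qvec a))).
Proof.
move=> ab; rewrite fcU filled_vacset // lexx eqxx linearZ /= toggle_vacset.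
have la : (l + Qvec b) a = l a by rewrite !ffunE (negPf ab) addr0.
have := toggle_vacset_down (l + Qvec b) a; rewrite la => tE.
rewrite fcU filled_vacset // la.
have -> : (l a <= l a - 1) = false by lia.
rewrite eqxx scalerA tE addrA; congr (_ *: _).
rewrite !jw_sign_vacset ?la ?eqxx ?orbT // below_Qvec sgnD mulrA below_between mulrC; congr (_ * _).
Qed.

End Signs.
End Order.

(** The r-th coefficient of psi*_b(q^s z) psi_a(q^t z) for two distinct components, as a
    current: position ni + b is emptied and n(i-r-1) + a is filled, with the power of q
    recording the two positions. *)
Section Bilinear.
Variables (A : fieldType) (qpow : rat -> A).
Variables (n : nat) (n_gt0 : (0 < n)%N).
Local Notation lt := (mode_order n).
Local Notation F := (fermions A).
Local Notation cur := (@cur A lt).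
Local Notation ket := (@ket A).
Local Notation fc := (@fc A lt).
Let ltP : tournament lt := mode_orderP n_gt0.
Variables (a b : 'I_n) (s t : rat).

Definition bil_coef (r j : int) : A :=
  let i := (j %/ n%:Z)%Z in
  if inclass b j then qpow (s * i%:Q - t * (i - r)%:Q) else 0.

Definition bil_shift (r : int) : int := - (n%:Z * (r + 1)) + a%:Z - b%:Z.

Definition bilin (r : int) : F -> F := cur (bil_coef r) (bil_shift r).

Lemma bil_coefE r i (c : 'I_n) : bil_coef r (n%:Z * i + c%:Z) =
  if c == b then qpow (s * i%:Q - t * (i - r)%:Q) else 0.
Proof. by rewrite /bil_coef inclassE divz_dec. Qed.

Lemma bil_shiftE r i : n%:Z * i + b%:Z + bil_shift r = n%:Z * (i - r - 1) + a%:Z.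
Proof. by rewrite /bil_shift; ring. Qed.

Hypothesis ab : a != b.

(** In this degree only the lowest filled position of component b can be moved, and it
    goes to the highest empty position of component a. *)
Lemma bilin_lead (l : {ffun 'I_n -> int}) : bilin (l b - l a) (ket (vacset l)) =
  (qpow (s * (l b)%:Q - t * (l a)%:Q) *
   ((-1) ^+ (b < a)%N * (-1) ^ (\sum_(r < n | (minn a b <= r < maxn a b)%N) l r)))
     *: ket (vacset (l + (Qvec b - Qvec a))).
Proof.
pose j0 := n%:Z * l b + b%:Z; pose L := bil_shift (l b - l a).
pose r := undup (j0 :: reach (vacset l) L).
have ur : uniq r by exact: undup_uniq.
have j0r : j0 \in r by rewrite mem_undup inE eqxx.
rewrite /bilin -/L (curE ltP _ ur) => [|j jr]; last by rewrite mem_undup inE jr orbT.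
have jL : j0 + L = n%:Z * (l a - 1) + a%:Z by rewrite /j0 /L bil_shiftE; congr (n%:Z * _ + _); ring.
have neq : j0 + L != j0.
  rewrite jL; apply: contraNneq ab => /(decomp_inj n_gt0)[_ ->] //.
transitivity (\sum_(j <- r) if j == j0 then bil_coef (l b - l a) j *: normal_pair lt (j + L) j
  (ket (vacset l)) else 0).
  apply: eq_big_seq => j _; case: eqP => // jj0.
  have [i [d jE]] := decomp n_gt0 j; rewrite jE bil_coefE in jj0 *.
  case: eqP => [db|]; last by rewrite scale0r.
  rewrite db in jj0 *; rewrite /L bil_shiftE (@normal_pair_off A lt) //; last first.
    by apply: contraNneq ab => /(decomp_inj n_gt0)[_ ->].
  rewrite !filled_vacset //; case: ifP => [h|_]; last by rewrite scaler0.
  by case: jj0; rewrite /j0; congr (n%:Z * _ + _); lia.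
rewrite (big_delta _ ur j0r) bil_coefE eqxx (normal_pair_neq lt _ neq) jL bil_vacset //.
by rewrite scalerA subKr.
Qed.

Lemma bilin_low r (l : {ffun 'I_n -> int}) : r < l b - l a -> bilin r (ket (vacset l)) = 0.
Proof.
move=> rl; rewrite /bilin curU big1 // => j _.
have [i [d ->]] := decomp n_gt0 j; rewrite bil_coefE.
case: eqP => [->|]; last by rewrite scale0r.
rewrite bil_shiftE (@normal_pair_off A lt) //; last first.
  by apply: contraNneq ab => /(decomp_inj n_gt0)[_ ->].
by rewrite !filled_vacset //; case: ifP => [h|_]; [lia | rewrite scaler0].
Qed.

(** A move of larger degree leaves a component that is no longer an up-set. *)
Lemma bilin_high r (l : {ffun 'I_n -> int}) D : l b - l a < r -> upclosed n D ->
  coef D (bilin r (ket (vacset l))) = 0.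
Proof.
move=> rl up; rewrite /bilin curU coef_sum big1 // => j _; rewrite coefZ.
have [i [d ->]] := decomp n_gt0 j; rewrite bil_coefE.
case: eqP => [->|]; last by rewrite mul0r.
rewrite bil_shiftE; set j0 := n%:Z * i + _; set j1 := n%:Z * (i - r - 1) + _.
have cl x y : n%:Z * x + a%:Z == n%:Z * y + b%:Z = false.
  by apply/negbTE; apply: contraNneq ab => /(decomp_inj n_gt0)[_ ->].
rewrite (@normal_pair_off A lt) //; last by rewrite cl.
case: (boolP (_ && _)) => [/andP[h0 h1]|_]; last by rewrite coef0 mulr0.
rewrite coefZ coef_ket; case: eqP => [DE|_]; last by rewrite !mulr0.
move: h0 h1; rewrite !filled_vacset // => h0 h1.
have FD x : filled D x = (x == j1) (+) ((x == j0) (+) filled (vacset l) x).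
  by rewrite -DE !filled_toggle.
have inj_n x y (c : 'I_n) : (n%:Z * x + c%:Z == n%:Z * y + c%:Z) = (x == y).
  by apply/eqP/eqP => [/(decomp_inj n_gt0)[]|->].
have [ilb|ilb] := eqVneq i (l b).
  have := up j1; rewrite !FD eqxx cl filled_vacset //.
  have -> : j1 + n%:Z = n%:Z * (i - r - 1 + 1) + a%:Z by rewrite /j1; ring.
  rewrite cl inj_n filled_vacset //.
  have -> : (l a <= i - r - 1) = false by lia.
  have -> : (l a <= i - r - 1 + 1) = false by lia.
  have -> : (i - r - 1 + 1 == i - r - 1) = false by lia.
  by move=> /(_ isT).
have := up (n%:Z * (i - 1) + b%:Z); rewrite !FD ![_ == j1]eq_sym !cl !inj_n filled_vacset //.
have -> : n%:Z * (i - 1) + b%:Z + n%:Z = j0 by rewrite /j0; ring.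
rewrite eqxx cl filled_vacset // h0.
have -> : (l b <= i - 1) by lia.
have -> : (i - 1 == i) = false by lia.
by move=> /(_ isT).
Qed.

Variables (q : A) (qpowP : fractional_powers q qpow).

Lemma bilin_bracket (c : 'I_n) k r v : k != 0 ->
  mode lt c k (bilin r v) - bilin r (mode lt c k v)
  = ((c == a)%:R * qpow (t * k%:Q) - (c == b)%:R * qpow (s * k%:Q)) *: bilin (r - k) v.
Proof.
move=> k0; rewrite /mode /bilin (cur_bracket ltP).
have -> : n%:Z * k + bil_shift r = bil_shift (r - k) by rewrite /bil_shift; ring.
have -> : (bil_shift (r - k) == 0) = false.
  apply/negbTE; apply: contraNneq ab => h.
  have : n%:Z * (r - k + 1) + b%:Z = n%:Z * 0 + a%:Z by move: h; rewrite /bil_shift; lia.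
  by move/(decomp_inj n_gt0) => [_ ->].
rewrite scale0r addr0 -curZ; apply: cur_ext => j.
have [i [d ->]] := decomp n_gt0 j.
have -> : n%:Z * i + d%:Z + n%:Z * k = n%:Z * (i + k) + d%:Z by ring.
rewrite !bil_coefE; have [->|db] := eqVneq d b; last by rewrite mul0r mulr0 mulr0 subr0.
rewrite bil_shiftE !inclassE [c == a]eq_sym [c == b]eq_sym.
have -> : qpow (s * i%:Q - t * (i - r)%:Q)
        = qpow (t * k%:Q) * qpow (s * i%:Q - t * (i - (r - k))%:Q).
  by rewrite -(qpowD qpowP); congr qpow; rewrite !(rmorphB, rmorphD) /=; ring.
have -> : qpow (s * (i + k)%:Q - t * (i + k - r)%:Q)
        = qpow (s * k%:Q) * qpow (s * i%:Q - t * (i - (r - k))%:Q).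
  by rewrite -(qpowD qpowP); congr qpow; rewrite !(rmorphB, rmorphD) /=; ring.
ring.
Qed.

End Bilinear.

(** * Coefficients of normally ordered exponentials *)

Section ExpCoef.
Variables (A : fieldType) (V : lmodType A).
Hypothesis char0 : forall m : nat, m.+1%:R != 0 :> A.
Variable X : nat -> V -> V.
Hypothesis X_linear : forall k, linear (X k).

Lemma pow_coef_linear j m : linear (pow_coef X j m).
Proof.
elim: j m => [|j IH] m /=.
  by apply: linear_iff; [exact: linear_idf | exact: linear_0f].
by apply: linear_sumf => k; apply: linear_compf.
Qed.

Lemma exp_coef_linear m : linear (exp_coef X m).
Proof. by apply: linear_sumf => j; apply/linear_scalef/pow_coef_linear. Qed.

Lemma pow_coef_gt j m v : (m < j)%N -> pow_coef X j m v = 0.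
Proof.
elim: j m => //= j IH m mj; rewrite big_nat big1 // => k /andP[k0 km].
by rewrite IH ?(linear_0 (X_linear _)) //; lia.
Qed.

Lemma pow_coef_vac v j m : (forall k, (0 < k)%N -> X k v = 0) ->
  pow_coef X j m v = if (j == 0%N) && (m == 0%N) then v else 0.
Proof.
move=> Xv; elim: j m => [|j IH] m //=; rewrite big_nat big1 // => k /andP[k0 km].
by rewrite IH; case: ifP => _; rewrite ?Xv ?(linear_0 (X_linear _)).
Qed.

Lemma exp_coef_vac v m : (forall k, (0 < k)%N -> X k v = 0) ->
  exp_coef X m v = if m == 0%N then v else 0.
Proof.
move=> Xv; rewrite /exp_coef big_nat_recl //= big1_seq ?addr0 => [|j _].
  by case: eqP => _; rewrite ?scaler0 // fact0 invr1 scale1r.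
by have /= -> := pow_coef_vac j.+1 m Xv; rewrite scaler0.
Qed.

Lemma exp_coef0 v : exp_coef X 0 v = v.
Proof. by rewrite /exp_coef big_nat1 /= fact0 invr1 scale1r. Qed.

Section Derivation.
Variables (T : V -> V) (d : nat) (xi : A).
Hypotheses (T_linear : linear T) (d_gt0 : (0 < d)%N).
Hypothesis XT : forall k v, (0 < k)%N ->
  X k (T v) = T (X k v) + (if k == d then xi *: v else 0).

Lemma pow_coef_derivation j m v : pow_coef X j m (T v) = T (pow_coef X j m v)
  + (if (d <= m)%N then (j%:R * xi) *: pow_coef X j.-1 (m - d) v else 0).
Proof.
elim: j m => [|j IH] m.
  rewrite mul0r scale0r if_same addr0 /=.
  by case: eqP => // _; rewrite (linear_0 T_linear).
rewrite /= (linear_bigsum T_linear).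
transitivity (\sum_(1 <= k < m.+1) (T (X k (pow_coef X j (m - k) v)) +
   ((if k == d then xi *: pow_coef X j (m - k) v else 0) +
    (if (d <= m - k)%N then (j%:R * xi) *: X k (pow_coef X j.-1 (m - k - d) v) else 0)))).
  rewrite !big_nat; apply: eq_bigr => k /andP[k0 km].
  rewrite IH (linear_additive (X_linear k)) XT // -!addrA; congr (_ + (_ + _)).
  by case: (d <= m - k)%N; rewrite ?(linear_0 (X_linear k)) // (linear_homo (X_linear k)).
rewrite big_split; congr (_ + _); rewrite big_split /=.
case: (leqP d m) => [dm|md]; last first.
  rewrite !big_nat !big1 ?addr0 // => k /andP[k0 km].
    by case: leqP => //; lia.
  by case: eqP => //; lia.
have -> : \sum_(1 <= k < m.+1) (if k == d then xi *: pow_coef X j (m - k) v else 0)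
    = xi *: pow_coef X j (m - d) v.
  rewrite (bigD1_seq d) ?iota_uniq ?mem_index_iota /= ?d_gt0 ?ltnS //= eqxx big1 ?addr0 //.
  by move=> k /negPf ->.
have -> : \sum_(1 <= k < m.+1) (if (d <= m - k)%N then
      (j%:R * xi) *: X k (pow_coef X j.-1 (m - k - d) v) else 0)
    = (j%:R * xi) *: pow_coef X j (m - d) v.
  case: j {IH} => [|j]; first by rewrite mul0r scale0r big1 // => k _; rewrite scale0r if_same.
  rewrite [pow_coef X j.+1 _ _]/= (big_cat_nat (n := (m - d).+1)) //=; last by lia.
  rewrite [X in _ + X]big_nat [X in _ + X]big1 ?addr0 => [|k /andP[k0 km]]; last first.
    by case: leqP => //; lia.
  rewrite scaler_sumr !big_nat; apply: eq_bigr => k /andP[k0 km].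
  have -> : (d <= m - k)%N by lia.
  by rewrite subnAC.
by rewrite -scalerDl -{1}[xi]mul1r -mulrDl -[1 + _](natrD _ 1 j).
Qed.

(** If [X_k, T] = xi for k = d and 0 otherwise, then commuting T through
    exp (sum_k X_k t^k) multiplies the exponential by xi t^d. *)
Lemma exp_coef_derivation m v : exp_coef X m (T v) = T (exp_coef X m v)
  + (if (d <= m)%N then xi *: exp_coef X (m - d) v else 0).
Proof.
rewrite /exp_coef (linear_bigsum T_linear).
transitivity (\sum_(0 <= j < m.+1) (T (j`!%:R^-1 *: pow_coef X j m v) +
   (if (d <= m)%N then (j`!%:R^-1 * (j%:R * xi)) *: pow_coef X j.-1 (m - d) v else 0))).
  apply: eq_bigr => j _; rewrite pow_coef_derivation scalerDr (linear_homo T_linear).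
  by congr (_ + _); case: (d <= m)%N; rewrite ?scaler0 ?scalerA.
rewrite big_split; congr (_ + _) => /=.
case: (leqP d m) => dm; last by rewrite big1.
rewrite big_nat_recl //= mul0r mulr0 scale0r add0r scaler_sumr.
rewrite (big_cat_nat (n := (m - d).+1)) //=; last by lia.
rewrite [X in _ + X]big_nat [X in _ + X]big1 ?addr0 => [|k /andP[k0 km]]; last first.
  by rewrite pow_coef_gt ?scaler0.
apply: eq_bigr => j _; rewrite scalerA; congr (_ *: _).
have f0 : (j`!)%:R != 0 :> A by have := fact_gt0 j; case: (j`!) => // f _; exact: char0.
rewrite factS natrM; field.
by rewrite f0 -[1 + _](natrD _ 1 j) char0.
Qed.

End Derivation.
End ExpCoef.

Section NormalCoef.
Variables (A : fieldType) (V : lmodType A).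
Hypothesis char0 : forall m : nat, m.+1%:R != 0 :> A.
Variables X Z : int -> V -> V.
Hypothesis X_linear : forall k, linear (X k).

(** The two exponentials of [normal_coef]: [create] collects the nonnegative and
    [destroy] the negative powers of z. *)
Definition create (z : int) (v : V) : V :=
  if z is Posz m then exp_coef (fun k => X k%:Z) m v else 0.
Definition destroy (e : nat) (v : V) : V := exp_coef (fun k => X (- k%:Z)) e v.

Lemma create_linear z : linear (create z).
Proof. case: z => m; [exact: exp_coef_linear | exact: linear_0f]. Qed.

Lemma destroy_linear e : linear (destroy e).
Proof. exact: exp_coef_linear. Qed.

Definition nterm (N : int) (rp : nat * nat) (v : V) : V :=
  create rp.1 (destroy rp.2 (Z (N - rp.1%:Z + rp.2%:Z) v)).

Definition summable N v :=
  exists2 r : seq (nat * nat), uniq r & forall rp, rp \notin r -> nterm N rp v = 0.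

Lemma normal_coef_seq N v r : uniq r -> (forall rp, rp \notin r -> nterm N rp v = 0) ->
  normal_coef X Z N v = \sum_(rp <- r) nterm N rp v.
Proof.
move=> ur r0; rewrite /normal_coef (fsbigE r) //; last by move=> rp _ /r0.
rewrite big_mkcond; apply: eq_bigr => rp _.
by have -> : rp \in [set: nat * nat]%classic by rewrite inE.
Qed.

Lemma normal_coef_comb N c u v : (forall M, linear (Z M)) -> summable N u -> summable N v ->
  summable N (c *: u + v) /\
  normal_coef X Z N (c *: u + v) = c *: normal_coef X Z N u + normal_coef X Z N v.
Proof.
move=> lZ [r1 _ h1] [r2 _ h2]; pose r := undup (r1 ++ r2).
have ur : uniq r by exact: undup_uniq.
have tlin rp : nterm N rp (c *: u + v) = c *: nterm N rp u + nterm N rp v.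
  by rewrite /nterm lZ destroy_linear create_linear.
have h1' rp : rp \notin r -> nterm N rp u = 0.
  by rewrite mem_undup mem_cat negb_or => /andP[/h1].
have h2' rp : rp \notin r -> nterm N rp v = 0.
  by rewrite mem_undup mem_cat negb_or => /andP[_ /h2].
have h rp : rp \notin r -> nterm N rp (c *: u + v) = 0.
  by move=> nr; rewrite tlin h1' // h2' // scaler0 addr0.
split; first by exists r.
rewrite !(normal_coef_seq ur) // scaler_sumr -big_split.
by apply: eq_bigr => rp _; exact: tlin.
Qed.

Lemma summable0 N : (forall M, linear (Z M)) -> summable N 0.
Proof.
move=> lZ; exists [::] => // rp _.
by rewrite /nterm (linear_0 (lZ _)) (linear_0 (destroy_linear _)) (linear_0 (create_linear _)).
Qed.

Lemma summableD N u v : (forall M, linear (Z M)) ->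
  summable N u -> summable N v -> summable N (u + v).
Proof. by move=> lZ su sv; have [] := normal_coef_comb 1 lZ su sv; rewrite scale1r. Qed.

Lemma summableZ N c u : (forall M, linear (Z M)) -> summable N u -> summable N (c *: u).
Proof. by move=> lZ su; have [] := normal_coef_comb c lZ su (summable0 N lZ); rewrite addr0. Qed.

Lemma nterm_graded N M0 E v rp :
    (forall M, M != M0 -> Z M v = 0) ->
    (forall e, (E <= e)%N -> destroy e (Z M0 v) = 0) ->
    rp \notin [seq (`|(N - M0 + e%:Z)%R|%N, e) | e <- iota 0 E & 0 <= N - M0 + e%:Z] ->
  nterm N rp v = 0.
Proof.
case: rp => a e ZM dE; have c0 := linear_0 (create_linear a).
apply: contraNeq; rewrite /nterm [(a, e).1]/= [(a, e).2]/=.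
have [M|M] := eqVneq (N - a%:Z + e%:Z) M0; last first.
  by rewrite ZM // (linear_0 (destroy_linear _)) c0 eqxx.
rewrite M; have [eE|eE] := ltnP e E; last first.
  by rewrite dE // c0 eqxx.
move=> _; apply/mapP; exists e; last by congr (_, _); lia.
by rewrite mem_filter mem_iota; lia.
Qed.

(** When Z v has the single component Z_{M0} v and [destroy] stops at E, the double sum
    collapses to the sum over e. *)
Lemma normal_coefE N M0 E v :
    (forall M, M != M0 -> Z M v = 0) ->
    (forall e, (E <= e)%N -> destroy e (Z M0 v) = 0) ->
  normal_coef X Z N v
  = \sum_(0 <= e < E) create (N - M0 + e%:Z) (destroy e (Z M0 v)).
Proof.
move=> ZM dE.
rewrite (normal_coef_seq _ (fun rp => @nterm_graded N M0 E v rp ZM dE)); last first.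
  by rewrite map_inj_uniq ?filter_uniq ?iota_uniq // => e e' [].
rewrite big_map big_filter [LHS]big_mkcond /= /index_iota subn0.
apply: eq_bigr => e _; case: (lerP 0 (N - M0 + e%:Z)) => g; last first.
  by case: (N - M0 + e%:Z) g.
rewrite /nterm /=; have -> : N - `|(N - M0 + e%:Z)%R|%N%:Z + e%:Z = M0 by lia.
by have -> : N - M0 + e%:Z = Posz `|(N - M0 + e%:Z)%R|%N by lia.
Qed.

Variables (I : Type) (cr : I -> V -> V) (dg : I -> nat) (xi : I -> A).
Hypotheses (cr_linear : forall i, linear (cr i)) (dg_gt0 : forall i, (0 < dg i)%N).
Hypothesis Xncr : forall i k v, (0 < k)%N ->
  X (- k%:Z) (cr i v) = cr i (X (- k%:Z) v) + (if k == dg i then xi i *: v else 0).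
Hypothesis Xpcr : forall i (k : nat) v, (0 < k)%N -> X k (cr i v) = cr i (X k v).
Hypothesis Zcr : forall i M v, Z M (cr i v) = cr i (Z M v).
Variables (M0 : int) (v0 v1 : V).
Hypothesis Zv0 : forall M, Z M v0 = if M == M0 then v1 else 0.
Hypothesis Xv1 : forall k, (0 < k)%N -> X (- k%:Z) v1 = 0.

Definition state (v : V) (s : seq I) : V := foldr cr v s.

Lemma Z_state M s : Z M (state v0 s) = if M == M0 then state v1 s else 0.
Proof.
elim: s => [|i s IH] /=; first exact: Zv0.
by rewrite Zcr IH; case: eqP => // _; rewrite (linear_0 (cr_linear i)).
Qed.

Lemma destroy_cr e i v : destroy e (cr i v) = cr i (destroy e v)
  + (if (dg i <= e)%N then xi i *: destroy (e - dg i) v else 0).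
Proof.
apply: (@exp_coef_derivation _ _ char0 (fun k => X (- k%:Z))).
- by move=> k; exact: X_linear.
- exact: cr_linear.
- exact: dg_gt0.
by move=> k v' k0; exact: Xncr.
Qed.

Lemma create_cr z i v : create z (cr i v) = cr i (create z v).
Proof.
case: z => m /=; last by rewrite (linear_0 (cr_linear i)).
rewrite (@exp_coef_derivation _ _ char0 (fun k => X k%:Z) _ (cr i) 1 0) //.
  by rewrite scale0r if_same addr0.
by move=> k v' k0; rewrite Xpcr // scale0r if_same addr0.
Qed.

Definition total (s : seq I) : nat := \sum_(i <- s) dg i.

Lemma destroy_state e s : (total s < e)%N -> destroy e (state v1 s) = 0.
Proof.
elim: s e => [|i s IH] e; rewrite /total ?big_cons => se.
  rewrite /destroy exp_coef_vac //= ?big_nil in se *; first by case: eqP => //; lia.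
rewrite /= destroy_cr IH; last by rewrite /total; lia.
rewrite (linear_0 (cr_linear i)) add0r; case: leqP => // ie.
by rewrite IH ?scaler0 // /total; lia.
Qed.

Lemma normal_state N E s : (total s < E)%N -> normal_coef X Z N (state v0 s)
  = \sum_(0 <= e < E) create (N - M0 + e%:Z) (destroy e (state v1 s)).
Proof.
move=> sE; rewrite (@normal_coefE N M0 E) => [|M /negPf MM|e eE].
- by rewrite Z_state eqxx.
- by rewrite Z_state MM.
by rewrite Z_state eqxx destroy_state //; exact: leq_trans eE.
Qed.

Lemma summable_state N s : summable N (state v0 s).
Proof.
exists [seq (`|(N - M0 + e%:Z)%R|%N, e) | e <- iota 0 (total s).+1 & 0 <= N - M0 + e%:Z].
  by rewrite map_inj_uniq ?filter_uniq ?iota_uniq // => e e' [].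
move=> rp; apply: nterm_graded => [M /negPf MM|e eE]; first by rewrite Z_state MM.
by rewrite Z_state eqxx destroy_state.
Qed.

Lemma normal_nil N : normal_coef X Z N v0 = create (N - M0) v1.
Proof.
rewrite -[v0]/(state v0 [::]) (@normal_state N 1) ?/total ?big_nil // big_nat1 addr0.
by rewrite /destroy exp_coef0.
Qed.

Lemma normal_cons N i s : normal_coef X Z N (state v0 (i :: s))
  = cr i (normal_coef X Z N (state v0 s))
    + xi i *: normal_coef X Z (N + (dg i)%:Z) (state v0 s).
Proof.
set E := (total s).+1.
rewrite (@normal_state N (E + dg i)); last by rewrite /total big_cons /E /total; lia.
rewrite (@normal_state N (E + dg i) s); last by rewrite /E; lia.
rewrite (@normal_state _ E s) // (linear_bigsum (cr_linear i)).
transitivity (\sum_(0 <= e < E + dg i)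
  (cr i (create (N - M0 + e%:Z) (destroy e (state v1 s))) +
   (if (dg i <= e)%N then xi i *: create (N - M0 + e%:Z) (destroy (e - dg i) (state v1 s)) else
     0))).
  apply: eq_bigr => e _; rewrite destroy_cr (linear_additive (create_linear _)) create_cr.
  congr (_ + _); case: (dg i <= e)%N; last by rewrite (linear_0 (create_linear _)).
  by rewrite (linear_homo (create_linear _)).
rewrite big_split; congr (_ + _) => /=.
rewrite (big_cat_nat (n := dg i)) //=; last by lia.
rewrite big_nat big1 ?add0r => [|e /andP[_ ei]]; last by case: leqP => //; lia.
rewrite -{1}[dg i]add0n big_addn addnK scaler_sumr; apply: eq_bigr => e _.
rewrite leq_addl addnK; congr (_ *: create _ _); lia.
Qed.

Variables (F : lmodType A) (Phi : V -> F) (Y : int -> F -> F) (crF : I -> F -> F).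
Hypotheses (Phi_linear : linear Phi) (Y_linear : forall N, linear (Y N)).
Hypothesis PhiE : forall i v, Phi (cr i v) = crF i (Phi v).
Hypothesis crF_linear : forall i, linear (crF i).
Hypothesis Ycr : forall N i x, Y N (crF i x) = crF i (Y N x) + xi i *: Y (N + (dg i)%:Z) x.

(** Y and the normally ordered exponential obey the same commutation rule with the
    creation operators, so agreement on the vacuum propagates to all states. *)
Lemma intertwine_state ep :
  (forall N, Y N (Phi v0) = ep *: Phi (create (N - M0) v1)) ->
  forall N s, Y N (Phi (state v0 s)) = ep *: Phi (normal_coef X Z N (state v0 s)).
Proof.
move=> base N s; elim: s N => [|i s IH] N; first by rewrite /= base normal_nil.
rewrite normal_cons [state _ _]/= PhiE Ycr !IH (linear_homo (crF_linear i)).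
by rewrite (linear_additive Phi_linear) (linear_homo Phi_linear) PhiE scalerDr !scalerA mulrC.
Qed.

Variables (an : I -> V -> V) (anF : I -> F -> F) (eta : I -> A).
Hypothesis an_linear : forall i, linear (an i).
Hypothesis anF_linear : forall i, linear (anF i).
Hypothesis Phian : forall i v, Phi (an i v) = anF i (Phi v).
Hypothesis anX : forall i (k : nat) v, (0 < k)%N ->
  an i (X k v) = X k (an i v) + (if k == dg i then eta i *: v else 0).
Hypothesis anv1 : forall i, an i v1 = 0.
Hypothesis anY : forall i N, anF i (Y N (Phi v0)) = eta i *: Y (N - (dg i)%:Z) (Phi v0).
Variable nt : F -> Prop.
Hypothesis nt0 : nt 0.
Hypothesis ntD : forall x y, nt x -> nt y -> nt (x + y).
Hypothesis ntZ : forall a x, nt x -> nt (a *: x).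
Hypothesis nt_singular : forall x, (forall i, anF i x = 0) -> nt x -> x = 0.
Hypothesis ntX : forall (k : nat) v, (0 < k)%N -> nt (Phi (X k v)).
Variable ep : A.
Hypothesis Ylow : forall N, N < M0 -> Y N (Phi v0) = 0.
Hypothesis Ylead : Y M0 (Phi v0) = ep *: Phi v1.
Hypothesis Yhigh : forall N, M0 < N -> nt (Y N (Phi v0)).

Lemma an_create i (m : nat) : an i (create m v1)
  = if (dg i <= m)%N then eta i *: create (m%:Z - (dg i)%:Z) v1 else 0.
Proof.
have Xan (k : nat) v : (0 < k)%N ->
    X k (an i v) = an i (X k v) + (if k == dg i then - eta i *: v else 0).
  move=> k0; rewrite anX // -addrA; case: eqP => _; last by rewrite !addr0.
  by rewrite scaleNr subrr addr0.
have := exp_coef_derivation char0 (fun k : nat => X_linear k) (an_linear i) (dg_gt0 i) Xan m v1.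
rewrite anv1 (linear_0 (exp_coef_linear (fun k : nat => X_linear k) m)).
move=> /esym/eqP; rewrite addr_eq0 => /eqP /= ->.
by case: leqP => [im|]; rewrite ?oppr0 // scaleNr opprK subzn.
Qed.

(** By induction on N - M0: the annihilation operators map the difference of the two
    sides to differences of lower degree, so it is singular; both sides lie in [nt], which
    contains no nonzero singular vector. *)
Lemma intertwine_vac N : Y N (Phi v0) = ep *: Phi (create (N - M0) v1).
Proof.
have [NM|NM|->] := ltgtP N M0; first 1 last.
- have [m ->] : exists m : nat, N = M0 + m%:Z by exists `|(N - M0)%R|%N; lia.
  have -> : M0 + m%:Z - M0 = m%:Z by ring.
  elim/ltn_ind: m => m IH.
  have [->|m0] := posnP m; first by rewrite addr0 /= exp_coef0.
  apply/eqP; rewrite -subr_eq0; apply/eqP/nt_singular => [i|]; last first.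
    rewrite -scaleNr; apply: ntD; first by apply: Yhigh; lia.
    apply: ntZ; rewrite /= /exp_coef (linear_bigsum Phi_linear).
    apply: big_ind => // j _; rewrite (linear_homo Phi_linear); apply: ntZ.
    case: j => [|j] /=; first by rewrite gtn_eqF // (linear_0 Phi_linear).
    rewrite (linear_bigsum Phi_linear) big_nat; apply: big_ind => // k /andP[k0 _].
    exact: ntX.
  rewrite (linear_sub (anF_linear i)) anY (linear_homo (anF_linear i)) -Phian an_create.
  case: leqP => im; last by rewrite Ylow ?(linear_0 Phi_linear) ?scaler0 ?subr0 //; lia.
  rewrite -[M0 + m%:Z - _]addrA (linear_homo Phi_linear) subzn // IH; last by have := dg_gt0 i; lia.
  by rewrite !scalerA mulrC subrr.
- by rewrite subrr Ylead /= exp_coef0.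
rewrite Ylow //; have : N - M0 < 0 by lia.
case: (N - M0) => m //= _.
by rewrite (linear_0 Phi_linear) scaler0.
Qed.

End NormalCoef.

(** * Fock spaces mapped to fermions *)

Lemma perm_mset1D (T : choiceType) (x : T * nat) (S : occupation T) :
  perm_eq (enum_mset (x +` S)%mset) (x :: enum_mset S).
Proof.
apply/allP => y _ /=; rewrite count_mem_mset mset1DE count_mem_mset.
by rewrite [y == _]eq_sym eqxx.
Qed.

Section FockMap.
Variables (R : realType) (T : choiceType) (F : lmodType R[i]).
Variables (a : T -> int -> F -> F) (vac : F).
Hypothesis a_linear : forall b i, linear (a b i).
Hypothesis a_bracket : forall b i c j x, i != 0 -> j != 0 ->
  a b i (a c j x) - a c j (a b i x) = (if (b == c) && (i + j == 0) then i%:~R else 0) *: x.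
Hypothesis a_vac : forall b (k : nat), a b k.+1 vac = 0.

(** The state obtained from vac by the creation operators listed in s; it depends only on
    the multiset of entries, which makes [fock_map] well defined. *)
Definition monomial (s : seq (T * nat)) : F :=
  foldr (fun bk v => a bk.1 (Negz bk.2) v) vac s.

Lemma creationC b k c m x : a b (Negz k) (a c (Negz m) x) = a c (Negz m) (a b (Negz k) x).
Proof.
apply/eqP; rewrite -subr_eq0 a_bracket //.
have -> : (b == c) && (Negz k + Negz m == 0) = false by rewrite andbC; lia.
by rewrite scale0r.
Qed.

Lemma monomial_rem bk s : bk \in s ->
  monomial s = a bk.1 (Negz bk.2) (monomial (rem bk s)).
Proof.
elim: s => // ck s IH; rewrite inE /=.
case: eqVneq => [->//|_] /= /IH ->.
exact: creationC.
Qed.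

Lemma perm_monomial s s' : perm_eq s s' -> monomial s = monomial s'.
Proof.
elim: s s' => [|bk s IH] s' ss'; first by move: ss'; rewrite perm_sym => /perm_nilP ->.
have bks' : bk \in s' by rewrite -(perm_mem ss') mem_head.
rewrite (monomial_rem bks') /=; congr (a _ _ _); apply: IH.
by have := perm_to_rem bks'; move/(perm_trans ss'); rewrite perm_cons.
Qed.

Lemma annihilate b k s : a b k.+1 (monomial s)
  = (k.+1 * count_mem (b, k) s)%:R *: monomial (rem (b, k) s).
Proof.
elim: s => [|[c m] s IH] /=; first by rewrite muln0 scale0r a_vac.
have := a_bracket b c (monomial s) (i := k.+1) (j := Negz m) isT isT.
move/eqP; rewrite subr_eq => /eqP ->; rewrite IH (linear_homo (a_linear _ _)).
have -> : (b == c) && (k.+1%:Z + Negz m == 0) = ((c, m) == (b, k)).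
  by rewrite xpair_eqE eq_sym; case: (c == b) => //=; lia.
case: eqVneq => [[-> ->]|cm].
  rewrite /= add1n mulnS natrD scalerDl; congr (_ + _).
  case: (boolP ((b, k) \in s)) => bks; first by rewrite [in RHS](monomial_rem bks).
  by rewrite (count_memPn bks) muln0 !scale0r.
by rewrite scale0r add0r add0n.
Qed.

Definition fock_map : fock R T -> F := malg_lift (fun S => monomial (enum_mset S)).

Lemma fock_map_linear : linear fock_map. Proof. exact: linearP. Qed.

Lemma fock_mapU S : fock_map << S >> = monomial (enum_mset S).
Proof. exact: malg_liftU. Qed.

Lemma monomial_osc b i S : i != 0 ->
  (osc R b i S).1 *: monomial (enum_mset (osc R b i S).2) = a b i (monomial (enum_mset S)).
Proof.
case: i => [[//|k]|k] _ /=; last first.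
  rewrite scale1r -[RHS]/(monomial ((b, k) :: enum_mset S)).
  exact/perm_monomial/perm_mset1D.
rewrite annihilate count_mem_mset.
have [S0|S0] := posnP (S (b, k)); first by rewrite S0 muln0 !scale0r.
congr (_ *: _); apply: perm_monomial; apply/allP => x _ /=.
rewrite count_mem_mset msetB1E count_rem count_mem_mset.
by rewrite -has_pred1 has_count count_mem_mset S0 /= [x == _]eq_sym.
Qed.

Lemma fock_map_heis b i v : i != 0 -> fock_map (heis b i v) = a b i (fock_map v).
Proof.
move=> i0; move: v; apply: malg_ext.
- by apply: linear_compf; exact: linearP.
- by apply: linear_compf; [exact: a_linear | exact: fock_map_linear].
move=> S; rewrite /heis malg_liftU fock_mapU -monomial_osc //.
by case: (osc R b i S) => c S' /=; rewrite (linear_homo fock_map_linear) fock_mapU.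
Qed.

End FockMap.

Section ChargeZero.
Variables (A : fieldType).
Local Notation F := (fermions A).

Definition neutral (x : F) := forall D, coef D x != 0 -> charge D = 0.

Lemma neutral_0 : neutral 0. Proof. by move=> D; rewrite coef0 eqxx. Qed.
Lemma neutralD x y : neutral x -> neutral y -> neutral (x + y).
Proof.
move=> cx cy D; rewrite coefD; have [x0|x0 _] := eqVneq (coef D x) 0; last exact: cx.
by rewrite x0 add0r; exact: cy.
Qed.
Lemma neutralZ a x : neutral x -> neutral (a *: x).
Proof. by move=> cx D; rewrite coefZ mulf_eq0 negb_or => /andP[_ /cx]. Qed.
Lemma neutral_ket D : charge D = 0 -> neutral (ket A D).
Proof. by move=> D0 E; rewrite coef_ket; case: (eqVneq D E) => [<- //|_]; rewrite eqxx. Qed.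

Lemma neutral_ind (P : F -> Prop) :
    P 0 -> (forall x y, P x -> P y -> P (x + y)) -> (forall a x, P x -> P (a *: x)) ->
    (forall D, charge D = 0 -> P (ket A D)) -> forall x, neutral x -> P x.
Proof.
move=> P0 PD PZ Pk x cx; rewrite (ketE x) big_seq.
by apply: big_ind => // D Dx; apply/PZ/Pk/cx; rewrite -mem_ksupp.
Qed.

Lemma neutral_cur lt al l x : tournament lt -> neutral x -> neutral (cur lt al l x).
Proof.
move=> ltP; apply: (neutral_ind (P := fun x => neutral (cur lt al l x))).
- by rewrite linear0; exact: neutral_0.
- by move=> y z cy cz; rewrite linearD; exact: neutralD.
- by move=> c y cy; rewrite linearZ; exact: neutralZ.
move=> D D0; rewrite curU; apply: big_ind => [||j _]; [exact: neutral_0 | exact: neutralD |].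
apply: neutralZ; have [l0|l0] := eqVneq l 0.
  by rewrite l0 addr0 normal_pair_diag //; apply/neutralZ/neutral_ket.
rewrite (@normal_pair_off A lt); last by lia.
case: (boolP (filled D j && _)) => [/andP[Fj Fjl]|_]; last exact: neutral_0.
apply/neutralZ/neutral_ket; rewrite !charge_toggle filled_toggle Fj (negPf Fjl).
have -> : (j + l == j) = false by lia.
by rewrite D0.
Qed.

End ChargeZero.

Lemma mode_upclosed (A : fieldType) lt n c (k : nat) D : (0 < n)%N ->
  (0 < k)%N -> upclosed n D -> @mode A lt n c k%:Z (ket A D) = 0.
Proof.
move=> n0 k0 up; rewrite /mode curU big1 // => j _.
have nk : (0 < n * k)%N by rewrite muln_gt0 n0.
rewrite (@normal_pair_off A lt); last by lia.
case: (boolP (filled D j && _)) => [/andP[Fj Fjk]|_]; last by rewrite scaler0.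
by rewrite (upclosedM k up Fj) in Fjk.
Qed.

(** A map of Fock spaces that commutes with lowering operators is injective as soon as it
    is so on vacua, by induction on the number of quanta: the coefficient of x at a
    nonempty S is a nonzero multiple of a coefficient of a lowered vector, whose image is
    0 as well. *)
Section FockInjective.
Variables (A : fieldType) (V F : lmodType A) (Phi : V -> F).
Variables (T : choiceType) (L : Type) (co : occupation T -> L -> V -> A).
Variables (low : T * nat -> V -> V) (lowF : T * nat -> F -> F).
Hypothesis co_low : forall bk S l x, exists2 c, c != 0 & co S l (low bk x) = c * co (bk +`
  S)%mset l x.
Hypothesis Phi_low : forall bk x, Phi (low bk x) = lowF bk (Phi x).
Hypothesis lowF0 : forall bk, lowF bk 0 = 0.
Hypothesis co_bounded : forall x, exists m, forall (S : occupation T) l,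
  (m <= size (enum_mset S))%N -> co S l x = 0.
Hypothesis singular0 : forall x, Phi x = 0 ->
  (forall S l, S != mset0 -> co S l x = 0) -> x = 0.
Hypothesis co0 : forall S l, co S l 0 = 0.

Lemma fock_injective x : Phi x = 0 -> x = 0.
Proof.
have [m xm] := co_bounded x; elim: m x xm => [|m IH] x xm Px.
  by apply: singular0 => // S l _; exact: xm.
apply: singular0 => // S l S0.
have [S00|[bk bkS]] := mset_0Vmem S; first by rewrite S00 eqxx in S0.
have low0 : low bk x = 0.
  apply: IH => [S' l' mS'|]; last by rewrite Phi_low Px lowF0.
  have [c _ ->] := co_low bk S' l' x; rewrite xm ?mulr0 //.
  by rewrite (perm_size (perm_mset1D bk S')).
have [c c0] := co_low bk (S `\ bk)%mset l x.
rewrite low0 co0 msetB1K // => /esym/eqP.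
by rewrite mulf_eq0 (negPf c0) => /eqP.
Qed.

End FockInjective.

Lemma coef_malg_lift (A : fieldType) (K : choiceType) (f : K -> fermions A) x D :
  coef D (malg_lift f x) = \sum_(k <- msupp x) x@_k * coef D (f k).
Proof. by rewrite /malg_lift coef_sum; apply: eq_bigr => k _; rewrite coefZ. Qed.

Lemma malg_size_bound (A : fieldType) (K : choiceType) (sz : K -> nat) (x : {malg A[K]}) :
  exists m, forall k, (m <= sz k)%N -> x@_k = 0.
Proof.
exists (\max_(k <- msupp x) sz k).+1 => k xk; apply: mcoeff_outdom.
apply: contraTN xk => kx; rewrite -ltnNge ltnS.
by rewrite (big_fsetD1 k kx) /= leq_maxl.
Qed.

Section Complex.
Variable R : realType.
Local Notation C := R[i].

Lemma char0C (m : nat) : m.+1%:R != 0 :> C. Proof. by rewrite pnatr_eq0. Qed.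

Section OneBoson.
Let F := fermions C.
Variables (lt : rel int) (ltP : tournament lt).

(** The current of all fermions together, indexed by unit to match [fock]. *)
Definition mode1 (b : unit) (i : int) : F -> F := mode lt (ord0 : 'I_1) i.

Lemma mode1_linear b i : linear (mode1 b i). Proof. exact: linearP. Qed.

Lemma mode1_bracket (b : unit) i (c : unit) j x : i != 0 -> j != 0 ->
  mode1 b i (mode1 c j x) - mode1 c j (mode1 b i x)
  = (if (b == c) && (i + j == 0) then i%:~R else 0) *: x.
Proof. by move=> _ _; rewrite /mode1 (mode_bracket ltP) // eqxx; case: b c => [] []. Qed.

Lemma upclosed_fset0 n : upclosed n fset0.
Proof. by move=> j; rewrite !filled0; lia. Qed.

Lemma mode1_vac b (k : nat) : mode1 b k.+1 (ket C fset0) = 0.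
Proof. by apply: mode_upclosed => //; exact: upclosed_fset0. Qed.

(** One-component boson-fermion correspondence, for an arbitrary order of the signs: the
    order used by the n-component correspondence can then serve for both modules. *)
Definition Phi1 : fock R unit -> F := fock_map mode1 (ket C fset0).

Lemma Phi1_linear : linear Phi1. Proof. exact: fock_map_linear. Qed.

Lemma Phi1_heis i v : i != 0 -> Phi1 (heis tt i v) = mode lt (ord0 : 'I_1) i (Phi1 v).
Proof. exact: (fock_map_heis mode1_linear mode1_bracket mode1_vac). Qed.

Lemma heis_coeff b k (x : fock R unit) S :
  (heis b k.+1 x)@_S = (k.+1 * (S (b, k)).+1)%:R * x@_((b, k) +` S)%mset.
Proof.
rewrite /heis (@malg_lift_coeff1 _ _ _ _ _ _ ((b, k) +` S)%mset) => [|S' S'S] /=.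
  rewrite mcoeffZ msetD1K mcoeffUU mulr1 mulrC mset1DE eqxx add1n; by [].
rewrite mcoeffZ mcoeffU.
have [S0|S0] := posnP (S' (b, k)); first by rewrite S0 muln0 mul0r.
case: eqP => [e|_]; last by rewrite mulr0.
by rewrite -e msetB1K ?in_mset ?S0 ?eqxx in S'S.
Qed.

Lemma Phi1_inj : injective Phi1.
Proof.
move=> x y xy; apply/eqP; rewrite -subr_eq0; apply/eqP.
have : Phi1 (x - y) = 0 by rewrite (linear_sub Phi1_linear) xy subrr.
apply: (@fock_injective C _ F Phi1 unit unit (fun S _ x => x@_S)
  (fun bk => heis bk.1 bk.2.+1) (fun bk => mode1 bk.1 bk.2.+1)).
- move=> [b k] S _ z; exists (k.+1 * (S (b, k)).+1)%:R; last exact: heis_coeff.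
  by rewrite mulnS addSn; exact: char0C.
- by move=> [[] k] z; rewrite Phi1_heis.
- by move=> bk; exact: linear_0 (mode1_linear _ _).
- by move=> z; have [m zm] := malg_size_bound (fun S : occupation unit => size (enum_mset S)) z;
  exists m => S _; exact: zm.
- move=> z Pz z0; apply/malgP => S; rewrite mcoeff0.
  have [->|S0] := eqVneq S mset0; last exact: (z0 S tt).
  have := congr1 (coef fset0) Pz; rewrite coef0 /Phi1 /fock_map coef_malg_lift.
  case: (boolP (mset0 \in msupp z)) => [m0|m0] ; last by rewrite mcoeff_outdom.
  rewrite (big_fsetD1 _ m0) /= big1_seq => [|S' /andP[_]].
    by rewrite enum_mset0 /= coef_ket eqxx mulr1 addr0.
  by rewrite !inE => /andP[S'0 _]; rewrite (z0 S' tt S'0) mul0r.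
by move=> S l; rewrite mcoeff0.
Qed.

Lemma Phi1_charge v : neutral (Phi1 v).
Proof.
rewrite /Phi1 /fock_map /malg_lift; apply: big_ind => [||S _]; [exact: neutral_0 | exact:
  neutralD |].
apply: neutralZ; elim: (enum_mset S) => [|bk s IH] /=; last exact: neutral_cur.
by apply: neutral_ket; rewrite /charge big_seq_fset0.
Qed.

Lemma Phi1_onto y : neutral y -> exists v, Phi1 v = y.
Proof.
apply: (neutral_ind (P := fun y => exists v, Phi1 v = y)).
- by exists 0; exact: linear_0 Phi1_linear.
- by move=> _ _ [v <-] [w <-]; exists (v + w); exact: linear_additive Phi1_linear v w.
- by move=> a _ [v <-]; exists (a *: v); exact: linear_homo Phi1_linear a v.
apply: (creation_generated ltP char0C (isT : (0 < 1)%N) (P := fun y => exists v, Phi1 v = y)).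
- by exists 0; exact: linear_0 Phi1_linear.
- by move=> _ _ [v <-] [w <-]; exists (v + w); exact: linear_additive Phi1_linear v w.
- by move=> a _ [v <-]; exists (a *: v); exact: linear_homo Phi1_linear a v.
- move=> c k _ k0 [v <-]; exists (heis tt (- k%:Z) v).
  by rewrite Phi1_heis ?(ord1 c) //; lia.
move=> D /(upclosedE (isT : (0 < 1)%N))[l ->].
rewrite charge_vacset // big_ord1 => /eqP; rewrite oppr_eq0 => /eqP l0.
have -> : l = [ffun=> 0] by apply/ffunP => b; rewrite ffunE (ord1 b).
exists << mset0 >>; rewrite /Phi1 fock_mapU enum_mset0 /= vacset0 //.
Qed.

End OneBoson.
End Complex.

(** * Bosonization of vertex operators *)

(** V is a bosonic space embedded by Phi in the fermions.  The hypotheses on X and Z say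
    that [normal_coef X Z] is the vertex operator :exp (phi_b - phi_a):, with the dilations
    of its two fields in ws and wt, and those on Y that the coefficients Y_N of a fermionic
    field have the matching commutators with the Heisenberg modes. *)
Section Bosonization.
Variables (A : fieldType).
Hypothesis char0 : forall m : nat, m.+1%:R != 0 :> A.
Variables (n : nat) (n_gt0 : (0 < n)%N) (lt : rel int).
Hypothesis ltP : tournament lt.
Local Notation F := (fermions A).
Local Notation mode := (@mode A lt n).
Variables (V : lmodType A) (B : 'I_n -> int -> V -> V) (Phi : V -> F).
Hypotheses (B_linear : forall c i, linear (B c i)) (Phi_linear : linear Phi).
Hypothesis Phi_inj : injective Phi.
Hypothesis PhiB : forall c i v, i != 0 -> Phi (B c i v) = mode c i (Phi v).

Lemma boson_bracket c i c' j v : i != 0 -> j != 0 ->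
  B c i (B c' j v) = B c' j (B c i v)
    + (if (c == c') && (i + j == 0) then i%:~R else 0) *: v.
Proof.
move=> i0 j0; apply: Phi_inj; rewrite (linear_additive Phi_linear) (linear_homo Phi_linear).
by rewrite !PhiB // -(mode_bracket ltP) // addrC subrK.
Qed.

Variables (a b : 'I_n) (wt ws : int -> A) (X : int -> V -> V).
Hypothesis X_linear : forall k, linear (X k).
Hypothesis XE : forall k v, k != 0 -> X k v =
  ((- k)%:~R^-1 * ws k) *: B b (- k) v - ((- k)%:~R^-1 * wt k) *: B a (- k) v.

Let intr_neq0 (k : int) : k != 0 -> k%:~R != 0 :> A.
Proof.
case: k => [[//|m]|m] _; first exact: char0.
by rewrite NegzE rmorphN oppr_eq0; exact: char0.
Qed.

Lemma boson_vertex c j k v : j != 0 -> k != 0 -> B c j (X k v) = X k (B c j v)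
  + (if j == k then (c == a)%:R * wt k - (c == b)%:R * ws k else 0) *: v.
Proof.
move=> j0 k0; rewrite !XE // (linear_sub (B_linear _ _)) !(linear_homo (B_linear _ _)).
have nk0 : - k != 0 by rewrite oppr_eq0.
rewrite (boson_bracket c b v j0 nk0) (boson_bracket c a v j0 nk0) !scalerDr opprD addrACA
  !scalerA -scalerBl subr_eq0.
congr (_ + _ *: _); case: (eqVneq j k) => [->|_]; last by rewrite !andbF !mulr0 subr0.
rewrite !andbT rmorphN invrN !mulNr opprK.
have kk : k%:~R^-1 * k%:~R = 1 :> A by rewrite mulVf ?intr_neq0.
have h (w : A) (e : bool) : k%:~R^-1 * w * (if e then k%:~R else 0) = e%:R * w.
  by case: e; rewrite ?mulr0 ?mul0r // mulrAC kk.
by rewrite !h addrC.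
Qed.

Variables (Z : int -> V -> V) (M0 : int) (v0 v1 : V).
Hypothesis ZB : forall c (m : nat) M v, Z M (B c (Negz m) v) = B c (Negz m) (Z M v).
Hypothesis Zv0 : forall M, Z M v0 = if M == M0 then v1 else 0.
Hypothesis v0_vac : forall c (k : nat), B c k.+1 v0 = 0.
Hypothesis v1_vac : forall c (k : nat), B c k.+1 v1 = 0.

Definition raise (cm : 'I_n * nat) : V -> V := B cm.1 (Negz cm.2).

Let w c k := (c == a)%:R * wt k - (c == b)%:R * ws k.
Let dg (cm : 'I_n * nat) := cm.2.+1.
Let dg0 i : (0 < dg i)%N. Proof. by []. Qed.

Lemma raise_linear i : linear (raise i). Proof. exact: B_linear. Qed.

Let Xn i (k : nat) v : (0 < k)%N -> X (- k%:Z) (raise i v) =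
  raise i (X (- k%:Z) v) + (if k == dg i then - w i.1 (Negz i.2) *: v else 0).
Proof.
move=> k0; rewrite /raise boson_vertex //; last by lia.
have -> : (Negz i.2 == - k%:Z) = (k == dg i) by rewrite /dg; lia.
case: eqP => [->|_]; last by rewrite scale0r !addr0.
by rewrite -addrA -scalerDl -NegzE /w addrN scale0r addr0.
Qed.

Let Xp i (k : nat) v : (0 < k)%N -> X k (raise i v) = raise i (X k v).
Proof.
move=> k0; rewrite /raise boson_vertex //; last by lia.
have -> : (Negz i.2 == k%:Z) = false by lia.
by rewrite scale0r addr0.
Qed.

Let Xv1 (k : nat) : (0 < k)%N -> X (- k%:Z) v1 = 0.
Proof.
case: k => // k _; rewrite XE ?opprK; last by lia.
by rewrite !v1_vac !scaler0 subr0.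
Qed.

Lemma vertex_summable N s : summable X Z N (state raise v0 s).
Proof.
apply: (summable_state char0 X_linear raise_linear dg0 Xn _ Zv0 Xv1) => i M v.
exact: ZB.
Qed.

Variable Y : int -> F -> F.
Hypothesis Y_linear : forall N, linear (Y N).
Hypothesis Y_bracket : forall c k N x, k != 0 -> mode c k (Y N x) - Y N (mode c k x)
  = ((c == a)%:R * wt k - (c == b)%:R * ws k) *: Y (N - k) x.
Variable ep : A.
Hypothesis Ylow : forall N, N < M0 -> Y N (Phi v0) = 0.
Hypothesis Ylead : Y M0 (Phi v0) = ep *: Phi v1.
Hypothesis Yhigh : forall N D, M0 < N -> upclosed n D -> coef D (Y N (Phi v0)) = 0.

(** The annihilation operators detect singular vectors, which are combinations of diagrams
    with all components vacua; the coefficients on such diagrams vanish for Y_N, N > M0,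
    and for everything in the image of a creation operator. *)
Lemma bosonization N (s : seq ('I_n * nat)) :
  Y N (Phi (state raise v0 s)) = ep *: Phi (normal_coef X Z N (state raise v0 s)).
Proof.
pose an (cm : 'I_n * nat) := B cm.1 cm.2.+1.
have PhiR i v : Phi (raise i v) = mode i.1 (Negz i.2) (Phi v) by rewrite PhiB.
have YR N' i x : Y N' (mode i.1 (Negz i.2) x) =
   mode i.1 (Negz i.2) (Y N' x) + - w i.1 (Negz i.2) *: Y (N' + (dg i)%:Z) x.
  have := Y_bracket i.1 N' x (isT : Negz i.2 != 0); rewrite NegzE opprK => /eqP.
  by rewrite subr_eq => /eqP ->; rewrite addrAC -scalerDl -/(w _ _) addrN scale0r add0r.
apply: (intertwine_state (xi := fun i => - w i.1 (Negz i.2))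
  (crF := fun i => mode i.1 (Negz i.2))
  char0 X_linear raise_linear dg0 Xn Xp _ Zv0 Xv1 Phi_linear PhiR _ YR).
- by move=> i M v; exact: ZB.
- by move=> i; exact: linearP.
(* [nt] of [intertwine_vac]: no component along the charged vacua. *)
move=> N'; pose nt (x : F) := forall D, upclosed n D -> coef D x = 0.
refine (@intertwine_vac _ _ char0 X X_linear _ dg dg0 M0 v0 v1 F Phi Y Phi_linear an
  (fun i => mode i.1 i.2.+1) (fun i => w i.1 (dg i)) _ _ _ _ _ _ nt _ _ _ _ _ ep _ _ _ N') => //.
- by move=> i; exact: B_linear.
- by move=> i; exact: linearP.
- by move=> i v; rewrite /an PhiB.
- move=> i k v k0; rewrite /an boson_vertex //; last by lia.
  have -> : (i.2.+1%:Z == k%:Z) = (k == dg i) by rewrite /dg; lia.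
  by case: eqP => [->|_]; rewrite ?scale0r.
- by move=> i; exact: v1_vac.
- move=> i N1; have := Y_bracket i.1 N1 (Phi v0) (isT : i.2.+1%:Z != 0).
  rewrite -PhiB // v0_vac (linear_0 Phi_linear) (linear_0 (Y_linear _)) subr0.
  exact.
- by move=> D _; rewrite coef0.
- by move=> x y nx ny D up; rewrite coefD nx // ny // addr0.
- by move=> c x nx D up; rewrite coefZ nx // mulr0.
- move=> x sx nx; apply: coefP => D; rewrite coef0; apply/eqP/negPn/negP => xD.
  have up : upclosed n D.
    apply: (singular_upclosed ltP char0 n_gt0 _ xD) => c [//|k] _.
    exact: (sx (c, k)).
  by rewrite nx ?eqxx in xD.
- move=> k v k0 D up; rewrite XE; last by lia.
  rewrite (linear_sub Phi_linear) !(linear_homo Phi_linear) !PhiB; try by lia.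
  by rewrite coefB !coefZ !(@creation_upclosed A lt n n_gt0) // !mulr0 subr0.
by move=> N1 lN D up; exact: Yhigh.
Qed.

End Bosonization.

(** With one component the two fields coincide, and :exp (phi(q^s z) - phi(q^t z)):
    corresponds to the field with coefficients E_{kap,-N} of the representation (1, 0, y),
    up to the constant by which E_{kap,0} multiplies the vacuum. *)
Section OneBosonVertex.
Variables (A : fieldType) (q : A) (qpow : rat -> A).
Hypothesis char0 : forall m : nat, m.+1%:R != 0 :> A.
Hypotheses (q_neq0 : q != 0) (q_not_root : forall k : nat, (0 < k)%N -> q ^+ k != 1).
Hypothesis (qpowP : fractional_powers q qpow).
Variables (lt : rel int) (ltP : tournament lt).

Lemma sum_modes n n' y k (x : fermions A) : (0 < n)%N -> k != 0 ->
  \sum_(c < n) mode lt c k x = diff_op qpow lt n n' y 0 k x.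
Proof.
move=> n0 k0; rewrite /diff_op /diff_central /deg mulr0 add0r.
have -> : (n%:Z * k == 0) = false by nia.
rewrite scale0r addr0 /mode -cur_sum; apply: cur_ext => j.
rewrite /diff_coeff expr0z mul1r !mul0r (qpow0 q_neq0 qpowP).
have [i [c ->]] := decomp n0 j.
rewrite (bigD1 c) //= inclassE eqxx big1 ?addr0 // => c' /negPf cc.
by rewrite inclassE eq_sym cc.
Qed.

Variables (y : A) (y_neq0 : y != 0) (kap : int) (kap_neq0 : kap != 0).
Local Notation E k l := (diff_op qpow lt 1 0 y k l).
Variables (s t : rat) (sE : s = kap%:Q / 2) (tE : t = - s).
Variables (V : lmodType A) (B : 'I_1 -> int -> V -> V) (Phi : V -> fermions A).
Hypotheses (B_linear : forall c i, linear (B c i)) (Phi_linear : linear Phi).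
Hypothesis Phi_inj : injective Phi.
Hypothesis PhiB : forall c i v, i != 0 -> Phi (B c i v) = mode lt c i (Phi v).
Variables (X Z : int -> V -> V) (v0 : V).
Hypothesis X_linear : forall k, linear (X k).
Hypothesis XE : forall k v, k != 0 -> X k v =
  ((- k)%:~R^-1 * qpow (k%:Q * s)) *: B ord0 (- k) v
  - ((- k)%:~R^-1 * qpow (k%:Q * t)) *: B ord0 (- k) v.
Hypothesis ZB : forall c (m : nat) M v, Z M (B c (Negz m) v) = B c (Negz m) (Z M v).
Hypothesis Zv0 : forall M, Z M v0 = if M == 0 then v0 else 0.
Hypothesis v0_vac : forall c (k : nat), B c k.+1 v0 = 0.
Hypothesis Phi_v0 : Phi v0 = ket A fset0.

Lemma one_boson_vertex N st :
  E kap (- N) (Phi (state (raise B) v0 st))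
  = diff_const qpow 1 y kap *: Phi (normal_coef X Z N (state (raise B) v0 st)).
Proof.
have degE k l : deg 1 0 k l = l by rewrite /deg mul0r add0r mul1r.
apply: (bosonization char0 (isT : (0 < 1)%N) ltP B_linear Phi_linear Phi_inj PhiB
  X_linear XE ZB Zv0 v0_vac v0_vac (Y := fun N => E kap (- N))).
- by move=> N'; exact: diff_op_linear.
- move=> c k N' x k0.
  have modeE z : mode lt c k z = E 0 k z by rewrite -sum_modes // big_ord1 (ord1 c).
  rewrite !modeE (diff_op_bracket q_neq0 q_not_root qpowP ltP _ 0 y_neq0) // add0r.
  have -> : (0 == - kap) = false by lia.
  rewrite scale0r addr0 (ord1 c) eqxx !mul1r opprB; congr ((qpow _ - qpow _) *: E _ _ _).
  + by rewrite tE sE mulr0 add0r rmorphN rmorphM /=; ring.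
  + by rewrite sE mulr0 subr0 rmorphM /=; ring.
- move=> N' N0; rewrite Phi_v0 /diff_op /diff_central degE cur_vac //; last by lia.
  by case: eqP => [|_]; [lia | rewrite scale0r addr0].
- by rewrite Phi_v0 oppr0 /diff_op /diff_central degE eqxx cur_vac // add0r.
move=> N' D N0 up; rewrite Phi_v0 /diff_op /diff_central degE.
case: eqP => [|_]; first by lia.
rewrite scale0r addr0; have -> : - N' = 1%N%:Z * - `|N'|%N%:Z by lia.
by apply: (@lowering_upclosed A lt 1 isT) => //; lia.
Qed.

Lemma one_boson_summable N st : summable X Z N (state (raise B) v0 st).
Proof.
exact: (vertex_summable char0 (isT : (0 < 1)%N) ltP B_linear Phi_linear Phi_inj PhiB X_linear XE
  ZB Zv0 v0_vac).
Qed.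

End OneBosonVertex.

(** * The n-component boson-fermion correspondence *)

Section NBoson.
Variables (R : realType) (n : nat) (n_gt0 : (0 < n)%N).
Local Notation C := R[i].
Local Notation V := (boson_space R n).
Let F := fermions C.
Let lt := mode_order n.
Let ltP : tournament lt := mode_orderP n_gt0.

Definition charged_vac (l : root_lattice n) : F := ket C (vacset (val l)).

Definition PhiN : V -> F := malg_lift (fun Sl =>
  monomial (@mode C lt n) (charged_vac Sl.2) (enum_mset Sl.1)).

Lemma PhiN_linear : linear PhiN. Proof. exact: linearP. Qed.

Lemma PhiN_U Sl : PhiN << Sl >> = monomial (@mode C lt n) (charged_vac Sl.2) (enum_mset Sl.1).
Proof. exact: malg_liftU. Qed.

Let modeP b i c j (x : F) : i != 0 -> j != 0 ->
  mode lt b i (mode lt c j x) - mode lt c j (mode lt b i x)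
  = (if ((b : 'I_n) == c) && (i + j == 0) then i%:~R else 0) *: x.
Proof. by move=> _ _; exact: mode_bracket. Qed.

Lemma charged_vac_singular l (c : 'I_n) (k : nat) : mode lt c k.+1 (charged_vac l) = 0.
Proof. by apply: mode_upclosed => //; exact: upclosed_vacset. Qed.

Lemma boson_linear b i : linear (@boson R n b i). Proof. exact: linearP. Qed.

Lemma boson_U b i S l : i != 0 ->
  @boson R n b i << (S, l) >> = (osc R b i S).1 *: << ((osc R b i S).2, l) >>.
Proof. by move=> /negPf i0; rewrite /boson malg_liftU /= i0; case: (osc R b i S). Qed.

Lemma raise_U b m S l :
  @boson R n b (Negz m) << (S, l) >> = << (((b, m) +` S)%mset, l) >>.
Proof.
have /= := boson_U b S l (isT : Negz m != 0).
by rewrite scale1r.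
Qed.

Lemma PhiN_boson b i v : i != 0 -> PhiN (boson b i v) = mode lt b i (PhiN v).
Proof.
move=> i0; move: v; apply: malg_ext.
- by apply: linear_compf; [exact: PhiN_linear | exact: boson_linear].
- by apply: linear_compf; [exact: mode_linear | exact: PhiN_linear].
case=> S l; rewrite (boson_U b S l i0) (linear_homo PhiN_linear).
rewrite [in LHS]PhiN_U [in RHS]PhiN_U.
by apply: monomial_osc; [exact: mode_linear | exact: modeP | exact: charged_vac_singular |].
Qed.

Lemma boson_coeff b k (x : V) S l : (boson b k.+1 x)@_(S, l)
  = (k.+1 * (S (b, k)).+1)%:R * x@_(((b, k) +` S)%mset, l).
Proof.
rewrite /boson (@malg_lift_coeff1 _ _ _ _ _ _ ((b, k) +` S, l)%mset) => [|[S' l'] S'S] /=.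
  rewrite mcoeffZ msetD1K mcoeffUU mulr1 mulrC mset1DE eqxx add1n; by [].
rewrite mcoeffZ mcoeffU.
have [S0|S0] := posnP (S' (b, k)); first by rewrite S0 muln0 mul0r.
case: eqP => [[e1 e2]|_]; last by rewrite mulr0.
by rewrite -e1 e2 msetB1K ?in_mset ?S0 ?eqxx in S'S.
Qed.

Lemma PhiN_inj : injective PhiN.
Proof.
move=> x y xy; apply/eqP; rewrite -subr_eq0; apply/eqP.
have : PhiN (x - y) = 0 by rewrite (linear_sub PhiN_linear) xy subrr.
apply: (@fock_injective C V F PhiN 'I_n (root_lattice n) (fun S l x => x@_(S, l))
  (fun bk => boson bk.1 bk.2.+1) (fun bk => mode lt bk.1 bk.2.+1)).
- move=> [b k] S l z; exists (k.+1 * (S (b, k)).+1)%:R; last exact: boson_coeff.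
  by rewrite mulnS addSn; exact: char0C.
- by move=> [b k] z; rewrite PhiN_boson.
- by move=> bk; exact: linear_0 (mode_linear _ _ _).
- move=> z.
  have [m zm] := malg_size_bound
    (fun Sl : occupation 'I_n * root_lattice n => size (enum_mset Sl.1)) z.
  by exists m => S l; exact: (zm (S, l)).
- move=> z Pz z0; apply/malgP => -[S l]; rewrite mcoeff0.
  have [->|S0] := eqVneq S mset0; last exact: z0.
  have := congr1 (coef (vacset (val l))) Pz; rewrite coef0 /PhiN coef_malg_lift.
  case: (boolP ((mset0, l) \in msupp z)) => [m0|m0] ; last by rewrite mcoeff_outdom.
  rewrite (big_fsetD1 _ m0) /= big1_seq => [|[S' l'] /andP[_]].
    by rewrite enum_mset0 /= coef_ket eqxx mulr1 addr0.
  case/fsetD1P=> S'l' _; have [S'0|S'0] := eqVneq S' mset0; last by rewrite (z0 S' l' S'0) mul0r.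
  rewrite S'0 in S'l' *; rewrite enum_mset0 [monomial _ _ _]/= coef_ket.
  rewrite (inj_eq (vacset_inj n_gt0)) (inj_eq val_inj).
  have [l'l|_] := eqVneq l' l; last by rewrite mulr0.
  by rewrite l'l eqxx in S'l'.
by move=> S l; rewrite mcoeff0.
Qed.

Lemma PhiN_charge v : neutral (PhiN v).
Proof.
rewrite /PhiN /malg_lift; apply: big_ind => [||[S l] _]; [exact: neutral_0 | exact: neutralD |].
apply: neutralZ => /=; elim: (enum_mset S) => [|bk s IH] /=; last exact: neutral_cur.
by apply: neutral_ket; rewrite charge_vacset // (eqP (valP l)) oppr0.
Qed.

Lemma PhiN_onto y : neutral y -> exists v, PhiN v = y.
Proof.
apply: (neutral_ind (P := fun y => exists v, PhiN v = y)).
- by exists 0; exact: linear_0 PhiN_linear.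
- by move=> _ _ [v <-] [w <-]; exists (v + w); exact: linear_additive PhiN_linear v w.
- by move=> a _ [v <-]; exists (a *: v); exact: linear_homo PhiN_linear a v.
apply: (creation_generated ltP (@char0C R) n_gt0 (P := fun y => exists v, PhiN v = y)).
- by exists 0; exact: linear_0 PhiN_linear.
- by move=> _ _ [v <-] [w <-]; exists (v + w); exact: linear_additive PhiN_linear v w.
- by move=> a _ [v <-]; exists (a *: v); exact: linear_homo PhiN_linear a v.
- move=> c k _ k0 [v <-]; exists (boson c (- k%:Z) v).
  by rewrite PhiN_boson //; lia.
move=> D /(upclosedE n_gt0)[l ->].
rewrite charge_vacset // => /eqP; rewrite oppr_eq0 => l0.
pose l' : root_lattice n := exist _ l l0.
by exists << (mset0, l') >>; rewrite PhiN_U enum_mset0.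
Qed.

Lemma raise_state (l : root_lattice n) s :
  state (raise (@boson R n)) << (mset0, l) >> s = << (seq_mset s, l) >>.
Proof.
elim: s => [|[b m] s IH].
  have -> : seq_mset [::] = mset0 :> occupation 'I_n; last by [].
  by apply/msetP => x; rewrite mset_seqE mset0E.
rewrite -[state _ _ _]/(boson b (Negz m) (state (raise (@boson R n)) << (mset0, l) >> s)) IH.
have -> : seq_mset ((b, m) :: s) = ((b, m) +` seq_mset s)%mset.
  by apply/msetP => x; rewrite mset1DE !mset_seqE /= eq_sym.
exact: raise_U.
Qed.

Lemma basis_state S l : << (S, l) >> =
  state (raise (@boson R n)) << (mset0, l) >> (enum_mset S) :> V.
Proof. by rewrite raise_state seq_mset_id. Qed.

Lemma vac_annihilated (l : root_lattice n) b (k : nat) :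
  boson b k.+1 (<< (mset0, l) >> : V) = 0.
Proof.
have /= := boson_U b mset0 l (isT : k.+1%:Z != 0).
by rewrite mset0E muln0 scale0r.
Qed.

Section Vertex.
Variables (q : C) (qpow : rat -> C).
Hypothesis (qpowP : fractional_powers q qpow).
Variables (b a : 'I_n) (s t : rat).

Let X k (w : V) := phi_osc qpow b s k w - phi_osc qpow a t k w.
Let Z := @zero_modes R qpow n b s a t.
Let ws (k : int) := qpow (k%:Q * s).
Let wt (k : int) := qpow (k%:Q * t).

Let X_linear k : linear (X k).
Proof. by apply: linear_subf; apply: linear_scalef; exact: boson_linear. Qed.

Let Z_linear M : linear (Z M). Proof. exact: linearP. Qed.

Let ZU M S (l : root_lattice n) : Z M << (S, l) >> =
  if val l b - val l a == M
  then qpow (s * (val l b)%:Q - t * (val l a)%:Q) *: << (S, shift b a l) >> else 0.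
Proof. by rewrite /Z /zero_modes malg_liftU. Qed.

Let ZB c (m : nat) M v : Z M (boson c (Negz m) v) = boson c (Negz m) (Z M v).
Proof.
move: v; apply: malg_ext; try by apply: linear_compf; exact: linearP.
case=> S l; rewrite raise_U [in LHS]ZU [in RHS]ZU; case: (_ == M).
  by rewrite (linear_homo (boson_linear _ _)) raise_U.
by rewrite (linear_0 (boson_linear _ _)).
Qed.

Let M0 (l : root_lattice n) := val l b - val l a.
Let v1 (l : root_lattice n) : V :=
  qpow (s * (val l b)%:Q - t * (val l a)%:Q) *: << (mset0, shift b a l) >>.

Let Zv0 (l : root_lattice n) M : Z M << (mset0, l) >> = if M == M0 l then v1 l else 0.
Proof. by rewrite ZU eq_sym. Qed.

Let v1_vac l c (k : nat) : boson c k.+1 (v1 l) = 0.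
Proof. by rewrite /v1 (linear_homo (boson_linear _ _)) vac_annihilated scaler0. Qed.

Let XE k v : k != 0 -> X k v =
  ((- k)%:~R^-1 * ws k) *: boson b (- k) v - ((- k)%:~R^-1 * wt k) *: boson a (- k) v.
Proof. by []. Qed.

Lemma vertex_linear N : linear (vertex qpow b s a t N).
Proof.
have summableX v : summable X Z N v.
  rewrite (malg_basisE v); apply: big_ind => [|x y|[S l] _].
  - exact: summable0.
  - exact: summableD.
  apply: summableZ => //; rewrite basis_state.
  exact: (vertex_summable (@char0C R) n_gt0 ltP boson_linear PhiN_linear PhiN_inj PhiN_boson
    X_linear XE ZB (Zv0 l) (v1_vac l)).
by move=> c u v; exact: (proj2 (normal_coef_comb X_linear c Z_linear (summableX u) (summableX v))).
Qed.

Lemma fermion_pair_linear N : linear (fermion_pair qpow b s a t N).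
Proof.
rewrite /fermion_pair; apply: linear_iff.
  exact/linear_scalef/vertex_linear.
apply/linear_scalef/linear_compf; [exact: vertex_linear | exact: linearP].
Qed.

Lemma PhiN_vac l : PhiN << (mset0, l) >> = charged_vac l.
Proof. by rewrite PhiN_U enum_mset0. Qed.

(** The sign by which [fermion_pair] corrects [klein] is the one found in
    [bil_vacset]. *)
Lemma PhiN_fermion_pair N v : a != b ->
  PhiN (fermion_pair qpow b s a t N v) = bilin qpow a b s t N (PhiN v).
Proof.
move=> ab; move: v; apply: malg_ext.
- by apply: linear_compf; [exact: PhiN_linear | exact: fermion_pair_linear].
- by apply: linear_compf; [exact: linearP | exact: PhiN_linear].
case=> S l; rewrite /fermion_pair (negPf ab) (linear_homo PhiN_linear).
set sg := \sum_(r < n | (minn a b <= r < maxn a b)%N) val l r.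
have -> : klein a b << (S, l) >> = (-1) ^ sg *: << (S, l) >> :> V.
  exact: malg_liftU.
rewrite (linear_homo (vertex_linear _)) (linear_homo PhiN_linear) scalerA basis_state.
apply/esym; apply: (bosonization (@char0C R) n_gt0 ltP boson_linear PhiN_linear PhiN_inj PhiN_boson
  X_linear XE ZB (Zv0 l) (vac_annihilated l) (v1_vac l) (Y := bilin qpow a b s t)).
- by move=> N'; exact: linearP.
- by move=> c k N' x k0; rewrite (bilin_bracket n_gt0 _ _ _ qpowP) // /ws /wt ![k%:Q * _]mulrC.
- by move=> N' lN; rewrite PhiN_vac (bilin_low _ n_gt0).
- rewrite PhiN_vac /M0 (bilin_lead _ n_gt0) // /v1 (linear_homo PhiN_linear) PhiN_vac scalerA mulrC.
  by [].
by move=> N' D lN up; rewrite PhiN_vac (bilin_high _ n_gt0).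
Qed.

End Vertex.
End NBoson.

(** * The fields E and F in components *)

Section Split.
Variables (A : fieldType) (q : A) (qpow : rat -> A).
Hypotheses (q_neq0 : q != 0) (q_not_root : forall k : nat, (0 < k)%N -> q ^+ k != 1).
Hypothesis (qpowP : fractional_powers q qpow).
Variables (y : A) (y_neq0 : y != 0).

Lemma diff_op_one lt n' k l x :
  diff_op qpow lt 1 n' y k l x = diff_op qpow lt 1 0 y k (n' * k + l) x.
Proof.
have d1 : deg 1 n' k l = n' * k + l by rewrite /deg mul1r.
have d2 : deg 1 0 k (n' * k + l) = n' * k + l by rewrite /deg mul0r add0r mul1r.
rewrite /diff_op /diff_central d1 d2; congr (_ + _); apply: cur_ext => j.
by rewrite /diff_coeff d1 d2.
Qed.

(** The contraction 1 / (q^{-kap/2} - q^{kap/2}) of [fermion_pair] and the prefactor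
    combine to the constant of the action. *)
Lemma diff_const_one (kap : int) : kap != 0 ->
  y ^ kap * qpow (kap%:Q * (0 + 0 - 1) / (2 * 1))
    * (qpow (- (kap%:Q / 2)) - qpow (kap%:Q / 2))^-1
  = diff_const qpow 1 y kap.
Proof.
move=> k0; have D := qpowD qpowP.
have h0 := qpow_neq0 q_neq0 qpowP (kap%:Q / 2).
have -> : kap%:Q * (0 + 0 - 1) / (2 * 1) = - (kap%:Q / 2) by field.
have qk : qpow (kap%:Q / 1%:Q) = qpow (kap%:Q / 2) * qpow (kap%:Q / 2).
  by rewrite -D; congr qpow; field.
have : qpow (kap%:Q / 1%:Q) != 1.
  by apply: (qpow_neq1 q_neq0 q_not_root qpowP); rewrite divr1 intr_eq0.
rewrite /diff_const qk (qpowN q_neq0 qpowP).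
move: (qpow (kap%:Q / 2)) h0 => h h0 h1.
have d1 : 1 - h * h != 0 by rewrite subr_eq0 eq_sym.
have -> : h^-1 - h = (1 - h * h) / h by field.
by field; rewrite h0 d1.
Qed.

Variables (n : nat) (n_gt0 : (0 < n)%N) (n' kap : int).
Local Notation lt := (mode_order n).
Hypothesis ndvd : ~~ (n%:Z %| kap * n')%Z.

(** A position j of class b is moved by d = kap n' + nl to the class a with
    b - a = - kap n' mod n.  The two dilations by q^{kap/2} and q^{-kap/2} produce the
    dependence on j of the coefficient, and the powers of q with exponents
    (a + b - n)/2n the rest. *)
Lemma diff_op_split l x :
  diff_op qpow lt n n' y kap l x =
  \sum_(a < n) \sum_(b < n | (b%:Z - a%:Z == - (kap * n') %[mod n%:Z])%Z)
    (y ^ kap * qpow (kap%:Q * (a%:Q + b%:Q - n%:Q) / (2 * n%:Q))) *: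
      bilin qpow a b (kap%:Q / 2) (- (kap%:Q / 2))
        (- l - (((kap * n' - a%:Z + b%:Z) %/ n%:Z)%Z + 1)) x.
Proof.
have n0 : n%:Z != 0 by lia.
have nQ : n%:Q != 0 by rewrite intr_eq0.
pose d := deg n n' kap l.
have d0 : (d == 0) = false.
  apply/negbTE; apply: contraNneq ndvd => dl; apply/dvdzP; exists (- l).
  by move: dl; rewrite /d /deg; lia.
rewrite /diff_op /diff_central -/d d0 scale0r addr0.
pose e (a b : 'I_n) := ((kap * n' - a%:Z + b%:Z) %/ n%:Z)%Z.
have eE (a b : 'I_n) : (b%:Z - a%:Z == - (kap * n') %[mod n%:Z])%Z ->
    e a b * n%:Z = kap * n' - a%:Z + b%:Z.
  rewrite eqz_mod_dvd => h; rewrite divzK //.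
  by move: h; congr (_ %| _)%Z; ring.
pose G (a b : 'I_n) j := y ^ kap * qpow (kap%:Q * (a%:Q + b%:Q - n%:Q) / (2 * n%:Q))
   * bil_coef qpow b (kap%:Q / 2) (- (kap%:Q / 2)) (- l - (e a b + 1)) j.
transitivity (\sum_(a < n) \sum_(b < n | (b%:Z - a%:Z == - (kap * n') %[mod n%:Z])%Z)
   cur lt (G a b) d x); last first.
  apply: eq_bigr => a _; apply: eq_bigr => b ab; rewrite curZ /bilin -/(e a b).
  congr (_ *: cur _ _ _ _); rewrite /bil_shift /d /deg.
  by have := eE _ _ ab; lia.
under eq_bigr => a _ do rewrite -cur_sum; rewrite -cur_sum; apply: cur_ext => j.
have [i [c ->]] := decomp n_gt0 j.
have GE (a b : 'I_n) : G a b (n%:Z * i + c%:Z) = if b == c then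
   y ^ kap * qpow (kap%:Q * (a%:Q + b%:Q - n%:Q) / (2 * n%:Q))
   * qpow (kap%:Q / 2 * i%:Q - - (kap%:Q / 2) * (i - (- l - (e a b + 1)))%:Q) else 0.
  by rewrite /G bil_coefE // eq_sym; case: eqP => // _; rewrite mulr0.
have [i1 [a0 a0E]] := decomp n_gt0 (c%:Z + kap * n').
(* For j of class c only b = c contributes, and then a is determined: it is the residue
   a0 of c + kap n'. *)
have inner (a : 'I_n) : \sum_(b < n | (b%:Z - a%:Z == - (kap * n') %[mod n%:Z])%Z)
    G a b (n%:Z * i + c%:Z) = if a == a0 then diff_coeff qpow n n' y kap l (n%:Z * i + c%:Z) else 0.
  have -> : (a == a0) = (c%:Z - a%:Z == - (kap * n') %[mod n%:Z])%Z.
    rewrite eqz_mod_dvd; have -> : c%:Z - a%:Z - - (kap * n') = n%:Z * i1 + (a0%:Z - a%:Z).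
      by move: a0E; lia.
    have -> : (n%:Z %| n%:Z * i1 + (a0%:Z - a%:Z))%Z = (n%:Z %| a0%:Z - a%:Z)%Z.
      by apply: rpredDl; exact: dvdz_mulr.
    rewrite -eqz_mod_dvd; apply/eqP/eqP => [->//|].
    rewrite !modz_small; first by move=> h; apply: val_inj => /=; lia.
      by have := ltn_ord a; lia.
    by have := ltn_ord a0; lia.
  case: (boolP (_ == _ %[mod _])%Z) => [ca|ca].
    rewrite (bigD1 c) //= big1 ?addr0 => [|b /andP[_ /negPf bc]]; last by rewrite GE bc.
    rewrite GE eqxx /diff_coeff -/d -mulrA -(qpowD qpowP); congr (_ * qpow _).
    have ec : (e a c)%:Q = ((kap * n')%:Q - a%:Q + c%:Q) / n%:Q.
      apply: (mulIf nQ); rewrite divfK // -rmorphM /= (eE _ _ ca).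
      by rewrite !(rmorphB, rmorphD).
    rewrite /d /deg !(rmorphB, rmorphD, rmorphM, rmorphN) /= ec !rmorphM /=; field.
    exact: nQ.
  rewrite big1 // => b ba; rewrite GE; case: eqP => // bc.
  by rewrite -bc ba in ca.
by rewrite (eq_bigr _ (fun a _ => inner a)) -big_mkcond big_pred1_eq.
Qed.

End Split.

(** * One boson *)

Lemma scaler_subN (A : fieldType) (V : lmodType A) (c d k : A) (w : V) :
  ((d - c) / k) *: w = ((- k)^-1 * c) *: w - ((- k)^-1 * d) *: w.
Proof.
rewrite -scalerBl; congr (_ *: _).
by rewrite invrN; ring.
Qed.

Section FockBasis.
Variables (R : realType) (T : choiceType).

Lemma heis_U b i S : heis b i (<< S >> : fock R T) =
  (osc R b i S).1 *: << (osc R b i S).2 >>.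
Proof. by rewrite /heis malg_liftU; case: (osc R b i S). Qed.

Lemma heis_raise b m S : heis b (Negz m) (<< S >> : fock R T) = << ((b, m) +` S)%mset >>.
Proof. by have /= := heis_U b (Negz m) S; rewrite scale1r. Qed.

Lemma heis_vac b (k : nat) : heis b k.+1 (<< mset0 >> : fock R T) = 0.
Proof. by have /= := heis_U b k.+1 mset0; rewrite mset0E muln0 scale0r. Qed.
End FockBasis.

Section OneComponent.
Variable R : realType.
Local Notation C := R[i].
Variables (q : C) (qpow : rat -> C).
Hypotheses (q_neq0 : q != 0) (q_not_root : forall k : nat, (0 < k)%N -> q ^+ k != 1).
Hypothesis (qpowP : fractional_powers q qpow).
Variables (y : C) (y_neq0 : y != 0) (kap : int) (kap_neq0 : kap != 0).
Let s : rat := kap%:Q / 2.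
Let t : rat := - s.

Section FockUnit.
Variables (lt : rel int) (ltP : tournament lt).
Local Notation V := (fock R unit).
Local Notation Phi1 := (@Phi1 R lt).

Let B (c : 'I_1) (i : int) : V -> V := heis tt i.
Let B_linear c i : linear (B c i). Proof. exact: linearP. Qed.
Let PhiB c i v : i != 0 -> Phi1 (B c i v) = mode lt c i (Phi1 v).
Proof. by move=> i0; rewrite /B Phi1_heis // (ord1 c). Qed.

(** The exponents of E(z) for kap = 1 and of F(z) for kap = -1 in one formula: that of
    :exp (phi(q^s z) - phi(q^t z)): without its zero modes. *)
Definition fock_X (k : int) (w : V) : V :=
  ((qpow (k%:Q * t) - qpow (k%:Q * s)) / k%:~R) *: heis tt (- k) w.
Definition fock_Z (M : int) (w : V) : V := if M == 0 then w else 0.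

Let X_linear k : linear (fock_X k).
Proof. by apply: linear_scalef; exact: linearP. Qed.
Let Z_linear M : linear (fock_Z M).
Proof. by apply: linear_iff; [exact: linear_idf | exact: linear_0f]. Qed.

Let XE k v : k != 0 -> fock_X k v =
  ((- k)%:~R^-1 * qpow (k%:Q * s)) *: B ord0 (- k) v
  - ((- k)%:~R^-1 * qpow (k%:Q * t)) *: B ord0 (- k) v.
Proof.
move=> k0; rewrite [(- k)%:~R](rmorphN (intmul 1)).
exact: scaler_subN.
Qed.

Let ZB c (m : nat) M v : fock_Z M (B c (Negz m) v) = B c (Negz m) (fock_Z M v).
Proof. by rewrite /fock_Z; case: eqP => // _; rewrite (linear_0 (B_linear _ _)). Qed.

Let v0 : V := << mset0 >>.
Let Zv0 M : fock_Z M v0 = if M == 0 then v0 else 0. Proof. by []. Qed.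

Let v0_vac c (k : nat) : B c k.+1 v0 = 0.
Proof. exact: heis_vac. Qed.

Let Phi_v0 : Phi1 v0 = ket C fset0.
Proof. by rewrite /Phi1 fock_mapU enum_mset0. Qed.

Let state_U st : state (raise B) v0 st = << seq_mset [seq (tt, cm.2) | cm <- st] >>.
Proof.
elim: st => [|[c m] st IH].
  have -> : seq_mset [::] = mset0 :> occupation unit; last by [].
  by apply/msetP => x; rewrite mset_seqE mset0E.
rewrite -[LHS]/(heis tt (Negz m) (state (raise B) v0 st)) IH.
have -> : seq_mset [seq (tt, cm.2) | cm <- (c, m) :: st]
        = ((tt, m) +` seq_mset [seq (tt, cm.2) | cm <- st])%mset.
  by apply/msetP => x; rewrite mset1DE !mset_seqE /= eq_sym.
exact: heis_raise.
Qed.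

Let basis_st S : exists st, << S >> = state (raise B) v0 st.
Proof.
exists [seq (ord0, bm.2) | bm <- enum_mset S]; rewrite state_U -map_comp.
rewrite (eq_map (_ : _ =1 id)) ?map_id ?seq_mset_id //.
by case=> -[] m.
Qed.

Let nc_linear N : linear (normal_coef fock_X fock_Z N).
Proof.
have sm v : summable fock_X fock_Z N v.
  rewrite (malg_basisE v); apply: big_ind => [|u w|S _].
  - exact: summable0.
  - exact: summableD.
  apply: summableZ => //; have [st ->] := basis_st S.
  exact: (one_boson_summable (@char0C R) ltP B_linear (Phi1_linear _) (Phi1_inj ltP) PhiB X_linear
    XE ZB Zv0 v0_vac).
by move=> c u v; exact: (proj2 (normal_coef_comb X_linear c Z_linear (sm u) (sm v))).
Qed.

Lemma Phi1_vertex l v : diff_const qpow 1 y kap *: Phi1 (normal_coef fock_X fock_Z (- l) v)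
  = diff_op qpow lt 1 0 y kap l (Phi1 v).
Proof.
move: v; apply: malg_ext.
- by apply/linear_scalef/linear_compf; [exact: Phi1_linear | exact: nc_linear].
- by apply: linear_compf; [exact: diff_op_linear | exact: Phi1_linear].
move=> S; have [st ->] := basis_st S.
rewrite -[in RHS](opprK l); apply/esym.
exact: (one_boson_vertex (@char0C R) q_neq0 q_not_root qpowP ltP y_neq0 kap_neq0
  (erefl s) (erefl t) B_linear (Phi1_linear _) (Phi1_inj ltP) PhiB X_linear XE ZB Zv0 v0_vac
    Phi_v0).
Qed.

End FockUnit.

(** For n = 1 the lattice is trivial and :exp (phi(q^s z) - phi(q^t z)): has no zero
    modes. *)
Section BosonOne.
Local Notation lt := (mode_order 1).
Let n1 : (0 < 1)%N := isT.
Let ltP : tournament lt := mode_orderP n1.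
Local Notation V := (boson_space R 1).
Local Notation PhiN := (@PhiN R 1).

Let X k (w : V) := phi_osc qpow (ord0 : 'I_1) s k w - phi_osc qpow (ord0 : 'I_1) t k w.
Let Z := @zero_modes R qpow 1 ord0 s ord0 t.

Let X_linear k : linear (X k).
Proof. by apply: linear_subf; apply: linear_scalef; exact: boson_linear. Qed.

Let XE k v : k != 0 -> X k v =
  ((- k)%:~R^-1 * qpow (k%:Q * s)) *: boson ord0 (- k) v
  - ((- k)%:~R^-1 * qpow (k%:Q * t)) *: boson ord0 (- k) v.
Proof. by []. Qed.

Let lattice0 (l : root_lattice 1) : val l = [ffun=> 0].
Proof.
have := valP l; rewrite /root_pred big_ord1 => /eqP l0.
by apply/ffunP => b; rewrite ffunE (ord1 b).
Qed.

Let shift0 (l : root_lattice 1) : shift ord0 ord0 l = l.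
Proof. by apply: val_inj => /=; rewrite subrr addr0. Qed.

Let ZE M v : Z M v = if M == 0 then v else 0.
Proof.
move: v; apply: malg_ext; first exact: linearP.
  by apply: linear_iff; [exact: linear_idf | exact: linear_0f].
case=> S l; rewrite /Z /zero_modes malg_liftU -[(S, l).2]/l -[(S, l).1]/S.
rewrite lattice0 ffunE subrr eq_sym shift0.
by rewrite !mulr0 subr0 (qpow0 q_neq0 qpowP) scale1r.
Qed.

Let ZB (c : 'I_1) (m : nat) M v : Z M (boson c (Negz m) v) = boson c (Negz m) (Z M v).
Proof.
have e1 := ZE M (boson c (Negz m) v); have e2 := ZE M v; rewrite e1 e2.
case: (M == 0); first reflexivity.
exact: esym (linear_0 (boson_linear c (Negz m))).
Qed.

Lemma PhiN_vertex1 l v :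
  diff_const qpow 1 y kap *: PhiN (vertex qpow ord0 s ord0 t (- l) v)
  = diff_op qpow lt 1 0 y kap l (PhiN v).
Proof.
move: v; apply: malg_ext.
- by apply/linear_scalef/linear_compf; [exact: PhiN_linear | exact: vertex_linear].
- by apply: linear_compf; [exact: diff_op_linear | exact: PhiN_linear].
case=> S lam; rewrite basis_state -[in RHS](opprK l); apply/esym.
have Phi_v0 : PhiN << (mset0, lam) >> = ket C fset0.
  by rewrite PhiN_vac /charged_vac lattice0 vacset0.
have H := (one_boson_vertex (Z := Z) (@char0C R) q_neq0 q_not_root qpowP ltP y_neq0 kap_neq0
  (erefl s) (erefl t) (@boson_linear R 1) (@PhiN_linear R 1) (PhiN_inj n1) (@PhiN_boson R 1 n1)
  X_linear XE ZB (fun M => ZE M _) (@vac_annihilated R 1 lam) Phi_v0 (- l) (enum_mset S)).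
exact: H.
Qed.

End BosonOne.
End OneComponent.

(** * Representations of Diff_q *)

Section Representations.
Variable R : realType.
Local Notation C := R[i].
Variables (q : C) (qpow : rat -> C).
Hypotheses (q_neq0 : q != 0) (q_not_root : forall k : nat, (0 < k)%N -> q ^+ k != 1).
Hypothesis (qpowP : fractional_powers q qpow).

Lemma dE_basis k l (kl : (k, l) != 0) : dE R k l = << inl (exist _ (k, l) kl) >>.
Proof. by rewrite /dE insubT. Qed.

Lemma bracket_linearl y : linear (fun x => bracket qpow x y).
Proof. exact: malg_lift_is_linear. Qed.

Lemma bracketU i j : bracket qpow << i >> << j >> = bracket_basis qpow i j.
Proof. by rewrite /bracket !malg_liftU. Qed.

Lemma bracket_linearr x : linear (bracket qpow x).
Proof. by apply: linear_sumf => k; exact/linear_scalef/malg_lift_is_linear. Qed.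

Lemma bracket_dE k l r s : (k, l) != 0 -> (r, s) != 0 ->
  bracket qpow (dE R k l) (dE R r s)
  = (qpow ((s * k - l * r)%:Q / 2) - qpow ((l * r - s * k)%:Q / 2)) *: dE R (k + r) (l + s)
    + (if (k == - r) && (l == - s) then k%:~R *: dc' R + l%:~R *: dc R else 0).
Proof. by move=> kl rs; rewrite (dE_basis kl) (dE_basis rs) bracketU. Qed.

Section RepOn.
Variable V : lmodType C.
Implicit Types rho : diffq R -> V -> V.

Lemma is_rep_basis rho : (forall x, linear (rho x)) -> (forall v, linear (rho^~ v)) ->
    (forall i j v, rho (bracket_basis qpow i j) v
       = rho << i >> (rho << j >> v) - rho << j >> (rho << i >> v)) ->
  is_rep qpow rho.
Proof.
move=> lr ll H; split=> // x y v; move: x.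
apply: malg_ext.
- exact: (linear_compf (ll v) (bracket_linearl y)).
- by apply: linear_subf; [exact: ll | exact: (linear_compf (lr y) (ll v))].
move=> i; move: y; apply: malg_ext.
- exact: (linear_compf (ll v) (bracket_linearr _)).
- by apply: linear_subf; [exact: (linear_compf (lr _) (ll v)) | exact: ll].
by move=> j; rewrite bracketU H.
Qed.

Lemma qpow_half_neq (x : int) : x != 0 -> qpow (x%:Q / 2) - qpow ((- x)%:Q / 2) != 0.
Proof.
move=> x0; rewrite subr_eq0; apply: contraNneq (qpow_neq1 q_neq0 q_not_root qpowP (r := x%:Q) _).
  move=> e; rewrite (_ : x%:Q = x%:Q / 2 - (- x)%:Q / 2); last by rewrite rmorphN /=; field.
  by rewrite (qpowD qpowP) e -(qpowD qpowP) subrr (qpow0 q_neq0 qpowP).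
by rewrite intr_eq0.
Qed.

(** [E_{e,a}, E_{em,b-a}] is a multiple of E_{e(m+1),b} for e = 1 or -1, and q is not a
    root of unity, so the multiple is nonzero as soon as b <> a(m+1). *)
Lemma rep_generated rho rho' : is_rep qpow rho -> is_rep qpow rho' ->
    (forall v, rho (dc R) v = rho' (dc R) v) ->
    (forall v, rho (dc' R) v = rho' (dc' R) v) ->
    (forall k v, k != 0 -> rho (dE R 0 k) v = rho' (dE R 0 k) v) ->
    (forall k v, rho (dE R 1 k) v = rho' (dE R 1 k) v) ->
    (forall k v, rho (dE R (-1) k) v = rho' (dE R (-1) k) v) ->
  rho =2 rho'.
Proof.
move=> [_ ll br] [_ ll' br'] hc hc' h0 h1 hm1 x v; move: x.
suff H k l : (k, l) != 0 -> forall v, rho (dE R k l) v = rho' (dE R k l) v.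
  apply: malg_ext; [exact: ll | exact: ll' |].
  case=> [[[k l] kl]|[]]; [| exact: hc | exact: hc'].
  by rewrite -dE_basis; exact: H.
have step (e : int) (m : nat) : (e == 1) || (e == -1) ->
    (forall b v, rho (dE R e b) v = rho' (dE R e b) v) ->
    (forall b v, rho (dE R (e * m.+1%:Z) b) v = rho' (dE R (e * m.+1%:Z) b) v) ->
  forall b v, rho (dE R (e * m.+2%:Z) b) v = rho' (dE R (e * m.+2%:Z) b) v.
  move=> e1 he hm b w.
  (* One of a = 0 and a = 1 makes the structure constant nonzero. *)
  have ex : exists a, b != a * m.+2%:Z.
    by have [b0|b0] := eqVneq b 0; [exists 1; lia | exists 0; lia].
  case: ex => a ba; pose c := (b - a) * e - a * (e * m.+1%:Z).
  have c0 : c != 0 by rewrite /c; case/orP: e1 => /eqP ->; lia.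
  have nz1 : (e, a) != 0 by rewrite xpair_eqE negb_and; case/orP: e1 => /eqP ->.
  have nz2 : (e * m.+1%:Z, b - a) != 0.
    by rewrite xpair_eqE negb_and; case/orP: e1 => /eqP ->; lia.
  have := bracket_dE nz1 nz2.
  have -> : (e == - (e * m.+1%:Z)) && (a == - (b - a)) = false.
    by case/orP: e1 => /eqP ->; lia.
  rewrite addr0 subrKC.
  have -> : e + e * m.+1%:Z = e * m.+2%:Z by lia.
  rewrite -/c; have -> : a * (e * m.+1%:Z) - (b - a) * e = - c by rewrite /c; lia.
  set d := qpow _ - qpow _ => E; have d0 : d != 0 by exact: qpow_half_neq.
  have key r : (forall u, linear (r^~ u)) ->
      (forall x y u, r (bracket qpow x y) u = r x (r y u) - r y (r x u)) ->
      r (dE R (e * m.+2%:Z) b) w = d^-1 *: (r (dE R e a) (r (dE R (e * m.+1%:Z) (b - a)) w)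
         - r (dE R (e * m.+1%:Z) (b - a)) (r (dE R e a) w)).
    move=> lr rb; rewrite -rb E (linear_homo (lr w)) scalerA mulVf // scale1r //.
  rewrite (key rho ll br) (key rho' ll' br').
  by rewrite (he a) (hm (b - a)) hm he.
have pos (e : int) (m : nat) : (e == 1) || (e == -1) ->
    (forall b v, rho (dE R e b) v = rho' (dE R e b) v) ->
  forall b v, rho (dE R (e * m.+1%:Z) b) v = rho' (dE R (e * m.+1%:Z) b) v.
  move=> e1 he; elim: m => [|m IH]; first by rewrite mulr1.
  exact: step.
move=> kl w; case: k kl => [[|m]|m] kl.
- by apply: h0; move: kl; rewrite xpair_eqE.
- by have := pos 1 m isT h1 l w; rewrite mul1r.
by have := pos (-1) m isT hm1 l w; rewrite mulN1r -NegzE.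
Qed.

End RepOn.

Section Fermionic.
Variables (lt : rel int) (ltP : tournament lt).
Variables (n : nat) (n_gt0 : (0 < n)%N) (n' : int) (y : C) (y_neq0 : y != 0).
Local Notation F := (fermions C).

Definition basis_op (i : diffq_basis) (x : F) : F :=
  match i with
  | inl kl => diff_op qpow lt n n' y (val kl).1 (val kl).2 x
  | inr true => n%:R *: x
  | inr false => n'%:~R *: x
  end.

Lemma basis_op_linear i : linear (basis_op i).
Proof.
case: i => [kl|[]]; first exact: diff_op_linear.
  exact/linear_scalef/linear_idf.
exact/linear_scalef/linear_idf.
Qed.

Definition fermion_rep (d : diffq R) (x : F) : F := malg_lift (basis_op^~ x) d.

Lemma fermion_rep_linearl x : linear (fermion_rep^~ x). Proof. exact: malg_lift_is_linear. Qed.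

Lemma fermion_rep_linear d : linear (fermion_rep d).
Proof.
apply: linear_sumf => i; exact/linear_scalef/basis_op_linear.
Qed.

Lemma fermion_repU i x : fermion_rep << i >> x = basis_op i x. Proof. exact: malg_liftU. Qed.

Lemma fermion_rep_dE k l x : (k, l) != 0 -> fermion_rep (dE R k l) x = diff_op qpow lt n n' y k l x.
Proof. by move=> kl; rewrite (dE_basis kl) fermion_repU. Qed.

Lemma fermion_rep_dc x : fermion_rep (dc R) x = n%:R *: x. Proof. exact: fermion_repU. Qed.
Lemma fermion_rep_dc' x : fermion_rep (dc' R) x = n'%:~R *: x. Proof. exact: fermion_repU. Qed.

Lemma fermion_rep_center a b x :
  fermion_rep (a *: dc' R + b *: dc R) x = (a * n'%:~R + b * n%:R) *: x.
Proof.
have h := fermion_rep_linearl x a (dc' R) (b *: dc R).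
apply: (etrans h); rewrite (_ : fermion_rep (b *: dc R) x = b *: fermion_rep (dc R) x).
  by rewrite fermion_rep_dc fermion_rep_dc' !scalerA -scalerDl.
exact: (linear_homo (fermion_rep_linearl x)).
Qed.

Lemma fermion_rep_rep : is_rep qpow fermion_rep.
Proof.
apply: is_rep_basis; [exact: fermion_rep_linear | exact: fermion_rep_linearl |].
move=> i j v; rewrite !fermion_repU.
have cent (c : C) (f : F -> F) w : linear f -> 0 = c *: f w - f (c *: w).
  by move=> lf; rewrite (linear_homo lf) subrr.
case: i => [[[k l] kl]|[]]; last 2 first.
- rewrite (linear_0 (fermion_rep_linearl v)); exact: cent (basis_op_linear j).
- rewrite (linear_0 (fermion_rep_linearl v)); exact: cent (basis_op_linear j).
case: j => [[[r s] rs]|[]]; last 2 first.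
- by rewrite (linear_0 (fermion_rep_linearl v)) (linear_homo (basis_op_linear _)) subrr.
- by rewrite (linear_0 (fermion_rep_linearl v)) (linear_homo (basis_op_linear _)) subrr.
rewrite [RHS](diff_op_bracket q_neq0 q_not_root qpowP ltP n_gt0 n' y_neq0 k l r s v).
rewrite [bracket_basis _ _ _]/= (linear_additive (fermion_rep_linearl v)).
rewrite (linear_homo (fermion_rep_linearl v)); congr (_ + _).
  have [e|e] := eqVneq (k + r, l + s) 0; last by rewrite fermion_rep_dE.
  case: e => kr ls; have -> : r = - k by lia.
  have -> : s = - l by lia.
  have -> : - l * k - l * - k = 0 by ring.
  have -> : l * - k - - l * k = 0 by ring.
  by rewrite subrr !scale0r.
case: (_ && _); last by rewrite (linear_0 (fermion_rep_linearl v)) scale0r.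
rewrite fermion_rep_center; congr (_ *: _).
by rewrite /deg rmorphD !rmorphM /= mulrC [l%:~R * _]mulrC.
Qed.

Lemma fermion_rep_neutral d x : neutral x -> neutral (fermion_rep d x).
Proof.
move=> cx; rewrite /fermion_rep /malg_lift; apply: big_ind => [||i _]; [exact: neutral_0 |
  exact: neutralD |].
apply: neutralZ; case: i => [kl|[]]; [|exact: neutralZ|exact: neutralZ].
by apply: neutralD; [exact: neutral_cur | exact: neutralZ].
Qed.

(** Charge-zero vectors are stable, so the action pulls back along any linear bijection
    onto them. *)
Lemma transport (V : lmodType C) (Phi : V -> F) : linear Phi -> injective Phi ->
    (forall v, neutral (Phi v)) -> (forall x, neutral x -> exists v, Phi v = x) ->
  exists rho : diffq R -> V -> V,
    is_rep qpow rho /\ forall d v, Phi (rho d v) = fermion_rep d (Phi v).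
Proof.
move=> lP iP cP sP.
have ex (dv : diffq R * V) : exists w, Phi w = fermion_rep dv.1 (Phi dv.2).
  exact/sP/fermion_rep_neutral/cP.
have [rho hr] := choice ex; exists (fun d v => rho (d, v)).
have h d v : Phi (rho (d, v)) = fermion_rep d (Phi v) by rewrite hr.
have [r1 r2 r3] := fermion_rep_rep.
split=> //; split=> [d c u v|v c d e|d e v]; apply: iP.
- by rewrite lP !h lP r1.
- by rewrite lP !h r2.
by rewrite (linear_sub lP) !h r3.
Qed.

End Fermionic.
End Representations.

(** * The rescaling of the fermions that realizes the twist *)

(** Multiplying psi_j by g_j, psi*_j by its inverse, and fixing the vacuum. *)
Section Gauge.
Variables (A : fieldType) (gg : int -> A).
Hypothesis gg_neq0 : forall j, gg j != 0.
Local Notation F := (fermions A).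

Definition gauge_weight (D : maya) : A := \prod_(j <- D) (if 0 <= j then (gg j)^-1 else gg j).

Definition gauge : F -> F := lift (fun D => gauge_weight D *: ket A D).

Lemma gauge_linear : linear gauge. Proof. exact: lift_linear. Qed.

Lemma gauge_ket D : gauge (ket A D) = gauge_weight D *: ket A D.
Proof. exact: lift_ket. Qed.

Lemma gauge_weight_neq0 D : gauge_weight D != 0.
Proof.
rewrite /gauge_weight; apply: (big_ind (fun x => x != 0)) => [||j _]; first exact: oner_neq0.
  by move=> x y x0 y0; rewrite mulf_neq0.
by case: (0 <= j); rewrite ?invr_eq0.
Qed.

Lemma gauge_weight_toggle j D :
  gauge_weight (toggle j D) = (if filled D j then (gg j)^-1 else gg j) * gauge_weight D.
Proof.
rewrite /gauge_weight (big_toggle (G := fun j => if 0 <= j then gg j else (gg j)^-1)); last first.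
  by case: (0 <= j); rewrite ?mulVf ?mulfV.
by rewrite /filled; case: (0 <= j); case: (j \in D).
Qed.

Lemma coef_gauge D x : coef D (gauge x) = gauge_weight D * coef D x.
Proof.
suff H : (fun x => coef D (gauge x) : A^o) =1 (fun x => gauge_weight D *: (coef D x : A^o)) by
  exact: H.
apply: ket_ext.
- by move=> c y z; rewrite gauge_linear coefD coefZ.
- by apply: linear_scalef => c y z; rewrite coefD coefZ.
move=> E; rewrite gauge_ket coefZ coef_ket.
by have [->|ne] := eqVneq E D; [|rewrite [RHS]mulr0 mulr0].
Qed.

Lemma gauge_neutral x : neutral x -> neutral (gauge x).
Proof.
by move=> cx D; rewrite coef_gauge mulf_eq0 (negPf (gauge_weight_neq0 D)) => /cx.
Qed.

Lemma gauge_inj : injective gauge.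
Proof.
move=> x y e; apply/coefP => D; apply: (mulfI (gauge_weight_neq0 D)).
by rewrite -!coef_gauge e.
Qed.

Lemma gauge_onto y : neutral y -> exists2 x, neutral x & gauge x = y.
Proof.
apply: (neutral_ind (P := fun y => exists2 x, neutral x & gauge x = y)).
- by exists 0; [exact: neutral_0 | exact: linear_0 gauge_linear].
- move=> _ _ [x cx <-] [z cz <-]; exists (x + z); first exact: neutralD.
  exact: (linear_additive gauge_linear).
- move=> a _ [x cx <-]; exists (a *: x); first exact: neutralZ.
  exact: (linear_homo gauge_linear).
move=> D D0; exists ((gauge_weight D)^-1 *: ket A D); first exact/neutralZ/neutral_ket.
by rewrite (linear_homo gauge_linear) gauge_ket scalerA mulVf ?gauge_weight_neq0 ?scale1r.
Qed.

(** psi_{j+l} psi*_j is multiplied by g_{j+l} / g_j; for l = 0 nothing changes. *)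
Lemma gauge_cur lt al l x : tournament lt ->
  gauge (cur lt al l x) = cur lt (fun j => al j * (gg (j + l) / gg j)) l (gauge x).
Proof.
move=> ltP; move: x; apply: ket_ext.
- by apply: linear_compf; [exact: gauge_linear | exact: linearP].
- by apply: linear_compf; [exact: linearP | exact: gauge_linear].
move=> D; rewrite gauge_ket linearZ /= !curU (linear_bigsum gauge_linear) scaler_sumr.
apply: eq_bigr => j _; rewrite (linear_homo gauge_linear).
have [->|l0] := eqVneq l 0.
  rewrite addr0 normal_pair_diag // divff // mulr1 (linear_homo gauge_linear) gauge_ket !scalerA.
  by congr (_ *: _); ring.
have jl : j + l != j by lia.
rewrite (@normal_pair_off A lt _ _ _ jl); case: (boolP (_ && _)) => [/andP[Fj Fl]|_]; last first.
  by rewrite (linear_0 gauge_linear) !scaler0.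
rewrite (linear_homo gauge_linear) gauge_ket !scalerA !gauge_weight_toggle filled_toggle.
by rewrite (negPf jl) Fj (negPf Fl) /=; congr (_ *: _); ring.
Qed.

End Gauge.

Section Sigma.
Variables (A : fieldType) (q : A) (qpow : rat -> A).
Hypotheses (q_neq0 : q != 0) (qpowP : fractional_powers q qpow).
Variables (lt : rel int) (ltP : tournament lt).
Variables (n : nat) (n_gt0 : (0 < n)%N) (m' m n' : int).
Hypothesis (det1 : m' * n%:Z - m * n' = 1).
Variables (u un : A) (un_neq0 : un != 0) (unP : un ^+ n = u).

(** The ratio of g at j + L and j has to be linear in j in the exponent, with slope
    mL/n, whence the quadratic exponent. *)
Definition twist_gauge (j : int) : A := un ^ (m * j) * qpow (m%:Q * (j * j)%:Q / (2 * n%:Q)).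

Lemma twist_gauge_neq0 j : twist_gauge j != 0.
Proof. by rewrite mulf_neq0 ?expfz_neq0 ?(qpow_neq0 q_neq0 qpowP). Qed.

Lemma twist_gauge_ratio j L : twist_gauge (j + L) / twist_gauge j
  = un ^ (m * L) * qpow (m%:Q * L%:Q / n%:Q * (j%:Q + L%:Q / 2)).
Proof.
rewrite /twist_gauge invfM -(qpowN q_neq0 qpowP) invr_expz mulrACA -expfzDr //.
rewrite -(qpowD qpowP); congr (_ ^ _ * qpow _); first by ring.
by have n0 := nQ_neq0 n_gt0; rewrite !(rmorphD, rmorphM) /=; field.
Qed.

(** With K = m'k + ml and L = n'k + nl one has nK = k + mL, so that the rate k/n of the
    exponent in j becomes K; for L = 0 this reads k = nK, which identifies the
    constants. *)
Lemma diff_op_gauge k l x :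
  gauge twist_gauge (diff_op qpow lt n n' un k l x)
  = diff_op qpow lt 1 0 u (m' * k + m * l) (n' * k + n%:Z * l) (gauge twist_gauge x).
Proof.
have n0 := nQ_neq0 n_gt0.
pose K := m' * k + m * l; pose L := n' * k + n%:Z * l.
have hK : n%:Z * K = k + m * L.
  transitivity (k * (m' * n%:Z - m * n') + m * L); first by rewrite /K /L; ring.
  by rewrite det1 mulr1.
have hu z : u ^ z = un ^ (n%:Z * z) by rewrite -unP -exprz_exp.
have degL : deg 1 0 K L = L by rewrite /deg mul0r mul1r add0r.
rewrite /diff_op (linear_additive (gauge_linear _)) (linear_homo (gauge_linear _)) degL.
rewrite (gauge_cur twist_gauge_neq0) //; congr (_ + _ *: _).
  apply: cur_ext => j; rewrite /diff_coeff degL -/K -/L twist_gauge_ratio.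
  have -> : deg n n' k l = L by [].
  rewrite mulrACA -expfzDr // -(qpowD qpowP) hu hK; congr (_ * qpow _).
  have hK' : K%:Q = (k%:Q + m%:Q * L%:Q) / n%:Q.
    by apply: (mulIf n0); rewrite divfK // mulrC -!intrM hK intrD.
  by rewrite hK' !(rmorphD, rmorphM) /=; field.
rewrite /diff_central degL; have -> : deg n n' k l = L by [].
rewrite -/K -/L; case: (eqVneq L 0) => [L0|//]; rewrite /diff_const hu divr1.
have nK : n%:Z * K = k by rewrite hK L0 mulr0 addr0.
by rewrite nK (_ : k%:Q / n%:Q = K%:Q) // -nK intrM mulrAC divff // mul1r.
Qed.

End Sigma.

Lemma det_mx2 (sigma : 'M[int]_2) :
  \det sigma = sigma 0 0 * sigma 1 1 - sigma 0 1 * sigma 1 0.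
Proof.
rewrite (expand_det_row _ 0) !big_ord_recl big_ord0 addr0 /cofactor !det_mx11 !mxE /=.
rewrite expr0 expr1 mul1r mulN1r mulrN.
by congr (sigma _ _ * sigma _ _ - sigma _ _ * sigma _ _); apply: val_inj.
Qed.

Section SigmaRep.
Variables (R : realType) (q : R[i]) (qpow : rat -> R[i]).
Hypotheses (q_neq0 : q != 0) (qpowP : fractional_powers q qpow).
Variables (lt : rel int) (ltP : tournament lt).
Variables (n : nat) (n_gt0 : (0 < n)%N) (sigma : 'M[int]_2).
Hypotheses (det_sigma : \det sigma = 1) (sigma_n : sigma 1 1 = n%:Z).
Variables (u un : R[i]) (un_neq0 : un != 0) (unP : un ^+ n = u).

(** Only nonzero (k, l) go to nonzero (K, L) under an invertible matrix, so the value of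
    E_{0,0} does not enter. *)
Lemma fermion_rep_sl2 d x :
  gauge (twist_gauge qpow n (sigma 0 1) un) (fermion_rep qpow lt n (sigma 1 0) un d x)
  = fermion_rep qpow lt 1 0 u (sl2_act sigma d) (gauge (twist_gauge qpow n (sigma 0 1) un) x).
Proof.
have det1 : sigma 0 0 * n%:Z - sigma 0 1 * sigma 1 0 = 1 by rewrite -sigma_n -det_mx2.
set G := gauge _; have lG : linear G := gauge_linear _.
have ll y : linear (fermion_rep qpow lt 1 0 u ^~ y) := fermion_rep_linearl qpow lt 1 0 u y.
move: d; apply: malg_ext.
- exact: (linear_compf lG (fermion_rep_linearl _ _ _ _ _ _)).
- exact: (linear_compf (ll _) (malg_lift_is_linear _)).
move=> i; rewrite /sl2_act malg_liftU fermion_repU.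
rewrite /sl2_basis; case: i => [[[k l] kl]|[]] /=.
- rewrite {1}/G (diff_op_gauge q_neq0 qpowP ltP n_gt0 det1 un_neq0 unP) -/G sigma_n
  fermion_rep_dE //.
  move: kl; apply: contraNneq => -[h1 h2]; rewrite xpair_eqE.
  have k0 : k = 0.
    transitivity (k * (sigma 0 0 * n%:Z - sigma 0 1 * sigma 1 0)); first by rewrite det1 mulr1.
    transitivity (n%:Z * (sigma 0 0 * k + sigma 0 1 * l) - sigma 0 1 * (sigma 1 0 * k + n%:Z * l)).
      by ring.
    by rewrite h1 h2 !mulr0 subrr.
  have l0 : l = 0.
    transitivity (l * (sigma 0 0 * n%:Z - sigma 0 1 * sigma 1 0)); first by rewrite det1 mulr1.
    transitivity (sigma 0 0 * (sigma 1 0 * k + n%:Z * l) - sigma 1 0 * (sigma 0 0 * k + sigma 0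
      1 * l)).
      by ring.
    by rewrite h1 h2 !mulr0 subrr.
  by rewrite k0 l0.
- by rewrite fermion_rep_center mulr0 add0r mulr1 (linear_homo lG) sigma_n.
by rewrite fermion_rep_center mulr0 add0r mulr1 (linear_homo lG).
Qed.

End SigmaRep.

(** * The two modules and their isomorphism *)

Section FockModule.
Variable R : realType.
Variables (q : R[i]) (qpow : rat -> R[i]).
Hypotheses (q_neq0 : q != 0) (q_not_root : forall k : nat, (0 < k)%N -> q ^+ k != 1).
Hypothesis (qpowP : fractional_powers q qpow).
Variables (u : R[i]) (u_neq0 : u != 0).

Lemma fock_EE l v :
  fock_E q qpow u l v = diff_const qpow 1 u 1 *: normal_coef (fock_X qpow 1) (@fock_Z R) (- l) v.
Proof.
have -> : fock_X qpow 1 = (fun k (w : fock R unit) =>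
    ((qpow (- k%:Q / 2) - qpow (k%:Q / 2)) / k%:~R) *: heis tt (- k) w).
  apply: funext => k; apply: funext => w; rewrite /fock_X.
  have -> : k%:Q * - (1%:Q / 2) = - k%:Q / 2 by field.
  by have -> : k%:Q * (1%:Q / 2) = k%:Q / 2 by field.
have -> : diff_const qpow 1 u 1 = u / (1 - q); last by reflexivity.
by rewrite /diff_const expr1z divr1 (qpow1 qpowP).
Qed.

Lemma fock_FE l v : fock_F q qpow u l v
  = diff_const qpow 1 u (-1) *: normal_coef (fock_X qpow (-1)) (@fock_Z R) (- l) v.
Proof.
have -> : fock_X qpow (-1) = (fun k (w : fock R unit) =>
    ((qpow (k%:Q / 2) - qpow (- k%:Q / 2)) / k%:~R) *: heis tt (- k) w).
  apply: funext => k; apply: funext => w; rewrite /fock_X.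
  have -> : k%:Q * - ((-1)%:Q / 2) = k%:Q / 2 by rewrite rmorphN /=; field.
  by have -> : k%:Q * ((-1)%:Q / 2) = - k%:Q / 2 by rewrite rmorphN /=; field.
have -> : diff_const qpow 1 u (-1) = u^-1 / (1 - q^-1); last by reflexivity.
rewrite /diff_const -exprz_inv expr1z divr1.
have -> : (-1)%:Q = - 1 :> rat by rewrite rmorphN.
by rewrite (qpowN q_neq0 qpowP) (qpow1 qpowP).
Qed.

Lemma fock_module lt : tournament lt -> exists2 rho, is_fock_module q qpow u rho
  & forall d v, Phi1 lt (rho d v) = fermion_rep qpow lt 1 0 u d (Phi1 lt v).
Proof.
move=> ltP; have lP := @Phi1_linear R lt; have iP := @Phi1_inj R lt ltP.
have [rho [rep h]] := transport q_neq0 q_not_root qpowP ltP (isT : (0 < 1)%N) 0 u_neq0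
  lP iP (@Phi1_charge R lt ltP) (@Phi1_onto R lt ltP).
exists rho => //; split=> // [v|k v k0|k v|k v].
- split; apply: iP; rewrite h; first by rewrite fermion_rep_dc scale1r.
  by rewrite fermion_rep_dc' scale0r (linear_0 lP).
- have kl : (0, k) != 0 :> (int * int)%type by rewrite xpair_eqE.
  apply: iP; rewrite h (fermion_rep_dE _ _ _ _ _ _ kl) Phi1_heis //.
  by rewrite -(sum_modes q_neq0 qpowP lt 0 u (Phi1 lt v) (isT : (0 < 1)%N) k0) big_ord1.
- have kl : (1, k) != 0 :> (int * int)%type by rewrite xpair_eqE.
  apply: iP; rewrite h (fermion_rep_dE _ _ _ _ _ _ kl) fock_EE (linear_homo lP).
  by rewrite (Phi1_vertex q_neq0 q_not_root qpowP u_neq0).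
have kl : (-1, k) != 0 :> (int * int)%type by rewrite xpair_eqE.
apply: iP; rewrite h (fermion_rep_dE _ _ _ _ _ _ kl) fock_FE (linear_homo lP).
by rewrite (Phi1_vertex q_neq0 q_not_root qpowP u_neq0).
Qed.

End FockModule.

Section TwistedFields.
Variable R : realType.
Variables (q : R[i]) (qpow : rat -> R[i]).
Hypotheses (q_neq0 : q != 0) (q_not_root : forall k : nat, (0 < k)%N -> q ^+ k != 1).
Hypothesis (qpowP : fractional_powers q qpow).
Variables (un : R[i]) (un_neq0 : un != 0).

(** [tw_E] for kap = 1 and [tw_F] for kap = -1. *)
Definition tw_field (n : nat) (n' kap l : int) (v : boson_space R n) : boson_space R n :=
  \sum_(a < n) \sum_(b < n | (b%:Z - a%:Z == - (kap * n') %[mod n%:Z])%Z)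
    (un ^ kap * qpow (kap%:Q * (a%:Q + b%:Q - n%:Q) / (2 * n%:Q))) *:
      fermion_pair qpow b (kap%:Q / 2) a (- (kap%:Q / 2))
        (- l - (((kap * n' - a%:Z + b%:Z) %/ n%:Z)%Z + 1)) v.

Lemma tw_EE n n' l (v : boson_space R n) : tw_E qpow n' un l v = tw_field n' 1 l v.
Proof.
rewrite /tw_E /tw_field (mul1r n'); apply: eq_bigr => a _; apply: eq_bigr => b _.
by rewrite (expr1z un) -[1%:Q]/(1 : rat) (mul1r (a%:Q + b%:Q - n%:Q)).
Qed.

Lemma tw_FE n n' l (v : boson_space R n) : tw_F qpow n' un l v = tw_field n' (-1) l v.
Proof.
rewrite /tw_F /tw_field (mulN1r n') (opprK n'); apply: eq_bigr => a _; apply: eq_bigr => b _.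
have -> : un ^ (-1) = un^-1 by rewrite -exprz_inv expr1z.
have -> : (-1)%:Q = - 1 :> rat by rewrite rmorphN.
have -> : - 1 / 2 = - (1 / 2) :> rat by rewrite mulNr.
have -> : - 1 * (a%:Q + b%:Q - n%:Q) = - a%:Q - b%:Q + n%:Q by ring.
by rewrite opprK.
Qed.

(** If n does not divide kap n' the two components a and b of each term are distinct and
    the terms are those of [diff_op_split]; otherwise n = 1 and there is a single term,
    a = b = 0. *)
Lemma PhiN_tw_field n n' kap l (v : boson_space R n) : (0 < n)%N -> kap != 0 ->
    ((n%:Z %| kap * n')%Z -> n = 1%N) ->
  PhiN (tw_field n' kap l v) = diff_op qpow (mode_order n) n n' un kap l (PhiN v).
Proof.
move=> n_gt0 k0 hdvd; have [dv|ndv] := boolP (n%:Z %| kap * n')%Z; last first.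
  rewrite (diff_op_split q_neq0 qpowP un_neq0 n_gt0 ndv) /tw_field.
  rewrite (linear_bigsum (@PhiN_linear R n)); apply: eq_bigr => a _.
  rewrite (linear_bigsum (@PhiN_linear R n)); apply: eq_bigr => b hb.
  rewrite (linear_homo (@PhiN_linear R n)); rewrite (PhiN_fermion_pair n_gt0 qpowP) //.
  apply: contraNneq ndv => ab; move: hb; rewrite ab subrr.
  by rewrite eqz_mod_dvd opprK add0r.
(* The case n = 1, in which all congruences hold. *)
have n1 := hdvd dv; subst n.
rewrite diff_op_one /tw_field big_ord1 big_mkcond big_ord1.
have -> : ((ord0 : 'I_1)%:Z - (ord0 : 'I_1)%:Z == - (kap * n') %[mod 1%:Z])%Z by rewrite !modz1.
rewrite /fermion_pair; have -> : ((ord0 : 'I_1) == ord0) by [].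
have lP := @PhiN_linear R 1.
rewrite scalerA (linear_homo lP).
have -> : (ord0 : 'I_1)%:Q = 0 by [].
have -> : (ord0 : 'I_1)%:Z = 0 by [].
rewrite (diff_const_one q_neq0 q_not_root qpowP un k0).
have -> : - l - (((kap * n' - 0 + 0) %/ 1%:Z)%Z + 1) + 1 = - (n' * kap + l).
  by rewrite divz1; ring.
exact: (PhiN_vertex1 q_neq0 q_not_root qpowP un_neq0 k0).
Qed.

End TwistedFields.

Section TwistedModule.
Variable R : realType.
Variables (q : R[i]) (qpow : rat -> R[i]).
Hypotheses (q_neq0 : q != 0) (q_not_root : forall k : nat, (0 < k)%N -> q ^+ k != 1).
Hypothesis (qpowP : fractional_powers q qpow).
Variables (n : nat) (n_gt0 : (0 < n)%N) (n' : int).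
Hypothesis (hdvd : (n%:Z %| n')%Z -> n = 1%N).
Variables (un : R[i]) (un_neq0 : un != 0).

Lemma twisted_boson_module : exists2 rho, is_twisted_boson_rep qpow n' un rho
  & forall d (v : boson_space R n),
      PhiN (rho d v) = fermion_rep qpow (mode_order n) n n' un d (PhiN v).
Proof.
have lP := @PhiN_linear R n; have iP := @PhiN_inj R n n_gt0.
have [rho [rep h]] := transport q_neq0 q_not_root qpowP (mode_orderP n_gt0) n_gt0 n' un_neq0
  lP iP (@PhiN_charge R n n_gt0) (@PhiN_onto R n n_gt0).
exists rho => //; split=> // [v|k v k0|k v|k v].
- split; apply: iP; rewrite h; first by rewrite fermion_rep_dc (linear_homo lP).
  by rewrite fermion_rep_dc' (linear_homo lP).
- have kl : (0, k) != 0 :> (int * int)%type by rewrite xpair_eqE.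
  apply: iP; rewrite h (fermion_rep_dE _ _ _ _ _ _ kl) (linear_bigsum lP).
  rewrite -(sum_modes q_neq0 qpowP (mode_order n) n' un _ n_gt0 k0).
  by apply: eq_bigr => b _; rewrite (PhiN_boson n_gt0).
- have kl : (1, k) != 0 :> (int * int)%type by rewrite xpair_eqE.
  apply: iP; rewrite h (fermion_rep_dE _ _ _ _ _ _ kl) tw_EE.
  by rewrite (PhiN_tw_field q_neq0 q_not_root qpowP un_neq0) // mul1r.
have kl : (-1, k) != 0 :> (int * int)%type by rewrite xpair_eqE.
apply: iP; rewrite h (fermion_rep_dE _ _ _ _ _ _ kl) tw_FE.
by rewrite (PhiN_tw_field q_neq0 q_not_root qpowP un_neq0) // mulN1r dvdzE abszN -dvdzE.
Qed.

End TwistedModule.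

(** Two modules embedded in F with the same image and compatible actions. *)
Lemma rep_iso_intro (R : realType) (V W : lmodType R[i]) (F : lmodType R[i])
    (rho : diffq R -> V -> V) (rho' : diffq R -> W -> W)
    (f : V -> F) (g : W -> F) : linear f -> linear g -> injective f -> injective g ->
    (forall v, exists w, g w = f v) -> (forall w, exists v, f v = g w) ->
    (forall x v w, g w = f v -> g (rho' x w) = f (rho x v)) ->
  rep_iso rho rho'.
Proof.
move=> lf lg jf jg fg gf hr.
have [h hP] := choice fg; have [k kP] := choice gf.
have lh : linear h by move=> c x y; apply: jg; rewrite lg !hP lf.
pose h' : {linear V -> W} := HB.pack h (GRing.isLinear.Build _ _ _ _ h lh).
exists h'.
  by exists k => [v|w]; [apply: jf; rewrite kP hP | apply: jg; rewrite hP kP].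
move=> x v; rewrite -[LHS]/(h (rho x v)) -[h' v]/(h v); apply: jg.
by rewrite hP (hr x v (h v)).
Qed.

Theorem theorem4p3 (R : realType) (q : R[i]) (qpow : rat -> R[i])
    (q_neq0 : q != 0) (q_not_root : forall k : nat, (0 < k)%N -> q ^+ k != 1)
    (qpowP : fractional_powers q qpow)
    (n : nat) (n_gt0 : (0 < n)%N)
    (sigma : 'M[int]_2) (det_sigma : \det sigma = 1) (sigma_n : sigma 1 1 = n%:Z)
    (u un : R[i]) (u_neq0 : u != 0) (unP : un ^+ n = u) :
  exists rho : diffq R -> boson_space R n -> boson_space R n,
    [/\ is_twisted_boson_rep qpow (sigma 1 0) un rho,
        forall rho', is_twisted_boson_rep qpow (sigma 1 0) un rho' -> rho' =2 rho
      & exists2 rhoF : diffq R -> fock R unit -> fock R unit,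
          is_fock_module q qpow u rhoF & rep_iso rho (twist sigma rhoF)].
Proof.
have un_neq0 : un != 0 by apply: contraNneq u_neq0 => un0; rewrite -unP un0 expr0n gtn_eqF.
(* A common divisor of n' and n divides the determinant 1. *)
have hdvd : (n%:Z %| sigma 1%R 0%R)%Z -> n = 1%N.
  move=> /dvdzP[c hc]; move: det_sigma; rewrite det_mx2 sigma_n hc => e.
  have : (n%:Z %| 1%R)%Z by apply/dvdzP; exists (sigma 0 0 - sigma 0 1 * c); rewrite -e; ring.
  by rewrite dvdz1 => /eqP.
have [rho rhoP hrho] :=
  twisted_boson_module q_neq0 q_not_root qpowP n_gt0 hdvd un_neq0.
exists rho; split=> //.
  case: rhoP => r1 r2 r3 r4 r5 rho' [s1 s2 s3 s4 s5].
  apply: (rep_generated q_neq0 q_not_root qpowP s1 r1).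
  - by move=> v; have [-> _] := s2 v; have [-> _] := r2 v.
  - by move=> v; have [_ ->] := s2 v; have [_ ->] := r2 v.
  - by move=> k v k0; rewrite s3 // r3.
  - by move=> k v; rewrite s4 r4.
  - by move=> k v; rewrite s5 r5.
have ltP := mode_orderP n_gt0.
have [rhoF rhoFP hrhoF] := fock_module q_neq0 q_not_root qpowP u_neq0 ltP.
exists rhoF => //.
have gn0 := twist_gauge_neq0 q_neq0 qpowP n (sigma 0 1) un_neq0.
pose G := gauge (twist_gauge qpow n (sigma 0 1) un).
have lG : linear G := gauge_linear _.
apply: (rep_iso_intro (f := fun v => G (PhiN v)) (g := Phi1 (mode_order n))).
- exact: (linear_compf lG (@PhiN_linear R n)).
- exact: Phi1_linear.
- by move=> v w /(gauge_inj gn0) /(PhiN_inj n_gt0).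
- exact: (Phi1_inj ltP).
- move=> v; apply: (Phi1_onto ltP); apply: (gauge_neutral gn0); exact: PhiN_charge.
- move=> w; have [x cx e] := gauge_onto gn0 (@Phi1_charge R _ ltP w).
  by have [v hv] := PhiN_onto n_gt0 cx; exists v; rewrite hv.
move=> x v w e; rewrite hrho /twist hrhoF e.
exact/esym/(fermion_rep_sl2 q_neq0 qpowP ltP n_gt0 det_sigma sigma_n un_neq0 unP).
Qed.
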